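(* Let $\theta\in\mathbb N$, let $N\ge2$ be an integer and $\lambda\in\mathbb{GT}_N$. Then $$P_\lambda\big(x_1,x_2;N,q,q^\theta\big)=\frac{q^{-(N-\frac32)\theta^2+\frac12\theta}(1-q)^\theta}{\prod_{i=1}^\theta(1-q^{\theta N-i})}\cdot\frac{1}{\prod_{i=1}^{\theta(N-1)-1}(x_1-q^{i-\theta})(x_2-q^{i-\theta})}\times\Big(\frac1{x_1-x_2}\circ(D_{q,x_2}-D_{q,x_1})\Big)^\theta\Big\{\prod_{i=1}^2\Big(P_\lambda\big(x_i;N,q,q^\theta\big)\prod_{j=1}^{\theta N-1}(x_i-q^{j-\theta})\Big)\Big\},$$ where the power $\theta$ denotes the $\theta$-fold composition of the operator $f\mapsto\frac{1}{x_1-x_2}(D_{q,x_2}f-D_{q,x_1}f)$, and $D_{q,x_1},D_{q,x_2}$ are the linear operators with $D_{q,x_i}(x_1^{m_1}x_2^{m_2})=\frac{1-q^{m_i}}{1-q}x_1^{m_1}x_2^{m_2}$, $i=1,2$.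
   Context: $q$ is a formal variable. $\mathbb{GT}_N$ is the set of signatures of length $N$: $\lambda=(\lambda_1\ge\dots\ge\lambda_N)\in\mathbb Z^N$. For $\lambda\in\mathbb{GT}_N$ with $\lambda_N\ge 0$, $P_\lambda(x_1,\dots,x_N;q,t)$ is the (monic) Macdonald symmetric polynomial: these are the unique symmetric polynomials over $\mathbb C(q,t)$ with $P_\lambda=m_\lambda+\sum_{\mu<\lambda}c_{\lambda,\mu}m_\mu$ (dominance order, $m_\mu$ monomial symmetric polynomials) which are pairwise orthogonal for $(f,g)=\big[f(x_1,\dots,x_N)g(x_1^{-1},\dots,x_N^{-1})\prod_{i\ne j}\prod_{k\ge0}\frac{1-q^kx_ix_j^{-1}}{1-q^ktx_ix_j^{-1}}\big]_0$, $[\cdot]_0$ = constant term. For general $\lambda\in\mathbb{GT}_N$, $P_\lambda=(x_1\cdots x_N)^{-p}P_{(\lambda_1+p,\dots,\lambda_N+p)}$ for any integer $p\geq 0$ with $\lambda_N+p\ge0$ (well defined). For $1\le m\le N$ the Macdonald character is $$P_\lambda(x_1,\dots,x_m;N,q,t)=\frac{P_\lambda(x_1,\dots,x_m,1,t,\dots,t^{N-m-1};q,t)}{P_\lambda(1,t,\dots,t^{N-1};q,t)}.$$ The operator $D_{q,x_i}$ equals $\frac{T_{q,x_i}-1}{q-1}$, where $T_{q,x_i}$ replaces $x_i$ by $qx_i$; in this form it acts also on Laurent polynomials and rational functions in $x_1,x_2$ over $\mathbb C(q)$. *)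

(* Defs.v *)
From HB Require Import structures.
From mathcomp Require Import all_boot all_order all_fingroup all_algebra.
From mathcomp Require Import mpoly.
From mathcomp Require Import boolp classical_sets reals.
From mathcomp Require Import complex.

Set Implicit Arguments.
Unset Strict Implicit.
Unset Printing Implicit Defensive.

Import Order.TTheory GRing.Theory Num.Theory.
Local Open Scope ring_scope.
Local Open Scope quotient_scope.

Notation "x %:F" := (@FracField.tofrac _ x) : ring_scope.

(* The fields C(q), C(q,t) and C(q)(x_1,x_2).  In {poly {poly C}} = C[q][t]
   the inner indeterminate is q and the outer one is t. *)
Definition Cq (C : fieldType) : fieldType := {fraction {poly C}}.
Definition Cqt (C : fieldType) : fieldType := {fraction {poly {poly C}}}.
Definition Cqx (C : fieldType) : fieldType := {fraction {mpoly (Cq C)[2]}}.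

Definition q_Cq (C : fieldType) : Cq C := ('X : {poly C})%:F.
Definition q_Cqt (C : fieldType) : Cqt C := (('X : {poly C})%:P)%:F.
Definition t_Cqt (C : fieldType) : Cqt C := ('X : {poly {poly C}})%:F.

Definition Cq_to_Cqx (C : fieldType) (c : Cq C) : Cqx C :=
  (c%:MP : {mpoly (Cq C)[2]})%:F.
Definition q_Cqx (C : fieldType) : Cqx C := Cq_to_Cqx (q_Cq C).
Definition var (C : fieldType) (i : 'I_2) : Cqx C :=
  ('X_i : {mpoly (Cq C)[2]})%:F.

(* Partitions with at most N parts, encoded as exponent vectors. *)
Definition is_partition (N : nat) (mu : 'X_{1..N}) : bool :=
  [forall i : 'I_N, forall j : 'I_N, (i <= j)%N ==> (mu j <= mu i)%N].

Definition dominance_lt (N : nat) (mu lam : 'X_{1..N}) : bool :=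
  [&& mu != lam, mdeg mu == mdeg lam &
      [forall k : 'I_N, (\sum_(i < N | (i <= k)%N) mu i
                          <= \sum_(i < N | (i <= k)%N) lam i)%N]].

(* m_mu: the sum of the distinct monomials in the 'S_N-orbit of 'X_[mu]. *)
Definition monomial_sym (K : fieldType) (N : nat) (mu : 'X_{1..N}) :
    {mpoly K[N]} :=
  \sum_(m : 'X_{1..N < (mdeg mu).+1} |
          [exists s : 'S_N, [forall i, (m : 'X_{1..N}) i == mu (s i)]])
     'X_[m].

(* Laurent polynomials in x_1, ..., x_N are represented by elements of
   K[x][y] = {mpoly {mpoly K[N]}[N]}, where y_i stands for x_i^-1.  The monomial
   x^a y^b represents x^(a-b), so the constant term is the sum of the
   coefficients of all the x^b y^b; it does not depend on the representative. *)
Definition constant_term (K : fieldType) (N : nat)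
    (F : {mpoly {mpoly K[N]}[N]}) : K :=
  \sum_(b <- msupp F) (F@_b)@_b.

Definition ratio_xy (K : fieldType) (N : nat) (i j : 'I_N) :
    {mpoly {mpoly K[N]}[N]} :=
  ('X_i)%:MP * 'X_j.

(* The weight prod_(i != j) prod_(k >= 0)
     (1 - q^k x_i x_j^-1) / (1 - q^k t x_i x_j^-1)
   with the product cut at k < n and each geometric series
   (1 - q^k t x_i x_j^-1)^-1 = sum_l (q^k t x_i x_j^-1)^l cut at l < n. *)
Definition truncated_weight (C : fieldType) (N n : nat) :
    {mpoly {mpoly (Cqt C)[N]}[N]} :=
  let q := (q_Cqt C)%:MP%:MP in
  let t := (t_Cqt C)%:MP%:MP in
  \prod_(i < N) \prod_(j < N | j != i) \prod_(k < n)
    ((1 - q ^+ k * ratio_xy _ i j)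
     * \sum_(l < n) (q ^+ k * t * ratio_xy _ i j) ^+ l).

Definition truncated_form (C : fieldType) (N : nat)
    (f g : {mpoly (Cqt C)[N]}) (n : nat) : Cqt C :=
  constant_term (f%:MP * map_mpoly (@mpolyC N (Cqt C)) g
                 * truncated_weight C N n).

(* Convergence to 0 in the (q,t)-adic topology of the fraction field of
   C[[q,t]]: after multiplication by a fixed nonzero d in C[q,t], the terms are
   eventually in C[q,t] and in every power (q,t)^n of the maximal ideal. *)
Definition formally_tends_to_0 (C : fieldType) (v : nat -> Cqt C) : Prop :=
  exists2 d : {poly {poly C}}, d != 0 &
    forall n : nat, exists K0 : nat, forall K : nat, (K0 <= K)%N ->
      exists2 r : {poly {poly C}}, (d%:F : Cqt C) * v K = r%:F &
        forall a b : nat, (a + b < n)%N -> (r`_b)`_a = 0.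

(* (f, g) = 0: the coefficients of the truncated weights converge in C[[q,t]] to
   those of the infinite product, so (f, g) is the limit of the truncations. *)
Definition macdonald_orthogonal (C : fieldType) (N : nat)
    (f g : {mpoly (Cqt C)[N]}) : Prop :=
  formally_tends_to_0 (truncated_form f g).

(* P lam is constrained only when lam is a partition. *)
Definition is_macdonald (C : fieldType) (N : nat)
    (P : 'X_{1..N} -> {mpoly (Cqt C)[N]}) : Prop :=
  [/\ forall lam, is_partition lam -> P lam \is symmetric,
      forall lam, is_partition lam ->
        exists c : 'X_{1..N} -> Cqt C,
          P lam = monomial_sym _ lam
            + \sum_(mu : 'X_{1..N < (mdeg lam).+1} |
                      is_partition mu && dominance_lt mu lam)
                 c mu *: monomial_sym _ mu
    & forall lam mu, is_partition lam -> is_partition mu -> lam != mu ->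
        macdonald_orthogonal (P lam) (P mu)].

(* Substitution t = q^theta: the value of a/b is a(q,q^theta)/b(q,q^theta) for
   any representation with b(q,q^theta) != 0, and 0 when there is none. *)
Definition subst_t_spec (C : fieldType) (theta : nat) (c : Cqt C) (v : Cq C) :
    Prop :=
  exists a b : {poly {poly C}},
    [/\ b.['X^theta] != 0, c = a%:F / b%:F
      & v = (a.['X^theta])%:F / (b.['X^theta])%:F].

Definition subst_t (C : fieldType) (theta : nat) (c : Cqt C) : Cq C :=
  xget 0 [set v | subst_t_spec theta c v]%classic.

Definition is_signature (N : nat) (lam : N.-tuple int) : bool :=
  sorted >=%R lam.

(* The least p >= 0 such that lam_N + p >= 0 (for a signature lam). *)
Definition sig_shift (N : nat) (lam : N.-tuple int) : nat :=
  `|(Num.min 0 (last 0 lam))%R|%N.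

Definition shifted_partition (N : nat) (lam : N.-tuple int) : 'X_{1..N} :=
  [multinom `|(tnth lam i + (sig_shift lam)%:Z)%R|%N | i < N].

(* P_lam(v_1, ..., v_N; q, q^theta) for v_1, ..., v_N in C(q)(x_1,x_2). *)
Definition macdonald_at (C : fieldType) (N : nat)
    (P : 'X_{1..N} -> {mpoly (Cqt C)[N]}) (theta : nat) (lam : N.-tuple int)
    (v : 'I_N -> Cqx C) : Cqx C :=
  (\prod_(i < N) v i) ^- sig_shift lam
  * mmap (fun c => Cq_to_Cqx (subst_t theta c)) v (P (shifted_partition lam)).

(* P_lam(xs_1, ..., xs_m; N, q, q^theta), where m = size xs. *)
Definition macdonald_char (C : fieldType) (N : nat)
    (P : 'X_{1..N} -> {mpoly (Cqt C)[N]}) (theta : nat) (lam : N.-tuple int)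
    (xs : seq (Cqx C)) : Cqx C :=
  let t := q_Cqx C ^+ theta in
  macdonald_at P theta lam
    (fun i => nth 0 (xs ++ mkseq (fun k => t ^+ k) (N - size xs)) i)
  / macdonald_at P theta lam (fun i => t ^+ i).

Definition q_shift_poly (C : fieldType) (i : 'I_2) (p : {mpoly (Cq C)[2]}) :
    {mpoly (Cq C)[2]} :=
  p \mPo [tuple (if j == i then q_Cq C *: 'X_j else 'X_j) | j < 2].

(* T_{q,x_i} on C(q)(x_1,x_2).  Substituting x_i -> q x_i is injective on
   polynomials, so the choice of the representing fraction is immaterial. *)
Definition q_shift (C : fieldType) (i : 'I_2) (f : Cqx C) : Cqx C :=
  let r := generic_quotient.repr (f : {fraction {mpoly (Cq C)[2]}}) in
  (q_shift_poly i \n_r)%:F / (q_shift_poly i \d_r)%:F.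

Definition q_deriv (C : fieldType) (i : 'I_2) (f : Cqx C) : Cqx C :=
  (q_shift i f - f) / (q_Cqx C - 1).

Definition diff_step (C : fieldType) (f : Cqx C) : Cqx C :=
  (var C 0 - var C 1)^-1 * (q_deriv 1 f - q_deriv 0 f).

(* Main.v *)
(* Write t = q^theta.  Clearing denominators, P_lam specializes at t = q^theta to a symmetric
   polynomial p that is orthogonal, for the polynomial weight
   prod_(i != j) prod_(k < theta) (1 - q^k x_i / x_j), to all lower symmetric polynomials; its
   leading coefficient does not vanish because the form is nondegenerate, as its limit q -> 0
   shows.  Noumi's operators of row type sum_(|mu| = r) w(mu) U_mu(x) f(q^mu x) are triangular and
   self-adjoint, so p is an eigenfunction.  At x = (q^s t^(N-1), t^(N-2), ..., t, 1) an involution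
   cancels every mu with more than two rows, and the eigenvalue equation becomes a Pieri relation:
   g(r) g(s) = sum_k G(r-k) G(s-k) Psi(r+s-k, k), where g and Psi are multiples of the values of p
   at (q^m t^(N-1), t^(N-2), ...) and (q^a t^(N-1), q^b t^(N-2), t^(N-3), ...).
   On the points x_1 = q^a t^(N-1), x_2 = q^b t^(N-2) with a > b, the theta-th power of
   (x_1 - x_2)^-1 (T_2 - T_1) expands with explicit coefficients; inserting the Pieri relation,
   the inner sums telescope to 0 for k < b, and k = b leaves the value of p at the two-row point.
   These points are Zariski dense. *)
Require Import Defs.
From HB Require Import structures.
From mathcomp Require Import all_boot all_order all_fingroup all_algebra.
From mathcomp Require Import ring zify.
From mathcomp Require Import ssrcomplements mpoly.
From mathcomp Require Import boolp classical_sets reals.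
From mathcomp Require Import complex.

Import Order.TTheory GRing.Theory Num.Theory.
Local Open Scope ring_scope.

Set Implicit Arguments.
Unset Strict Implicit.
Unset Printing Implicit Defensive.

(** * Constant terms and kernels *)

(** One mechanism serves three times. On x_j = q^k x_i the terms of Noumi's sum with mu_i >= k
    cancel in pairs and those with mu_i < k < mu_i + theta contain a zero factor, so only mu_i <= k
    - theta survives. For k < theta nothing is left: the numerator is divisible by the common
    denominator and polynomials are preserved. For k = theta row i is killed, which leaves two rows
    at the lattice points. For k = s + theta the second row is at most s. The eigenvalue is never
    computed: at s = 0 the relation has a single term, which expresses it through g(r). Coefficients
    of P_lam might have poles at t = q^theta, and orthogonality is only a (q,t)-adic limit; so a
    multiple of P_lam regular and nonzero there is specialized first, and nondegeneracy excludes the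
    poles afterwards. At q = 0 the form pairs V f with V g, V the Vandermonde product, and is
    definite against complex conjugates. On the lattice prod_j (x_i - q^(j - theta)) is the
    normalization turning values of p into g, and its zeros cut the expanded operator exactly where
    the Pieri relation ceases to apply. *)

Section Evaluation.
Variables (N : nat) (R : nzRingType).

Lemma eq_mmap (S : nzRingType) (f g : R -> S) (v w : 'I_N -> S) (p : {mpoly R[N]}) :
  f =1 g -> v =1 w -> mmap f v p = mmap g w p.
Proof. by move=> /funext -> /funext ->. Qed.

Lemma rmorph_mmap (S T : nzRingType) (phi : {rmorphism S -> T}) (f : R -> S)
    (v : 'I_N -> S) (p : {mpoly R[N]}) :
  phi (mmap f v p) = mmap (phi \o f) (phi \o v) p.
Proof.
rewrite /mmap rmorph_sum; apply: eq_bigr => m _.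
by rewrite rmorphM /mmap1 rmorph_prod; congr (_ * _); apply: eq_bigr => i _; rewrite rmorphXn.
Qed.

Lemma mmap_comp_mpoly (K : nat) (S : comNzRingType) (f : {rmorphism R -> S})
    (v : 'I_K -> S) (w : 'I_N -> {mpoly R[K]}) (p : {mpoly R[N]}) :
  mmap f v (mmap (@mpolyC K R) w p) = mmap f (fun i => mmap f v (w i)) p.
Proof.
rewrite [LHS](rmorph_mmap (mmap f v)); apply: eq_mmap => // c /=.
exact: mmapC.
Qed.

Lemma mmap_sym (S : comNzRingType) (f : {rmorphism R -> S}) (v : 'I_N -> S)
    (s : 'S_N) (p : {mpoly R[N]}) :
  p \is symmetric -> mmap f (v \o s) p = mmap f v p.
Proof.
move=> /issymP/(_ s) sp; rewrite -[in RHS]sp /msym mmap_comp_mpoly.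
by apply: eq_mmap => // i /=; rewrite mmapX mmap1U.
Qed.

Lemma mmap_perm_eq (S : comNzRingType) (f : {rmorphism R -> S}) (s t : N.-tuple S)
    (p : {mpoly R[N]}) :
  p \is symmetric -> perm_eq s t -> mmap f (tnth s) p = mmap f (tnth t) p.
Proof.
move=> sp /tuple_permP [r e]; rewrite -(mmap_sym f (tnth t) r sp).
by apply: eq_mmap => // i /=; rewrite -(tnth_mktuple (fun i => tnth t (r i))); congr (tnth _ _); apply: val_inj.
Qed.

End Evaluation.

(** * The constant term pairing and its adjoints *)

Section Pairing.
Variables (N : nat) (K : comNzRingType).
Implicit Types (A B : {mpoly K[N]}) (c : 'I_N -> K).

(** The constant term of A(x) B(1/x), for which monomials are orthonormal. It makes Laurent
    polynomials unnecessary. *)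
Definition mdot A B : K := \sum_(m <- msupp A) A@_m * B@_m.

Lemma mdotwE k A B : (msize A <= k)%N ->
  mdot A B = \sum_(m : 'X_{1..N < k}) A@_m * B@_m.
Proof.
move=> le_Ak; rewrite /mdot (big_mksub 'X_{1..N < k}) ?msupp_uniq //=; first last.
  by move=> x /msize_mdeg_lt /leq_trans; apply.
by rewrite big_rmcond //= => j /memN_msupp_eq0 ->; rewrite mul0r.
Qed.

Lemma mdotC A B : mdot A B = mdot B A.
Proof.
rewrite (mdotwE _ (leq_maxl (msize A) (msize B))) (mdotwE _ (leq_maxr (msize A) (msize B))).
by apply: eq_bigr => m _; rewrite mulrC.
Qed.

Lemma mdot_is_additive A : additive (mdot A).
Proof.
move=> B C; rewrite /mdot -sumrB; apply: eq_bigr => m _.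
by rewrite mcoeffB mulrBr.
Qed.
HB.instance Definition _ A := GRing.isAdditive.Build {mpoly K[N]} K (mdot A)
  (mdot_is_additive A).

Lemma mdotZr (b : K) A B : mdot A (b *: B) = b * mdot A B.
Proof.
by rewrite /mdot mulr_sumr; apply: eq_bigr => m _; rewrite mcoeffZ mulrCA.
Qed.
Lemma mdotZl (b : K) A B : mdot (b *: A) B = b * mdot A B.
Proof. by rewrite mdotC mdotZr mdotC. Qed.
Lemma mdotBl A B C : mdot (A - B) C = mdot A C - mdot B C.
Proof. by rewrite !(mdotC _ C) raddfB. Qed.
Lemma mdotBr A B C : mdot A (B - C) = mdot A B - mdot A C.
Proof. exact: raddfB. Qed.
Lemma mdot_suml (I : Type) (r : seq I) (P : pred I) (F : I -> {mpoly K[N]}) B :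
  mdot (\sum_(i <- r | P i) F i) B = \sum_(i <- r | P i) mdot (F i) B.
Proof. by rewrite mdotC raddf_sum; apply: eq_bigr => i _; rewrite mdotC. Qed.
Lemma mdot_sumr (I : Type) (r : seq I) (P : pred I) A (F : I -> {mpoly K[N]}) :
  mdot A (\sum_(i <- r | P i) F i) = \sum_(i <- r | P i) mdot A (F i).
Proof. exact: raddf_sum. Qed.
Lemma mdotX m B : mdot 'X_[m] B = B@_m.
Proof. by rewrite /mdot msuppX big_seq1 mcoeffX eqxx mul1r. Qed.
Lemma mdot_mulX m A B : mdot ('X_[m] * A) ('X_[m] * B) = mdot A B.
Proof.
rewrite [A]mpolyE mulr_sumr !mdot_suml; apply: eq_bigr => k _.
by rewrite -scalerAr !mdotZl -mpolyXD !mdotX [_ * B]mulrC mcoeffMX.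
Qed.

Definition mscale c : {mpoly K[N]} -> {mpoly K[N]} :=
  mmap (@mpolyC N K) (fun i => c i *: 'X_i).
HB.instance Definition _ c := GRing.RMorphism.on (mscale c).

Lemma mscaleX c m : mscale c 'X_[m] = (\prod_i c i ^+ m i) *: 'X_[m].
Proof.
rewrite /mscale mmapX /mmap1 mpolyXE_id -scaler_prod.
by apply: eq_bigr => i _; rewrite exprZn.
Qed.
Lemma mscaleZ c a A : mscale c (a *: A) = a *: mscale c A.
Proof. by rewrite /mscale mmapZ mul_mpolyC. Qed.
Lemma mcoeff_mscale c A m : (mscale c A)@_m = (\prod_i c i ^+ m i) * A@_m.
Proof.
rewrite [A in LHS]mpolyE (raddf_sum (mscale c)) [A in RHS]mpolyE !raddf_sum mulr_sumr.
apply: eq_bigr => k _ /=; rewrite mscaleZ mscaleX !mcoeffZ mcoeffX.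
by case: eqVneq => [->|_]; rewrite ?mulr0 // mulrCA.
Qed.

(** Monomials are orthonormal and are eigenvectors of every scaling, so scalings are self-adjoint.
    The q-shifts in Noumi's operators are such scalings. *)
Lemma mdot_mscale c A B : mdot (mscale c A) B = mdot A (mscale c B).
Proof.
have le : (msize (mscale c A) <= maxn (msize (mscale c A)) (msize A))%N by rewrite leq_maxl.
have le' : (msize A <= maxn (msize (mscale c A)) (msize A))%N by rewrite leq_maxr.
rewrite (mdotwE _ le) (mdotwE _ le'); apply: eq_bigr => m _.
by rewrite !mcoeff_mscale; ring.
Qed.

(* [U] times a monomial [1 / M] has [U'] as its adjoint for the constant term pairing
   [A, B |-> CT (A(x) B(1/x))]. *)
Definition adjoint_mul (U M U' : {mpoly K[N]}) :=
  forall A B, mdot (U * A) (M * B) = mdot A (U' * B).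

Lemma adjoint_mulM U1 M1 V1 U2 M2 V2 : adjoint_mul U1 M1 V1 -> adjoint_mul U2 M2 V2 ->
  adjoint_mul (U1 * U2) (M1 * M2) (V1 * V2).
Proof. by move=> h1 h2 A B; rewrite -!mulrA h1 (mulrCA V1) h2 (mulrCA V2). Qed.

Lemma adjoint_mul_prod (I : Type) (r : seq I) (P : pred I) (U M V : I -> {mpoly K[N]}) :
  (forall i, P i -> adjoint_mul (U i) (M i) (V i)) ->
  adjoint_mul (\prod_(i <- r | P i) U i) (\prod_(i <- r | P i) M i) (\prod_(i <- r | P i) V i).
Proof.
move=> h; elim: r => [|i r IH]; first by move=> A B; rewrite !big_nil !mul1r.
rewrite !big_cons; case: ifP => // Pi; apply: adjoint_mulM => //; exact: h.
Qed.

Lemma adjoint_mul_lin (a b : K) i j :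
  adjoint_mul (a *: 'X_j - b *: 'X_i) ('X_i * 'X_j) (a *: 'X_i - b *: 'X_j).
Proof.
move=> A B; rewrite !mulrBl mdotBl mdotBr -!scalerAl !mdotZl !mdotZr.
congr (_ * _ - _ * _); first by rewrite ['X_i * _]mulrC -!mulrA mdot_mulX.
by rewrite -!mulrA mdot_mulX.
Qed.

End Pairing.

Section Kernel.
Variables (N a : nat).

Definition vdm (E : comNzRingType) (z : 'I_N -> E) : E :=
  \prod_(p : 'I_N * 'I_N | (p.1 < p.2)%N) (z p.2 - z p.1).

Definition cross (E : comNzRingType) (q : E) (x z : 'I_N -> E) : E :=
  \prod_(p : 'I_N * 'I_N | p.1 != p.2) \prod_(k < a) (x p.2 - q ^+ k.+1 * z p.1).

(** The factors with equal indices left out of [cross]. Only the product of the two is invariant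
    under permuting z alone, and at z = q^mu x this one supplies the weight in Noumi's operator. *)
Definition diagonal (E : comNzRingType) (q : E) (x z : 'I_N -> E) : E :=
  \prod_i \prod_(k < a) (x i - q ^+ k.+1 * z i).

Section Ring.
Variables (E : comNzRingType) (q : E).
Implicit Types (x z : 'I_N -> E) (s : 'S_N).

Lemma vdm_perm s z : vdm (z \o s) = (-1) ^+ s * vdm z.
Proof.
have vdmE y : vdm y = \det (Vandermonde N (\row_i y i)).
  rewrite det_Vandermonde pair_big_dep; apply: eq_bigr => p _.
  by rewrite !mxE.
rewrite !vdmE.
have -> : Vandermonde N (\row_i (z \o s) i) = col_perm s (Vandermonde N (\row_i z i)).
  by apply/matrixP => i j; rewrite !mxE.
by rewrite col_permE det_mulmx det_perm odd_permV mulrC.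
Qed.

Lemma cross_diagonal x z : cross q x z * diagonal q x z =
  \prod_(p : 'I_N * 'I_N) \prod_(k < a) (x p.2 - q ^+ k.+1 * z p.1).
Proof.
rewrite [RHS](bigID (fun p : 'I_N * 'I_N => p.1 != p.2)) /=; congr (_ * _).
under [RHS]eq_bigl do rewrite negbK eq_sym.
rewrite -(pair_big_dep xpredT (fun i j : 'I_N => j == i)
  (fun i j => \prod_(k < a) (x j - q ^+ k.+1 * z i))) /=.
by apply: eq_bigr => i _; rewrite big_pred1_eq.
Qed.

Lemma cross_diagonal_perm s x z :
  cross q x (z \o s) * diagonal q x (z \o s) = cross q x z * diagonal q x z.
Proof.
have inj_s : injective (fun p : 'I_N * 'I_N => (s p.1, p.2)).
  by move=> [i j] [i' j'] /= [/perm_inj -> ->].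
by rewrite !cross_diagonal [RHS](reindex_inj inj_s).
Qed.

Lemma cross_perm2 s x z : cross q (x \o s) (z \o s) = cross q x z.
Proof.
have inj_s : injective (fun p : 'I_N * 'I_N => (s p.1, s p.2)).
  by move=> [i j] [i' j'] /= [/perm_inj -> /perm_inj ->].
rewrite /cross [RHS](reindex_inj inj_s) /=; apply: eq_bigl => p.
by rewrite (inj_eq (@perm_inj _ s)).
Qed.

End Ring.

Lemma rmorph_vdm (E E' : comNzRingType) (phi : {rmorphism E -> E'}) z :
  phi (vdm z) = vdm (phi \o z).
Proof. by rewrite rmorph_prod; apply: eq_bigr => p _; rewrite rmorphB. Qed.

Lemma rmorph_cross (E E' : comNzRingType) (phi : {rmorphism E -> E'}) q x z :
  phi (cross q x z) = cross (phi q) (phi \o x) (phi \o z).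
Proof.
rewrite rmorph_prod; apply: eq_bigr => p _; rewrite rmorph_prod.
by apply: eq_bigr => k _; rewrite rmorphB rmorphM rmorphXn.
Qed.

End Kernel.

(** * The exchange involution on compositions *)

Section Compositions.
Variables (N r : nat).
Implicit Types (mu : {ffun 'I_N -> 'I_r.+1}).

Definition is_comp mu := (\sum_i (mu i : nat) == r)%N.

(** For k <= mu j this bounds mu i + k by r, so that [inord] in [swap_comp] never falls back on its
    default. *)
Lemma is_comp_le2 mu (i j : 'I_N) : i != j -> is_comp mu -> (mu i + mu j <= r)%N.
Proof.
move=> nij /eqP; rewrite (bigD1 i) //= (bigD1 j) /= 1?eq_sym // addnA.
by lia.
Qed.

(* On [x i = q ^+ k * x j], exchanging the values [z i] and [z j] of [z = q ^ mu * x]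
   amounts to the substitution [(mu i, mu j) |-> (mu j - k, mu i + k)]. *)
Definition swap_comp (k : nat) (i j : 'I_N) mu : {ffun 'I_N -> 'I_r.+1} :=
  [ffun l => if l == i then inord (mu j - k) else if l == j then inord (mu i + k) else mu l].

Lemma swap_compE k i j mu l : i != j -> is_comp mu -> (k <= mu j)%N ->
  swap_comp k i j mu l = (if l == i then mu j - k else if l == j then mu i + k else mu l)%N :> nat.
Proof.
move=> nij cmu kj; rewrite ffunE; have := is_comp_le2 nij cmu.
by case: eqP => _; [|case: eqP => _ //]; move=> h; rewrite inordK //; lia.
Qed.

Lemma swap_comp_is_comp k i j mu : i != j -> is_comp mu -> (k <= mu j)%N ->
  is_comp (swap_comp k i j mu).
Proof.
move=> nij cmu kj; rewrite /is_comp; under eq_bigr do rewrite swap_compE //.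
move: (cmu); rewrite /is_comp (bigD1 i) //= (bigD1 j) /= 1?eq_sym // => /eqP e.
rewrite (bigD1 i) //= (bigD1 j) /= 1?eq_sym //.
rewrite eqxx (eq_sym j) (negPf nij) eqxx.
rewrite (eq_bigr (fun l => mu l : nat)) => [|l /andP[/negPf -> /negPf ->] //].
apply/eqP; rewrite {1}e !addnA; congr (_ + _)%N; lia.
Qed.

Lemma swap_compK k i j mu : i != j -> is_comp mu -> (k <= mu j)%N ->
  swap_comp k i j (swap_comp k i j mu) = mu.
Proof.
move=> nij cmu kj; apply/ffunP => l; apply: val_inj => /=.
have cs := swap_comp_is_comp nij cmu kj.
have nji : (j == i) = false by rewrite eq_sym (negPf nij).
have ej : swap_comp k i j mu j = (mu i + k)%N :> nat by rewrite swap_compE // nji eqxx.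
rewrite swap_compE // ?ej ?leq_addl // !swap_compE // eqxx.
by case: eqP => [->|_]; [rewrite addnK|case: eqP => [->|_]; rewrite ?subnK].
Qed.

Variables (E : idomainType).
Hypothesis char2 : 2%:R != 0 :> E.

(** [swap_comp] exchanges the values z_i and z_j, under which G changes sign, so the sum is its own
    negative. Compositions fixed by the exchange need no separate treatment, at the price of
    [char2]. The selection Q must be blind to the coordinates i and j in order to be preserved. *)
Lemma swap_sum0 (q : E) (x : 'I_N -> E) (G : ('I_N -> E) -> E) (Q : pred {ffun 'I_N -> 'I_r.+1})
    (k : nat) (i j : 'I_N) :
  i != j -> x i = q ^+ k * x j ->
  (forall z, G (z \o tperm i j) = - G z) ->
  (forall mu mu', (forall l, l != i -> l != j -> mu l = mu' l) -> Q mu = Q mu') ->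
  \sum_(mu | [&& is_comp mu, Q mu & (k <= mu j)%N]) G (fun l => q ^+ mu l * x l) = 0.
Proof.
move=> nij xij Ganti Qloc; pose P mu := [&& is_comp mu, Q mu & (k <= mu j)%N]; set S := \sum_(mu | _) _.
suff SN : S = - S.
  have /eqP : S *+ 2 = 0 by rewrite mulr2n {1}SN addNr.
  by rewrite -mulr_natl mulf_eq0 (negPf char2) => /eqP.
have Pswap mu : P mu -> P (swap_comp k i j mu).
  case/and3P => cmu Qmu kj; rewrite /P swap_comp_is_comp //= (Qloc _ mu) ?Qmu /=; last first.
    by move=> l /negPf li /negPf lj; rewrite ffunE li lj.
  by rewrite swap_compE // eq_sym (negPf nij) eqxx leq_addl.
rewrite {1}/S (reindex_onto (swap_comp k i j) (swap_comp k i j)) /=; last first.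
  by move=> mu /and3P[*]; apply: swap_compK.
rewrite -sumrN; apply: eq_big => [mu|mu].
  apply/andP/idP => [[/Pswap h /eqP e]|h]; first by rewrite e in h.
  by split; [exact: Pswap|case/and3P: h => *; rewrite swap_compK].
case/andP => /Pswap + /eqP e; rewrite {}e => /and3P[cmu _ kj].
rewrite -Ganti; congr G; apply/funext => l /=.
rewrite swap_compE //; case: eqVneq => [->|li].
  by rewrite tpermL xij mulrA -exprD subnK.
case: eqVneq => [->|lj]; first by rewrite tpermR xij mulrA -exprD.
by rewrite tpermD // eq_sym.
Qed.

End Compositions.

(** * Noumi's operators at t = q^theta *)

Section NoumiSum.
Variables (F : fieldType) (q : F) (N a r : nat).

(** At t = q^(a+1) the ratio (t u; q)_m / (q u; q)_m in Noumi's coefficients equals (q^(m+1) u; q)_a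
    / (q u; q)_a. The numerators for u = 1 form this weight, those for u = x_i / x_j with i != j
    form [cross]; the constant (q; q)_a^N is dropped. *)
Definition noumi_weight (mu : 'I_N -> nat) : F := \prod_i \prod_(k < a) (1 - q ^+ (k.+1 + mu i)).

Section Ring.
Variables (E : idomainType) (iota : {rmorphism F -> E}).
Implicit Types (x z : 'I_N -> E) (f : {mpoly F[N]}).

Definition qscale x (mu : {ffun 'I_N -> 'I_r.+1}) : 'I_N -> E :=
  fun l => iota q ^+ mu l * x l.

(* At [t = q ^+ a.+1], the sum over [|mu| = r] defining Noumi's q-difference operator of row
   type, multiplied by its common denominator [vdm x * cross (iota q) x x]. *)
Definition noumi x f : E :=
  \sum_(mu | is_comp mu) iota (noumi_weight (fun i => mu i)) *
     (vdm (qscale x mu) * cross a (iota q) x (qscale x mu) * mmap iota (qscale x mu) f).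

Lemma diagonal_qscale x mu :
  diagonal a (iota q) x (qscale x mu) = iota (noumi_weight (fun i => mu i)) * (\prod_i x i) ^+ a.
Proof.
rewrite /diagonal /noumi_weight rmorph_prod -prodrXl.
apply: etrans (big_split _ _ _ _ _); apply: eq_bigr => i _ /=.
have -> : x i ^+ a = \prod_(k < a) x i by rewrite prodr_const card_ord.
rewrite rmorph_prod.
apply: etrans (big_split _ _ _ _ _); apply: eq_bigr => k _ /=.
by rewrite /qscale rmorphB rmorph1 rmorphXn exprD; ring.
Qed.

Hypothesis char2 : 2%:R != 0 :> E.

(** A summand of [noumi] times (prod x)^a. The weight then turns into [diagonal], and the summand
    becomes a function of x and z that is antisymmetric in z, as [swap_sum0] demands. *)
Definition noumi_term x f z : E :=
  vdm z * (cross a (iota q) x z * diagonal a (iota q) x z) * mmap iota z f.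

Lemma noumi_termE x f :
  (\prod_i x i) ^+ a * noumi x f = \sum_(mu | is_comp mu) noumi_term x f (qscale x mu).
Proof.
rewrite mulr_sumr; apply: eq_bigr => mu _.
by rewrite /noumi_term diagonal_qscale; ring.
Qed.

Lemma noumi_term_restrict x f (Q : pred {ffun 'I_N -> 'I_r.+1}) (k : nat) (i j : 'I_N) :
  f \is symmetric -> i != j -> x j = iota q ^+ k * x i ->
  (forall mu mu' : {ffun 'I_N -> 'I_r.+1}, (forall l, l != i -> l != j -> mu l = mu' l) -> Q mu = Q mu') ->
  \sum_(mu | is_comp mu && Q mu) noumi_term x f (qscale x mu) =
  \sum_(mu | [&& is_comp mu, Q mu & (mu i + a < k)%N]) noumi_term x f (qscale x mu).
Proof.
move=> sf nij xji Qloc; rewrite (bigID (fun mu : {ffun 'I_N -> 'I_r.+1} => k <= mu i)%N) /=.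
rewrite [X in X + _](_ : _ = 0) ?add0r; last first.
  have nji : j != i by rewrite eq_sym.
  apply: etrans (@swap_sum0 N r E char2 (iota q) x (noumi_term x f) Q k j i nji xji _ _).
  - by apply: eq_big => [mu|//]; rewrite andbA.
  - move=> z; rewrite /noumi_term vdm_perm cross_diagonal_perm odd_tperm nji mmap_sym //=.
    by rewrite expr1; ring.
  - by move=> mu mu' h; apply: Qloc => l li lj; apply: h.
rewrite [LHS](bigID (fun mu : {ffun 'I_N -> 'I_r.+1} => mu i + a < k)%N) /= addrC.
rewrite big1 ?add0r => [|mu /andP[/andP[_]]].
  apply: eq_bigl => mu; rewrite -!andbA; do 2![congr (_ && _)].
  by apply/idP/idP; lia.
(* For mu i < k <= mu i + a, [cross] contains x_j - q^(k - mu i) z_i, which is zero. *)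
rewrite -ltnNge -leqNgt => h1 h2; rewrite /noumi_term cross_diagonal (bigD1 (i, j)) //=.
have lt_a : ((k - mu i).-1 < a)%N by lia.
rewrite (bigD1 (Ordinal lt_a)) //= xji.
have -> : iota q ^+ k * x i - iota q ^+ (k - mu i).-1.+1 * qscale x mu i = 0.
  by rewrite /qscale mulrA -exprD (_ : ((k - mu i).-1.+1 + mu i = k)%N) ?subrr //; lia.
by ring.
Qed.

Lemma noumi_vanish x f (k : nat) (i j : 'I_N) :
  f \is symmetric -> i != j -> (k <= a)%N -> (forall l, x l != 0) ->
  x j = iota q ^+ k * x i -> noumi x f = 0.
Proof.
move=> sf nij ka x0 xji; have : (\prod_i x i) ^+ a * noumi x f = 0.
  rewrite noumi_termE; transitivity (\sum_(mu | @is_comp N r mu && xpredT mu) noumi_term x f (qscale x mu)).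
    by apply: eq_bigl => mu; rewrite andbT.
  rewrite (noumi_term_restrict sf nij xji) // big1 // => mu /and3P[_ _].
  by rewrite ltnNge (leq_trans ka) ?leq_addl.
by move/eqP; rewrite mulf_eq0 expf_eq0 prodf_seq_eq0 => /orP[/andP[_ /hasP[l _]]|/eqP //]; rewrite (negPf (x0 l)).
Qed.

Lemma noumi_perm x f (s : 'S_N) : f \is symmetric ->
  noumi (x \o s) f = (-1) ^+ s * noumi x f.
Proof.
move=> sf; have bij : bijective (fun mu : {ffun 'I_N -> 'I_r.+1} => [ffun i => mu (s i)]).
  exists (fun mu : {ffun 'I_N -> 'I_r.+1} => [ffun i => mu (s^-1%g i)]) => mu;
    by apply/ffunP => i; rewrite !ffunE ?permK ?permKV.
rewrite /noumi mulr_sumr (reindex _ (onW_bij _ bij)) /=; apply: eq_big => [mu|mu _].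
  rewrite /is_comp [in RHS](reindex_inj (@perm_inj _ s)) /=.
  by under eq_bigr do rewrite ffunE.
have -> : qscale (x \o s) [ffun i => mu (s i)] = qscale x mu \o s.
  by apply/funext => i; rewrite /qscale /= ffunE.
rewrite vdm_perm cross_perm2 mmap_sym //.
have -> : noumi_weight (fun i => [ffun i => mu (s i)] i) = noumi_weight (fun i => mu i).
  rewrite /noumi_weight [RHS](reindex_inj (@perm_inj _ s)) /=.
  by apply: eq_bigr => i _; apply: eq_bigr => k _; rewrite ffunE.
rewrite -!mulrA; set A := iota _; set B := vdm _; set C := cross _ _ _ _; set D := mmap _ _ _.
by rewrite [A * _]mulrCA.
Qed.

End Ring.

Lemma rmorph_noumi (E E' : idomainType) (iota : {rmorphism F -> E}) (phi : {rmorphism E -> E'}) x f :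
  phi (noumi iota x f) = noumi (phi \o iota) (phi \o x) f.
Proof.
rewrite rmorph_sum; apply: eq_bigr => mu _.
have e : phi \o qscale iota x mu = qscale (phi \o iota) (phi \o x) mu.
  by apply/funext => l; rewrite /qscale /= rmorphM rmorphXn.
by rewrite !rmorphM rmorph_vdm rmorph_cross rmorph_mmap e.
Qed.

End NoumiSum.

(** * Divisibility by the common denominator *)

Section Hyperplanes.
Variables (F : fieldType) (N : nat).
Implicit Types (f g : {mpoly F[N]}) (i j : 'I_N) (c : F).

Definition restrict_var i j c (l : 'I_N) : {mpoly F[N]} :=
  if l == j then c *: 'X_i else 'X_l.

Definition restrict i j c : {mpoly F[N]} -> {mpoly F[N]} :=
  mmap (@mpolyC N F) (restrict_var i j c).
HB.instance Definition _ i j c := GRing.RMorphism.on (restrict i j c).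

Lemma restrictX i j c l : restrict i j c 'X_l = restrict_var i j c l.
Proof. by rewrite /restrict mmapX mmap1U. Qed.

Lemma restrictZ i j c b f : restrict i j c (b *: f) = b *: restrict i j c f.
Proof. by rewrite /restrict mmapZ mul_mpolyC. Qed.

Lemma sub_restrict i j c f : exists g, f - restrict i j c f = g * ('X_j - c *: 'X_i).
Proof.
pose D f := exists g, f - restrict i j c f = g * ('X_j - c *: 'X_i).
have DM f1 f2 : D f1 -> D f2 -> D (f1 * f2).
  move=> [g1 e1] [g2 e2]; exists (g1 * f2 + restrict i j c f1 * g2).
  by rewrite rmorphM mulrDl mulrAC -e1 -mulrA -e2; ring.
have D1 : D 1 by exists 0; rewrite rmorph1 subrr mul0r.
have DX l : D 'X_l.
  rewrite /D restrictX /restrict_var; case: eqP => [->|_]; first by exists 1; rewrite mul1r.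
  by exists 0; rewrite subrr mul0r.
have Dm m : D 'X_[m].
  rewrite mpolyXE_id; apply: (big_ind D D1 DM) => l _.
  elim: (m l) => [|n IH]; first by rewrite expr0; exact: D1.
  by rewrite exprS; exact: DM (DX l) IH.
change (D f); elim/mpolyind: f => [|b m f _ _ [g2 e2]].
  by exists 0; rewrite raddf0 subrr mul0r.
have [g1 e1] := Dm m; exists (b *: g1 + g2).
by rewrite raddfD /= restrictZ mulrDl -scalerAl -e1 -e2 scalerBr; ring.
Qed.

Lemma restrict_eq0 i j c f : restrict i j c f = 0 -> exists g, f = g * ('X_j - c *: 'X_i).
Proof. by have [g e] := sub_restrict i j c f => f0; exists g; rewrite -e f0 subr0. Qed.

Lemma linear_form_neq0 (b c : F) i j : i != j -> b != 0 -> b *: 'X_j - c *: 'X_i != 0 :> {mpoly F[N]}.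
Proof.
move=> nij b0; apply/eqP => /(congr1 (mcoeff U_(j)%MM)).
rewrite mcoeff0 mcoeffB !mcoeffZ !mcoeffX eqxx eq_mnm1 (negPf nij) mulr1 mulr0 subr0.
exact/eqP.
Qed.

Lemma mpolyXi_neq0 i : 'X_i != 0 :> {mpoly F[N]}.
Proof.
apply/eqP => /(congr1 (mcoeff U_(i)%MM)); rewrite mcoeff0 mcoeffX eqxx.
by apply/eqP/oner_neq0.
Qed.

Variable q : F.
Hypothesis q0 : q != 0.
Hypothesis qn : forall n, (0 < n)%N -> q ^+ n != 1.

Lemma expr_inj m n : q ^+ m = q ^+ n -> m = n.
Proof.
wlog le_mn : m n / (m <= n)%N.
  by move=> h; case/orP: (leq_total m n) => mn e; [|apply/esym]; apply: h.
rewrite -{1}(subnK le_mn) exprD -{1}[q ^+ m]mul1r => /(mulIf (expf_neq0 _ q0))/esym/eqP.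
by case: (posnP (n - m)) => [|/qn/negPf ->] //; lia.
Qed.

(* The linear forms [X_j - q ^+ k * X_i], with [X_i - X_j] kept only once. *)
Definition form_index := ('I_N * 'I_N * nat)%type.
Definition form (l : form_index) : {mpoly F[N]} := 'X_l.1.2 - q ^+ l.2 *: 'X_l.1.1.
Definition form_valid (l : form_index) :=
  (l.1.1 != l.1.2) && ((0 < l.2)%N || (l.1.1 < l.1.2)%N).

(** No positive power of q is 1, so distinct forms are never proportional and none vanishes on the
    hyperplane of another. *)
Lemma restrict_form_neq0 l l' : form_valid l -> form_valid l' -> l != l' ->
  restrict l.1.1 l.1.2 (q ^+ l.2) (form l') != 0.
Proof.
case: l l' => [[i j] k] [[i' j'] k'] /= /andP[/= nij ok] /andP[/= nij' ok'] neq.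
rewrite /form /= raddfB /= restrictZ !restrictX /restrict_var.
have qk0 n : q ^+ n != 0 by rewrite expf_neq0.
case: (eqVneq j' j) => [ej|nj].
  have -> : (i' == j) = false by rewrite -ej; exact/negbTE.
  case: (eqVneq i' i) => [ei|ni]; last by rewrite linear_form_neq0.
  rewrite ei -scalerBl scaler_eq0 (negPf (mpolyXi_neq0 _)) orbF subr_eq0.
  by apply: contraNneq neq => /expr_inj ->; rewrite ei ej.
case: (eqVneq i' j) => [ei|ni]; last by rewrite -['X_j']scale1r linear_form_neq0 ?oner_neq0.
rewrite scalerA -exprD; case: (eqVneq j' i) => [ej|nj'].
  rewrite ej -{1}['X_i]scale1r -scalerBl scaler_eq0 (negPf (mpolyXi_neq0 _)) orbF subr_eq0 eq_sym.
  case: (posnP (k' + k)) => [e|]; last exact: qn.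
  by move: ok ok' nij; rewrite ei ej; lia.
by rewrite -['X_j']scale1r linear_form_neq0 ?oner_neq0 // eq_sym.
Qed.

(** This avoids unique factorization: restriction to a hyperplane is a ring morphism into a domain,
    so when a product vanishes there and the other linear forms do not, the cofactor must. *)
Lemma prod_form_dvd (L : seq form_index) f : uniq L -> all form_valid L ->
  (forall l, l \in L -> restrict l.1.1 l.1.2 (q ^+ l.2) f = 0) ->
  exists g, f = g * \prod_(l <- L) form l.
Proof.
elim: L => [|l L IH]; first by move=> _ _ _; exists f; rewrite big_nil mulr1.
move=> /= /andP[nlL uL] /andP[vl vL] h.
have [|g e] := IH uL vL; first by move=> l' l'L; apply: h; rewrite inE l'L orbT.
have /eqP := h l (mem_head _ _); rewrite e rmorphM mulf_eq0 /= => /orP[/eqP|].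
  by move=> /restrict_eq0[g' ->]; exists g'; rewrite big_cons mulrA.
rewrite rmorph_prod /= prodf_seq_eq0 => /hasP[l' l'L /=].
rewrite (negPf (restrict_form_neq0 vl _ _)) //; first exact: (allP vL).
by apply: contraNneq nlL => ->.
Qed.

Lemma Xforms (a : nat) : exists L : seq form_index,
  [/\ uniq L, all form_valid L, (forall l, l \in L -> (l.2 <= a)%N)
    & vdm (fun i => 'X_i) * cross a q%:MP (fun i => 'X_i) (fun i => 'X_i) = \prod_(l <- L) form l].
Proof.
pose A := filter (fun p : 'I_N * 'I_N => (p.1 < p.2)%N) (enum {: 'I_N * 'I_N}).
pose B := filter (fun p : 'I_N * 'I_N => p.1 != p.2) (enum {: 'I_N * 'I_N}).
exists ([seq (p, 0%N) | p <- A] ++ [seq (p, k) | p <- B, k <- iota 1 a]); split.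
- have uA P : uniq (filter P (enum {: 'I_N * 'I_N})) by rewrite filter_uniq ?enum_uniq.
  rewrite cat_uniq map_inj_uniq; last by move=> p p' [].
  rewrite uA allpairs_uniq ?uA ?iota_uniq //.
    rewrite andbT; apply/hasPn => l /allpairsP[[p k] /= [_ + ->]]; rewrite mem_iota => /andP[k0 _].
    by apply/mapP => -[p' _ [_ e]]; rewrite e in k0.
  by move=> [p k] [p' k'] _ _.
- apply/allP => l; rewrite mem_cat => /orP[/mapP[p + ->]|/allpairsP[[p k] /= [+ + ->]]].
    by rewrite mem_filter /form_valid /= => /andP[h _]; rewrite h andbT neq_ltn h.
  by rewrite mem_filter mem_iota /form_valid /= => /andP[-> _] /andP[-> _].
- move=> l; rewrite mem_cat => /orP[/mapP[p _ ->] //|/allpairsP[[p k] /= [_ + ->]]].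
  by rewrite mem_iota /=; lia.
rewrite big_cat /= big_map big_filter big_enum_cond /= big_allpairs_dep /= big_filter big_enum_cond /=.
congr (_ * _); first by apply: eq_bigr => p _; rewrite /form /= expr0 scale1r.
apply: eq_bigr => p _; rewrite -[1%N]addn0 iotaDl big_map -[a in iota _ a]subn0 -/(index_iota 0 a) big_mkord.
by apply: eq_bigr => k _; rewrite /form /= -rmorphXn mul_mpolyC add1n.
Qed.

Variables (a r : nat).
Hypothesis char2 : 2%:R != 0 :> F.

(** [noumi_vanish] is used at the generic point of each hyperplane, that is in [{mpoly F[N]}] with
    'X_j replaced by q^k 'X_i. This is why [noumi] takes its points in any domain with a morphism
    from F. *)
Lemma noumi_dvd f : f \is symmetric -> exists h : {mpoly F[N]},
  noumi q a r (@mpolyC N F) (fun i => 'X_i) f =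
  h * (vdm (fun i => 'X_i) * cross a q%:MP (fun i => 'X_i) (fun i => 'X_i)).
Proof.
move=> sf; have [L [uL vL La ->]] := Xforms a; apply: prod_form_dvd => // -[[i j] k] lL /=.
have /andP[/= nij _] := allP vL _ lL; have /= ka := La _ lL.
rewrite (rmorph_noumi _ _ _ _ (restrict i j (q ^+ k))).
have e c : restrict i j (q ^+ k) c%:MP = c%:MP by rewrite /restrict mmapC.
pose x l := restrict i j (q ^+ k) 'X_l.
have := @noumi_vanish F q N a r _ (restrict i j (q ^+ k) \o @mpolyC N F) _ x f k i j sf nij ka.
apply.
- by rewrite -(rmorph_nat (@mpolyC N F)) mpolyC_eq0.
- move=> l; rewrite /x restrictX /restrict_var; case: ifP => _; last exact: mpolyXi_neq0.
  by rewrite scaler_eq0 negb_or expf_neq0 //= mpolyXi_neq0.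
by rewrite /x /= e !restrictX /restrict_var eqxx (negPf nij) -rmorphXn mul_mpolyC.
Qed.

End Hyperplanes.

(** * Triangularity and self-adjointness *)

Section Grading.
Variables (F : fieldType) (N : nat).
Implicit Types (f g : {mpoly F[N]}) (w : 'I_N -> nat).

Definition wdeg w (m : 'X_{1..N}) : nat := (\sum_i w i * m i)%N.

Definition wconst : F -> {poly {mpoly F[N]}} := polyC \o @mpolyC N F.
HB.instance Definition _ := GRing.RMorphism.on wconst.

(** Marks each variable with a power of an auxiliary indeterminate, so that weighted degree becomes
    the size of a polynomial over a domain. The weights that matter are 1 on the first k variables,
    for the partial sums of dominance, and N - i, for [height]. *)
Definition wgrade w : {mpoly F[N]} -> {poly {mpoly F[N]}} :=
  mmap wconst (fun i => ('X_i)%:P * 'X^(w i)).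
HB.instance Definition _ w := GRing.RMorphism.on (wgrade w).

Lemma wgradeC w c : wgrade w c%:MP = wconst c.
Proof. by rewrite /wgrade mmapC. Qed.

Lemma wgradeXi w i : wgrade w 'X_i = ('X_i)%:P * 'X^(w i).
Proof. by rewrite /wgrade mmapX mmap1U. Qed.

Lemma wgradeX w m : wgrade w 'X_[m] = ('X_[m])%:P * 'X^(wdeg w m).
Proof.
rewrite /wgrade mmapX /mmap1 [in RHS]mpolyXE_id /wdeg.
rewrite rmorph_prod (big_morph (GRing.exp 'X) (exprD 'X) (expr0 'X)).
apply: etrans (big_split _ _ _ _ _); apply: eq_bigr => i _.
by rewrite exprMn exprM -polyC_exp.
Qed.

Lemma wgradeE w f : wgrade w f = \sum_(m <- msupp f) (f@_m *: 'X_[m])%:P * 'X^(wdeg w m).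
Proof.
rewrite {1}[f]mpolyE rmorph_sum; apply: eq_bigr => m _ /=.
by rewrite -mul_mpolyC rmorphM /= wgradeC wgradeX /wconst /= polyCM mulrA.
Qed.

Lemma coef_wgrade w f d m : ((wgrade w f)`_d)@_m = if wdeg w m == d then f@_m else 0.
Proof.
rewrite wgradeE coef_sum raddf_sum /=.
under eq_bigr => k _ do rewrite coefCM coefXn mulr_natr mcoeffMn mcoeffZ mcoeffX.
have [mf|/memN_msupp_eq0 mf] := boolP (m \in msupp f).
  rewrite (bigD1_seq m) ?msupp_uniq //= eqxx mulr1 big1 ?addr0.
    by rewrite eq_sym; case: eqP => _; rewrite ?mulr1n ?mulr0n.
  by move=> k /negPf ->; rewrite mulr0 mul0rn.
rewrite mf if_same big1 // => k _; case: eqVneq => [->|_]; first by rewrite mf mul0r mul0rn.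
by rewrite mulr0 mul0rn.
Qed.

Lemma size_wgradeP w f d :
  (size (wgrade w f) <= d)%N <-> (forall m, m \in msupp f -> (wdeg w m < d)%N).
Proof.
split=> [/leq_sizeP h m|h].
  rewrite mcoeff_msupp ltnNge; apply: contraNN => /h/(congr1 (mcoeff m)).
  by rewrite coef_wgrade eqxx mcoeff0 => ->.
apply/leq_sizeP => k le_dk; apply/mpolyP => m; rewrite coef_wgrade mcoeff0.
case: eqP => // e; apply: contraTeq le_dk; rewrite -mcoeff_msupp => /h.
by rewrite e ltnNge.
Qed.

Lemma homog_wgrade d f : f \is d.-homog <-> wgrade (fun=> 1%N) f = f%:P * 'X^d.
Proof.
have w1 m : wdeg (fun=> 1%N) m = mdeg m by rewrite /wdeg mdegE; under eq_bigr do rewrite mul1n.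
split=> [/dhomogP h|h].
  rewrite wgradeE [in RHS](mpolyE f) rmorph_sum mulr_suml; apply: eq_big_seq => m /h/= <-.
  by rewrite w1.
apply/dhomogP => m; rewrite mcoeff_msupp; have := coef_wgrade (fun=> 1%N) f d m.
by rewrite w1 h coefCM coefXn eqxx mulr1; case: eqP => //= _ ->; rewrite eqxx.
Qed.

Lemma homog_cancel f g d e : g != 0 -> g \is d.-homog -> f * g \is (e + d).-homog -> f \is e.-homog.
Proof.
move=> g0 /homog_wgrade hg /homog_wgrade; rewrite rmorphM /= hg exprD => h.
apply/homog_wgrade; have gX0 : g%:P * 'X^d != 0 :> {poly {mpoly F[N]}}.
  by rewrite mulf_neq0 ?polyC_eq0 // -size_poly_eq0 size_polyXn.
by apply: (mulIf gX0); rewrite h polyCM mulrACA [_ * 'X^d]mulrC.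
Qed.

Lemma homog_prod (I : finType) (P : pred I) (G : I -> {mpoly F[N]}) (d : I -> nat) :
  (forall i, P i -> G i \is (d i).-homog) ->
  \prod_(i | P i) G i \is (\sum_(i | P i) d i)%N.-homog.
Proof.
move=> h; apply: (big_rec2 (fun k p => p \is k.-homog)) => [|i k p Pi hp].
  exact: dhomog1.
by apply: dhomogM => //; exact: h.
Qed.

Lemma mscale_homog c d f : f \is d.-homog -> mscale c f \is d.-homog.
Proof.
move=> /dhomogP h; apply/dhomogP => m; rewrite mcoeff_msupp mcoeff_mscale mulf_eq0 negb_or.
by case/andP=> _; rewrite -mcoeff_msupp => /h.
Qed.

Definition eq_size (E : idomainType) (p p' : {poly E}) := (p != 0) && (size p == size p').

Lemma eq_size_mul (E : idomainType) (p p' s s' : {poly E}) :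
  eq_size p p' -> eq_size s s' -> eq_size (p * s) (p' * s').
Proof.
move=> /andP[p0 /eqP ep] /andP[s0 /eqP es].
have p0' : p' != 0 by rewrite -size_poly_eq0 -ep size_poly_eq0.
have s0' : s' != 0 by rewrite -size_poly_eq0 -es size_poly_eq0.
by rewrite /eq_size mulf_neq0 //= !size_mul ?ep ?es.
Qed.

Lemma eq_size_prod (E : idomainType) (I : finType) (P : pred I) (G G' : I -> {poly E}) :
  (forall i, P i -> eq_size (G i) (G' i)) -> eq_size (\prod_(i | P i) G i) (\prod_(i | P i) G' i).
Proof.
move=> h; apply: (big_ind2 (@eq_size E)) => //; first by rewrite /eq_size oner_neq0 eqxx.
by move=> *; apply: eq_size_mul.
Qed.

Lemma size_weighted_linear w i j (b c : F) : i != j -> b != 0 -> c != 0 ->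
  size (wconst b * (('X_j)%:P * 'X^(w j)) - wconst c * (('X_i)%:P * 'X^(w i)) : {poly {mpoly F[N]}})
    = (maxn (w i) (w j)).+1.
Proof.
have aux i' b' : wconst b' * (('X_i')%:P * 'X^(w i')) = (b' *: 'X_i')%:P * 'X^(w i') :> {poly {mpoly F[N]}}.
  by rewrite /wconst /= mulrA -polyCM mul_mpolyC.
have sz i' b' : b' != 0 -> size ((b' *: 'X_i')%:P * 'X^(w i') : {poly {mpoly F[N]}}) = (w i').+1.
  by move=> b0; rewrite size_Cmul ?size_polyXn // scaler_eq0 negb_or b0 mpolyXi_neq0.
move=> nij b0 c0; rewrite !aux; case: (ltngtP (w i) (w j)) => h.
- by rewrite size_polyDl ?size_polyN !sz //; lia.
- by rewrite addrC size_polyDl ?size_polyN !sz //; lia.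
rewrite h -mulrBl -polyCB size_Cmul ?size_polyXn //.
exact: linear_form_neq0.
Qed.

End Grading.

Section NoumiSize.
Variables (F : fieldType) (N : nat) (E : idomainType) (iota : {rmorphism F -> {poly E}}).
Variables (q : F) (a r : nat) (w : 'I_N -> nat) (y : 'I_N -> {poly E}).
Hypothesis q0 : q != 0.
Hypothesis size_iota : forall c, (size (iota c) <= 1)%N.
Hypothesis size_lin : forall (i j : 'I_N) b c, i != j -> b != 0 -> c != 0 ->
  size (iota b * y j - iota c * y i) = (maxn (w i) (w j)).+1.

(** A q-shift changes the coefficients of each linear factor but not its degree, so every numerator
    has the degree of the common denominator. Hence Noumi's operators raise no weighted degree,
    which is their triangularity. *)
Lemma eq_size_kernel (mu : {ffun 'I_N -> 'I_r.+1}) :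
  eq_size (vdm y * cross a (iota q) y y)
    (vdm (qscale q iota y mu) * cross a (iota q) y (qscale q iota y mu)).
Proof.
have aux (b c b' c' : F) i j : i != j -> b != 0 -> c != 0 -> b' != 0 -> c' != 0 ->
    eq_size (iota b * y j - iota c * y i) (iota b' * y j - iota c' * y i).
  move=> nij b0 c0 b'0 c'0; apply/andP; split.
    by rewrite -size_poly_gt0 (size_lin nij b0 c0).
  by apply/eqP; exact: etrans (size_lin nij b0 c0) (esym (size_lin nij b'0 c'0)).
have qe0 k : q ^+ k != 0 by rewrite expf_neq0.
have one0 := oner_neq0 F.
apply: eq_size_mul; apply: eq_size_prod => p np.
  have nij : p.1 != p.2 by rewrite neq_ltn np.
  have := aux 1 1 (q ^+ mu p.2) (q ^+ mu p.1) p.1 p.2 nij one0 one0 (qe0 _) (qe0 _).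
  by rewrite rmorph1 !mul1r !rmorphXn.
apply: eq_size_prod => k _.
have := aux 1 (q ^+ k.+1) 1 (q ^+ (k.+1 + mu p.1)) p.1 p.2 np one0 (qe0 _) one0 (qe0 _).
by rewrite rmorph1 !mul1r !rmorphXn exprD -mulrA.
Qed.

Lemma size_noumi_le (f : {mpoly F[N]}) d :
  (forall mu : {ffun 'I_N -> 'I_r.+1}, size (mmap iota (qscale q iota y mu) f) <= d)%N ->
  (size (noumi q a r iota y f) <= (size (vdm y * cross a (iota q) y y)%R + d).-1)%N.
Proof.
move=> hd; apply: leq_trans (size_sum _ _ _) _; apply/bigmax_leqP => mu _ /=.
have /andP[D0 /eqP eD] := eq_size_kernel mu.
have D1 : (0 < size (vdm y * cross a (iota q) y y)%R)%N by rewrite size_poly_gt0.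
apply: leq_trans (size_polyMleq _ _) _.
set X := vdm _ * _ * _; have hX : (size X <= (size (vdm y * cross a (iota q) y y)%R + d).-1)%N.
  apply: leq_trans (size_polyMleq _ _) _; rewrite -eD.
  by rewrite -!subn1 leq_sub2r // leq_add2l.
apply: leq_trans hX; rewrite -[X in (_ <= X)%N]add0n -subn1 leq_subLR addnA leq_add2r.
exact: size_iota.
Qed.

Variable phi : {rmorphism {mpoly F[N]} -> {poly E}}.
Hypothesis phiC : forall c, phi c%:MP = iota c.
Hypothesis phiX : forall i, phi 'X_i = y i.

Lemma size_noumi_dvd f h d :
  noumi q a r (@mpolyC N F) (fun i => 'X_i) f =
    h * (vdm (fun i => 'X_i) * cross a q%:MP (fun i => 'X_i) (fun i => 'X_i)) ->
  (forall c, size (phi (mscale c f)) <= d)%N -> (size (phi h) <= d)%N.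
Proof.
move=> e0 hd; have eX : phi \o (fun i : 'I_N => 'X_i) = y by apply/funext => i; exact: phiX.
have eN : phi (noumi q a r (@mpolyC N F) (fun i => 'X_i) f) = noumi q a r iota y f.
  rewrite rmorph_noumi eX; apply: eq_bigr => mu _.
  have -> : qscale q (phi \o @mpolyC N F) y mu = qscale q iota y mu.
    by apply/funext => l; rewrite /qscale /= phiC.
  rewrite /= !phiC; congr (_ * (_ * _)).
  by apply: eq_mmap => // c; exact: phiC.
have e : noumi q a r iota y f = phi h * (vdm y * cross a (iota q) y y).
  by rewrite -eN e0 !rmorphM rmorph_vdm rmorph_cross eX phiC.
have /andP[D0 _] := eq_size_kernel [ffun=> ord0].
have [->|h0] := eqVneq (phi h) 0; first by rewrite size_poly0.
have := @size_noumi_le f d; rewrite e size_mul //.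
move: D0 h0; set D := vdm y * _; rewrite -!size_poly_gt0 => D0 h0 hs.
suff hmu (mu : {ffun 'I_N -> 'I_r.+1}) : (size (mmap iota (qscale q iota y mu) f) <= d)%N.
  by move: (hs hmu) D0 h0; move: (size D) (size (phi h)) => s1 s2; lia.
suff -> : mmap iota (qscale q iota y mu) f = phi (mscale (fun i => q ^+ mu i) f) by [].
rewrite (rmorph_mmap phi); apply: eq_mmap => [c|i]; first by rewrite /= phiC.
by rewrite /= -mul_mpolyC rmorphM /= phiC phiX rmorphXn.
Qed.

End NoumiSize.

Section NoumiGrade.
Variables (F : fieldType) (N : nat).
Implicit Types (f g : {mpoly F[N]}).
Variables (q : F) (a r : nat) (w : 'I_N -> nat).
Hypothesis q0 : q != 0.

Lemma wgrade_noumi_dvd f h d :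
  noumi q a r (@mpolyC N F) (fun i => 'X_i) f =
    h * (vdm (fun i => 'X_i) * cross a q%:MP (fun i => 'X_i) (fun i => 'X_i)) ->
  (forall m, m \in msupp f -> (wdeg w m < d)%N) ->
  forall m, m \in msupp h -> (wdeg w m < d)%N.
Proof.
move=> e0 hf; apply/size_wgradeP.
apply: (@size_noumi_dvd F N _ (@wconst F N) q a r w _ q0 _ (@size_weighted_linear F N w) (wgrade w) _ _ f) e0 _.
- by move=> c; exact: size_polyC_leq1.
- exact: wgradeC.
- exact: wgradeXi.
move=> c; apply/size_wgradeP => m; rewrite mcoeff_msupp mcoeff_mscale mulf_eq0 negb_or => /andP[_].
by rewrite -mcoeff_msupp; exact: hf.
Qed.

Lemma kernelX_neq0 : vdm (fun i : 'I_N => 'X_i : {mpoly F[N]}) * cross a q%:MP (fun i => 'X_i) (fun i => 'X_i) != 0.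
Proof.
have X1 i : 'X_i = 1 *: 'X_i :> {mpoly F[N]} by rewrite scale1r.
rewrite mulf_neq0 //; apply/prodf_neq0 => p np.
  by rewrite (X1 p.1) (X1 p.2) linear_form_neq0 ?oner_neq0 // neq_ltn np.
by apply/prodf_neq0 => k _; rewrite -rmorphXn mul_mpolyC [X in X - _]X1 linear_form_neq0 ?oner_neq0.
Qed.

Lemma noumi_homog_dvd f h d :
  noumi q a r (@mpolyC N F) (fun i => 'X_i) f =
    h * (vdm (fun i => 'X_i) * cross a q%:MP (fun i => 'X_i) (fun i => 'X_i)) ->
  f \is d.-homog -> h \is d.-homog.
Proof.
move=> e hf.
have lin (b c : F) i j : b *: 'X_j - c *: 'X_i \is [in F[N], 1.-homog].
  by rewrite rpredB // dhomogZ // dhomogX /= mdeg1.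
have X1 i : 'X_i = 1 *: 'X_i :> {mpoly F[N]} by rewrite scale1r.
have hK (c : 'I_N -> F) : vdm (fun i => c i *: 'X_i) * cross a q%:MP (fun i => 'X_i) (fun i => c i *: 'X_i)
    \is (\sum_(p : 'I_N * 'I_N | p.1 < p.2) 1 + \sum_(p : 'I_N * 'I_N | p.1 != p.2) \sum_(k < a) 1)%N.-homog.
  apply: dhomogM; apply: homog_prod => p _; first exact: lin.
  by apply: homog_prod => k _; rewrite -rmorphXn mul_mpolyC scalerA [X in X - _]X1; exact: lin.
have e1 : (fun i : 'I_N => 'X_i : {mpoly F[N]}) = (fun i => 1 *: 'X_i).
  by apply/funext => i.
have hK1 := hK (fun=> 1); rewrite -e1 in hK1.
apply: (homog_cancel kernelX_neq0 hK1).
rewrite -e; apply: rpred_sum => mu _; rewrite mul_mpolyC dhomogZ // addnC.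
have -> : qscale q (@mpolyC N F) (fun i => 'X_i) mu = (fun i => q ^+ mu i *: 'X_i).
  by apply/funext => i; rewrite /qscale -rmorphXn mul_mpolyC.
by apply: dhomogM; [exact: hK|exact: mscale_homog].
Qed.

End NoumiGrade.

(** * Self-adjointness of Noumi's operators for the Macdonald form *)

Section MacdonaldForm.
Variables (F : comNzRingType) (N a : nat) (q : F).
Implicit Types (f g : {mpoly F[N]}) (c : 'I_N -> F).

Local Notation X := (fun i : 'I_N => 'X_i : {mpoly F[N]}).

Definition vdm_rev : {mpoly F[N]} := \prod_(p : 'I_N * 'I_N | (p.1 < p.2)%N) ('X_p.1 - 'X_p.2).

Definition half_mon : {mpoly F[N]} :=
  \prod_(p : 'I_N * 'I_N | (p.1 < p.2)%N) ('X_p.1 * 'X_p.2) *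
  \prod_(p : 'I_N * 'I_N | p.1 != p.2) \prod_(k < a) 'X_p.1.

(** For c = q^mu this is, up to [half_mon] and the constant weight of mu, the weight of the form
    times the coefficient of the shift x -> c x in Noumi's operator: the common denominator cancels
    against the weight and leaves [vdm_rev]. *)
Definition kernel c : {mpoly F[N]} :=
  vdm_rev * (vdm (fun i => c i *: 'X_i) * cross a q%:MP X (fun i => c i *: 'X_i)).

(* [mform f g] is the constant term of
   [f(x) g(1/x) \prod_(i != j) \prod_(k < a.+1) (1 - q ^+ k * x i / x j)]: the weight equals
   [kernel (fun=> 1) / half_mon]. *)
Definition mform f g : F := mdot (kernel (fun=> 1) * f) (half_mon * g).

Lemma swap_pair_prod (G : 'I_N -> 'I_N -> {mpoly F[N]}) :
  \prod_(p : 'I_N * 'I_N | p.1 != p.2) G p.2 p.1 = \prod_(p : 'I_N * 'I_N | p.1 != p.2) G p.1 p.2.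
Proof.
have inj_s : injective (fun p : 'I_N * 'I_N => (p.2, p.1)) by move=> [i j] [i' j'] /= [-> ->].
by rewrite [RHS](reindex_inj inj_s) /=; apply: eq_bigl => p; rewrite eq_sym.
Qed.

Lemma half_mon_sqr : half_mon * half_mon =
  \prod_(p : 'I_N * 'I_N | (p.1 < p.2)%N) ('X_p.2 * 'X_p.1) *
  (\prod_(p : 'I_N * 'I_N | (p.1 < p.2)%N) ('X_p.1 * 'X_p.2) *
   \prod_(p : 'I_N * 'I_N | p.1 != p.2) \prod_(k < a) ('X_p.1 * 'X_p.2)).
Proof.
rewrite mulrACA -mulrA; congr (_ * _).
  by apply: eq_bigr => p _; rewrite mulrC.
congr (_ * _); rewrite -{1}(swap_pair_prod (fun i j => \prod_(k < a) 'X_i)) mulrC.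
rewrite -big_split; apply: eq_bigr => p _; rewrite -big_split; apply: eq_bigr => k _ //.
Qed.

(** [kernel c] at 1/x, cleared by the square of [half_mon]. *)
Definition kernel_adj c : {mpoly F[N]} :=
  vdm X * (\prod_(p : 'I_N * 'I_N | (p.1 < p.2)%N) (c p.2 *: 'X_p.1 - c p.1 *: 'X_p.2) *
    \prod_(p : 'I_N * 'I_N | p.1 != p.2) \prod_(k < a) ('X_p.1 - (q ^+ k.+1 * c p.1) *: 'X_p.2)).

Lemma adjoint_kernel c : adjoint_mul (kernel c) (half_mon * half_mon) (kernel_adj c).
Proof.
have lin1 (b : F) i j : adjoint_mul ('X_j - b *: 'X_i) ('X_i * 'X_j) ('X_i - b *: 'X_j : {mpoly F[N]}).
  by have := adjoint_mul_lin 1 b i j; rewrite !scale1r.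
have lin2 i j : adjoint_mul ('X_j - 'X_i) ('X_i * 'X_j) ('X_i - 'X_j : {mpoly F[N]}).
  by have := lin1 1 i j; rewrite !scale1r.
rewrite half_mon_sqr; apply: adjoint_mulM; first by apply: adjoint_mul_prod => p _; exact: lin2.
apply: adjoint_mulM; apply: adjoint_mul_prod => p _; first exact: adjoint_mul_lin.
by apply: adjoint_mul_prod => k _; rewrite -rmorphXn mul_mpolyC scalerA; exact: lin1.
Qed.

Lemma adjoint_half_mon : adjoint_mul half_mon half_mon 1.
Proof.
have hX i : adjoint_mul ('X_i) ('X_i) (1 : {mpoly F[N]}).
  by move=> A B; rewrite mdot_mulX mul1r.
have hp (I : finType) (P : pred I) (G : I -> {mpoly F[N]}) :
    (forall i, P i -> adjoint_mul (G i) (G i) 1) -> adjoint_mul (\prod_(i | P i) G i) (\prod_(i | P i) G i) 1.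
  move=> h; have := adjoint_mul_prod (index_enum I) (V := fun=> 1) h.
  by rewrite [\prod_(i | _) 1]big1.
have hM (U V : {mpoly F[N]}) : adjoint_mul U U 1 -> adjoint_mul V V 1 -> adjoint_mul (U * V) (U * V) 1.
  by move=> hU hV; have := adjoint_mulM hU hV; rewrite mulr1.
apply: (hM); apply: (hp) => p _; last by apply: hp.
by apply: hM.
Qed.

Definition kappa c : F := \prod_(p : 'I_N * 'I_N | (p.1 < p.2)%N) (c p.1 * c p.2) *
  \prod_(p : 'I_N * 'I_N | p.1 != p.2) \prod_(k < a) c p.1.

Lemma mscaleXi c i : mscale c 'X_i = c i *: 'X_i.
Proof. by rewrite /mscale mmapX mmap1U. Qed.

Lemma scaler_prod2 (I : Type) (s : seq I) (P : pred I) (b : I -> F) (G : I -> {mpoly F[N]}) :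
  \prod_(i <- s | P i) (b i *: G i) = (\prod_(i <- s | P i) b i) *: \prod_(i <- s | P i) G i.
Proof. exact: scaler_prod. Qed.

Lemma scaler_mul2 (b b' : F) (A B : {mpoly F[N]}) : (b * b') *: (A * B) = (b *: A) * (b' *: B).
Proof. by rewrite -scalerAl -scalerAr scalerA. Qed.

Lemma mscale_half_mon c : mscale c half_mon = kappa c *: half_mon.
Proof.
rewrite /half_mon rmorphM !rmorph_prod /kappa scaler_mul2; congr (_ * _).
  by rewrite -scaler_prod2; apply: eq_bigr => p _; rewrite rmorphM /= !mscaleXi -scalerAl -scalerAr scalerA.
rewrite -scaler_prod2; apply: eq_bigr => p _; rewrite -scaler_prod2 rmorph_prod.
by apply: eq_bigr => k _; rewrite /= mscaleXi.
Qed.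

(** The symmetry behind self-adjointness: inverting x and then scaling by c gives [kernel c] back,
    up to the same factor by which [half_mon] scales. *)
Lemma mscale_kernel_adj c : mscale c (kernel_adj c) = kappa c *: kernel c.
Proof.
have eV : mscale c (vdm X) = vdm (fun i => c i *: 'X_i).
  by rewrite rmorph_vdm; congr vdm; apply/funext => i; rewrite /= mscaleXi.
have eR : mscale c (\prod_(p : 'I_N * 'I_N | (p.1 < p.2)%N) (c p.2 *: 'X_p.1 - c p.1 *: 'X_p.2)) =
    (\prod_(p : 'I_N * 'I_N | (p.1 < p.2)%N) (c p.1 * c p.2)) *: vdm_rev.
  rewrite rmorph_prod -scaler_prod2; apply: eq_bigr => p _.
  by rewrite rmorphB /= !mscaleZ !mscaleXi !scalerA [c p.2 * _]mulrC scalerBr.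
have eC : mscale c (\prod_(p : 'I_N * 'I_N | p.1 != p.2) \prod_(k < a) ('X_p.1 - (q ^+ k.+1 * c p.1) *: 'X_p.2)) =
    (\prod_(p : 'I_N * 'I_N | p.1 != p.2) \prod_(k < a) c p.1) *: cross a q%:MP X (fun i => c i *: 'X_i).
  rewrite /cross (swap_pair_prod (fun i j => \prod_(k < a) ('X_i - q%:MP ^+ k.+1 * (c j *: 'X_j)))).
  rewrite rmorph_prod -scaler_prod2; apply: eq_bigr => p _.
  rewrite rmorph_prod -scaler_prod2; apply: eq_bigr => k _.
  rewrite rmorphB /= mscaleZ !mscaleXi scalerBr -rmorphXn mul_mpolyC !scalerA.
  by congr (_ - _ *: _); ring.
rewrite /kernel_adj !rmorphM /= eV eR eC /kappa /kernel.
by rewrite -scaler_mul2 -scalerAr mulrCA.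
Qed.

End MacdonaldForm.

Section FieldForm.
Variables (F : fieldType) (N a : nat) (q : F).
Implicit Types (f g : {mpoly F[N]}) (c : 'I_N -> F).

Local Notation X := (fun i : 'I_N => 'X_i : {mpoly F[N]}).
Local Notation kernel := (kernel a q).
Local Notation half_mon := (half_mon F N a).
Local Notation vdm_rev := (vdm_rev F N).
Local Notation mform := (mform a q).
Local Notation kappa := (kappa a).

(** Each shift together with its coefficient is self-adjoint on its own, so the sum over mu needs no
    rearrangement. The case c = 1 is the symmetry of the form. *)
Lemma mform_kernel c f g : (forall i, c i != 0) ->
  mdot (kernel c * mscale c f) (half_mon * g) = mdot (half_mon * f) (kernel c * mscale c g).
Proof.
move=> c0; have k0 : kappa c != 0.
  by rewrite mulf_neq0 //; apply/prodf_neq0 => p _; [rewrite mulf_neq0|apply/prodf_neq0 => k _].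
(* Multiplying both arguments by [half_mon] changes nothing and provides its square, against which
   [kernel c] has an adjoint. *)
rewrite -[LHS](_ : mdot (half_mon * (kernel c * mscale c f)) (half_mon * (half_mon * g)) = _); last first.
  by rewrite adjoint_half_mon mul1r.
rewrite [half_mon * (kernel c * _)]mulrCA [half_mon * (half_mon * g)]mulrA adjoint_kernel.
apply: (mulfI k0); rewrite -mdotZl scalerAl -mscale_half_mon -rmorphM mdot_mscale.
by rewrite rmorphM /= mscale_kernel_adj -scalerAl mdotZr.
Qed.

Lemma mformC f g : mform f g = mdot (half_mon * f) (kernel (fun=> 1) * g).
Proof.
have s1 h : mscale (fun=> 1) h = h.
  by apply/mpolyP => m; rewrite mcoeff_mscale big1 ?mul1r // => i _; rewrite expr1n.
by have := @mform_kernel (fun=> 1) f g (fun i => oner_neq0 F); rewrite !s1.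
Qed.

Lemma mformZl (b : F) f g : mform (b *: f) g = b * mform f g.
Proof. by rewrite /mform -scalerAr mdotZl. Qed.
Lemma mformBl f1 f2 g : mform (f1 - f2) g = mform f1 g - mform f2 g.
Proof. by rewrite /mform mulrBr mdotBl. Qed.
Lemma mformZr (b : F) f g : mform f (b *: g) = b * mform f g.
Proof. by rewrite /mform -scalerAr mdotZr. Qed.

Section SelfAdjoint.
Variable r : nat.
Hypothesis q0 : q != 0.

Lemma noumiX f : noumi q a r (@mpolyC N F) X f =
  \sum_(mu : {ffun 'I_N -> 'I_r.+1} | is_comp mu) noumi_weight q a (fun i => mu i) *:
    (vdm (fun i => q ^+ mu i *: 'X_i) * cross a q%:MP X (fun i => q ^+ mu i *: 'X_i)
      * mscale (fun i => q ^+ mu i) f).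
Proof.
apply: eq_bigr => mu _; rewrite mul_mpolyC.
have -> // : qscale q (@mpolyC N F) X mu = (fun i => q ^+ mu i *: 'X_i).
by apply/funext => i; rewrite /qscale -rmorphXn mul_mpolyC.
Qed.

Lemma mform_noumi f g hf hg :
  noumi q a r (@mpolyC N F) X f = hf * (vdm X * cross a q%:MP X X) ->
  noumi q a r (@mpolyC N F) X g = hg * (vdm X * cross a q%:MP X X) ->
  mform hf g = mform f hg.
Proof.
have k1 h : kernel (fun=> 1) * h = vdm_rev * (h * (vdm X * cross a q%:MP X X)).
  rewrite /kernel; have -> : (fun i => 1 *: 'X_i) = X by apply/funext => i; rewrite scale1r.
  by rewrite -mulrA [h * _]mulrC.
move=> ef eg; rewrite [RHS]mformC /mform (k1 hf) (k1 hg) -ef -eg (noumiX f) (noumiX g).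
have aux (I : finType) (P : pred I) (G1 G2 : I -> {mpoly F[N]}) A B B' :
    (forall i, mdot (A * G1 i) B = mdot B' (A * G2 i)) ->
    mdot (A * \sum_(i | P i) G1 i) B = mdot B' (A * \sum_(i | P i) G2 i).
  move=> e; rewrite !mulr_sumr mdot_suml mdot_sumr; apply: eq_bigr => i _; exact: e.
have auxZ (b : F) (U V A B B' : {mpoly F[N]}) :
    mdot (A * U) B = mdot B' (A * V) -> mdot (A * (b *: U)) B = mdot B' (A * (b *: V)).
  by move=> e; rewrite -!scalerAr mdotZl mdotZr e.
apply: aux => mu; apply: auxZ.
have c0 i : q ^+ mu i != 0 by rewrite expf_neq0.
by have := @mform_kernel (fun i => q ^+ mu i) f g c0; rewrite /kernel -!mulrA.
Qed.

End SelfAdjoint.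
End FieldForm.

(** * Dominance order and the eigenfunction property *)

Section Dominance.
Variable N : nat.
Implicit Types (m lam mu : 'X_{1..N}).

Definition psum m (k : nat) : nat := (\sum_(i < N | i < k) m i)%N.

(** Dominance for arbitrary exponent vectors instead of partitions, so that it can be asked of every
    monomial in a support. *)
Definition below lam m := mdeg m = mdeg lam /\ forall k, (psum m k <= psum lam k)%N.

(** The sum of all partial sums, hence strictly increasing for dominance: a single weight that
    separates lam from everything strictly below it. *)
Definition height m : nat := wdeg (fun i : 'I_N => (N - i)%N) m.

Lemma below_trans mu lam m : below lam mu -> below mu m -> below lam m.
Proof. by move=> [e1 h1] [e2 h2]; split=> [|k]; [rewrite e2|exact: leq_trans (h2 k) (h1 k)]. Qed.

Lemma psum_wdeg m k : psum m k = wdeg (fun i : 'I_N => (i < k)%N : nat) m.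
Proof.
rewrite /psum /wdeg big_mkcond; apply: eq_bigr => i _.
by case: ifP => _; rewrite ?mul1n ?mul0n.
Qed.

Lemma heightE m : height m = (\sum_(k < N) psum m k.+1)%N.
Proof.
under [RHS]eq_bigr => k _ do rewrite psum_wdeg.
rewrite exchange_big; apply: eq_bigr => i _; rewrite -big_distrl /=; congr (_ * _)%N.
have count n : (\sum_(k < n) (i < k.+1) = n - i)%N.
  by elim: n => [|n IH]; rewrite ?big_ord0 // big_ord_recr /= IH; lia.
by rewrite count.
Qed.

Lemma psumS m (k : 'I_N) : psum m k.+1 = (psum m k + m k)%N.
Proof.
rewrite /psum (bigD1 k) //= addnC; congr (_ + _)%N; apply: eq_bigl => i.
by rewrite ltnS ltn_neqAle andbC.
Qed.

Lemma psum_inj m lam : (forall k : 'I_N, psum m k.+1 = psum lam k.+1) -> m = lam.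
Proof.
move=> h; apply/mnmP => k; have := h k; rewrite !psumS.
suff -> : psum m k = psum lam k by move/addnI.
case: k => -[|k] ltk /=; first by rewrite /psum !big_pred0.
exact: (h (Ordinal (ltnW ltk))).
Qed.

Lemma below_height lam m : below lam m -> m != lam -> (height m < height lam)%N.
Proof.
move=> [_ hm] neq; rewrite !heightE.
have [k lt_k] : exists k : 'I_N, (psum m k.+1 < psum lam k.+1)%N.
  apply/existsP; apply: contraNT neq => /existsPn h; apply/eqP/psum_inj => k.
  by apply/eqP; rewrite eqn_leq hm /= leqNgt h.
rewrite (bigD1 k) //= [X in (_ < X)%N](bigD1 k) //= -addSn leq_add //.
by apply: leq_sum => i _; exact: hm.
Qed.

Lemma below_anti lam m : below lam m -> below m lam -> m = lam.
Proof.
move=> h1 h2; apply/eqP/negP => /negP neq; have := below_height h1 neq.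
by rewrite eq_sym in neq; have := below_height h2 neq; lia.
Qed.

Variable F : comNzRingType.
Implicit Types (f g p : {mpoly F[N]}).

Definition sym_below lam f := f \is symmetric /\ forall m, m \in msupp f -> below lam m.
Definition sym_strictly_below lam f := sym_below lam f /\ f@_lam = 0.

Lemma sym_belowZ lam (c : F) f : sym_below lam f -> sym_below lam (c *: f).
Proof.
by move=> [sf hf]; split; [exact: rpredZ|move=> m /msuppZ_le; exact: hf].
Qed.

Lemma sym_belowD lam f g : sym_below lam f -> sym_below lam g -> sym_below lam (f + g).
Proof.
move=> [sf hf] [sg hg]; split; first exact: rpredD.
by move=> m /msuppD_le; rewrite mem_cat => /orP[/hf|/hg].
Qed.

Lemma sym_belowB lam f g : sym_below lam f -> sym_below lam g -> sym_below lam (f - g).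
Proof. by move=> hf hg; rewrite -scaleN1r; apply: sym_belowD => //; exact: sym_belowZ. Qed.

End Dominance.

Section Eigenfunction.
Variables (F : fieldType) (N a r : nat) (q : F).
Hypothesis q0 : q != 0.
Hypothesis qn : forall n, (0 < n)%N -> q ^+ n != 1.
Hypothesis char2 : 2%:R != 0 :> F.
Implicit Types (f g h p : {mpoly F[N]}).

Local Notation X := (fun i : 'I_N => 'X_i : {mpoly F[N]}).
Local Notation D := (vdm X * cross a q%:MP X X).

Lemma noumi_dvd_sym f h : f \is symmetric ->
  noumi q a r (@mpolyC N F) X f = h * D -> h \is symmetric.
Proof.
move=> sf e; apply/issymP => s.
have sX : msym s \o X = X \o s by apply/funext => i; rewrite /= /msym mmapX mmap1U.
have sC (c : F) : msym s c%:MP = c%:MP by rewrite /msym mmapC.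
have eD : msym s D = (-1) ^+ s * D.
  apply: etrans (rmorphM (@msym N F s) _ _) _.
  by rewrite rmorph_vdm rmorph_cross sX vdm_perm /= sC cross_perm2 mulrA.
have : msym s (noumi q a r (@mpolyC N F) X f) = msym s h * msym s D.
  by rewrite e; exact: rmorphM.
rewrite eD.
have -> : msym s (noumi q a r (@mpolyC N F) X f) = noumi q a r (@mpolyC N F) (X \o s) f.
  rewrite (rmorph_noumi q a r (@mpolyC N F) (msym s)) sX; apply: eq_bigr => mu _.
  have -> : qscale q (msym s \o @mpolyC N F) (X \o s) mu = qscale q (@mpolyC N F) (X \o s) mu.
    by apply/funext => i; rewrite /qscale /= sC.
  by rewrite /= !sC; congr (_ * (_ * _)); apply: eq_mmap => // c /=; rewrite sC.
rewrite noumi_perm // e => e2.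
have D0 := kernelX_neq0 N q a.
have : (-1) ^+ s * (h * D) = (-1) ^+ s * (msym s h * D).
  by rewrite e2 mulrCA.
have sg0 : (-1) ^+ s != 0 :> {mpoly F[N]} by rewrite expf_neq0 // oppr_eq0 oner_eq0.
by move/(mulfI sg0)/(mulIf D0)/esym.
Qed.

Lemma noumi_dvd_below lam f h : sym_below lam f ->
  noumi q a r (@mpolyC N F) X f = h * D -> sym_below lam h.
Proof.
move=> [sf hf] e; split; first exact: noumi_dvd_sym sf e.
move=> m mh; split.
  have hom : f \is (mdeg lam).-homog by apply/dhomogP => m' /hf[].
  by have /dhomogP/(_ m mh) := noumi_homog_dvd e hom.
move=> k; rewrite !psum_wdeg -ltnS.
apply: (wgrade_noumi_dvd (w := fun i => (i < k)%N : nat) q0 e) mh => m' m'f.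
by rewrite ltnS -!psum_wdeg; case: (hf _ m'f).
Qed.

(** The partial sums only bound the support by lam. That lam itself does not reappear comes from
    [height], which is smaller than [height lam] on the support of f and is not raised. *)
Lemma noumi_dvd_strictly_below lam f h : sym_strictly_below lam f ->
  noumi q a r (@mpolyC N F) X f = h * D -> sym_strictly_below lam h.
Proof.
move=> [sbf f0] e; split; first exact: noumi_dvd_below e.
apply/eqP; rewrite mcoeff_eq0; apply/negP => lh.
suff H m : m \in msupp f -> (height m < height lam)%N.
  by have := wgrade_noumi_dvd q0 e H lh; rewrite ltnn.
move=> mf; apply: below_height; first exact: sbf.2.
by apply: contraTneq mf => ->; rewrite mcoeff_msupp f0 eqxx.
Qed.

(** With eta the ratio of the coefficients at lam, the image of p minus eta p is strictly below lam.
    By self-adjointness and triangularity it is orthogonal to everything strictly below lam, so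
    nondegeneracy there makes it 0. *)
Theorem noumi_eigenfunction lam p :
  sym_below lam p -> p@_lam != 0 ->
  (forall g, sym_strictly_below lam g -> mform a q p g = 0) ->
  (forall g, sym_strictly_below lam g ->
     (forall g', sym_strictly_below lam g' -> mform a q g g' = 0) -> g = 0) ->
  exists eta : F, noumi q a r (@mpolyC N F) X p = (eta *: p) * D.
Proof.
move=> hp p0 orth nondeg; have [h e] := @noumi_dvd F N q q0 qn a r char2 p hp.1.
exists (h@_lam / p@_lam); rewrite e; congr (_ * _); apply/eqP; rewrite -subr_eq0; apply/eqP.
apply: nondeg.
  split; last by rewrite mcoeffB mcoeffZ divfK // subrr.
  by apply: sym_belowB; [exact: noumi_dvd_below e|exact: sym_belowZ].
move=> g hg; have [k ek] := @noumi_dvd F N q q0 qn a r char2 g hg.1.1.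
rewrite mformBl mformZl (orth _ hg) mulr0 subr0 (mform_noumi q0 e ek).
by apply: orth; exact: noumi_dvd_strictly_below ek.
Qed.

Corollary noumi_eigenvalue lam p :
  sym_below lam p -> p@_lam != 0 ->
  (forall g, sym_strictly_below lam g -> mform a q p g = 0) ->
  (forall g, sym_strictly_below lam g ->
     (forall g', sym_strictly_below lam g' -> mform a q g g' = 0) -> g = 0) ->
  exists eta : F, forall x : 'I_N -> F,
    noumi q a r idfun x p = eta * p.@[x] * (vdm x * cross a q x x).
Proof.
move=> hp p0 orth nondeg; have [eta e] := noumi_eigenfunction hp p0 orth nondeg.
exists eta => x; have eX : meval x \o X = x by apply/funext => i; rewrite /= mevalXU.
have eC (c : F) : meval x c%:MP = c by rewrite mevalC.
have eD : meval x D = vdm x * cross a q x x.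
  apply: etrans (rmorphM (meval x) _ _) _.
  by rewrite rmorph_vdm rmorph_cross eX /= eC.
have : meval x (noumi q a r (@mpolyC N F) X p) = meval x (eta *: p) * meval x D.
  by rewrite e; exact: rmorphM.
rewrite mevalZ eD => <-.
rewrite (rmorph_noumi q a r (@mpolyC N F) (meval x)) eX; apply: eq_bigr => mu _.
have -> : qscale q (meval x \o @mpolyC N F) x mu = qscale q idfun x mu.
  by apply/funext => i; rewrite /qscale /= eC.
by rewrite /= !eC; congr (_ * (_ * _)); apply: eq_mmap => // c /=; rewrite eC.
Qed.

End Eigenfunction.

(** * Specialization of Macdonald polynomials at t = q^theta *)

Section Fractions.
Variable A : idomainType.
Local Notation "x %:F" := (@FracField.tofrac A x) : ring_scope.
Local Open Scope quotient_scope.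

Lemma frac_denom_neq0 (x : {fraction A}) : (\d_(generic_quotient.repr x) : A) != 0.
Proof. exact: denom_ratioP. Qed.

Lemma frac_numden (x : {fraction A}) :
  x = (\n_(generic_quotient.repr x))%:F / (\d_(generic_quotient.repr x))%:F.
Proof.
have d0 := frac_denom_neq0 x; set n := \n_ _; set d := \d_ _ in d0 *.
apply: (canRL (mulfK _)); first by rewrite tofrac_eq0.
rewrite -[x in LHS]generic_quotient.reprK !generic_quotient.piE; apply/eqP.
rewrite generic_quotient.piE /= /FracField.equivf /= /FracField.mulf !numden_Ratio ?mulf_neq0 ?oner_neq0 //.
by rewrite !mulr1 mulrC.
Qed.

Lemma frac_cross (a b c d : A) : b != 0 -> d != 0 -> (a%:F / b%:F == c%:F / d%:F) = (a * d == c * b).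
Proof. by move=> b0 d0; rewrite eqr_div ?tofrac_eq0 // -!rmorphM tofrac_eq. Qed.

Variable N : nat.

Lemma common_denominator (h : {mpoly {fraction A}[N]}) :
  exists b h', b != 0 /\ b%:F *: h = map_mpoly (@FracField.tofrac A) h'.
Proof.
elim/mpolyind: h => [|c m p _ _ [b [p' [b0 e]]]].
  by exists 1, 0; rewrite oner_neq0 scaler0 rmorph0.
have d0 := frac_denom_neq0 c; have ec := frac_numden c.
set n := \n_ _ in ec; set d := \d_ _ in d0 ec.
exists (b * d), ((b * n) *: 'X_[m] + d *: p'); split; first by rewrite mulf_neq0.
rewrite rmorphD /= !map_mpolyZ map_mpolyX -e scalerDr !scalerA -!rmorphM; congr (_ + _ *: _).
  congr (_ *: _); rewrite ec !rmorphM /= -!mulrA; congr (_ * _).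
  by rewrite mulrCA divff ?mulr1 // tofrac_eq0.
by rewrite mulrC.
Qed.

End Fractions.

Lemma rescale_map (N : nat) (R : comNzRingType) (K : fieldType) (phi : {rmorphism R -> K})
    (b : K) (u : R) (h : {mpoly K[N]}) (h1 h' : {mpoly R[N]}) :
  b *: h = map_mpoly phi h1 -> h1 = u *: h' -> phi u != 0 ->
  ((phi u)^-1 * b) *: h = map_mpoly phi h'.
Proof. by move=> e e1 u0; rewrite -scalerA e e1 map_mpolyZ scalerA mulVf ?scale1r. Qed.

Section PrimitiveMultiple.
Variables (A : idomainType) (alpha : A) (N : nat).
Local Notation tofrac := (@FracField.tofrac {poly A}).

Lemma root_divides (h : {mpoly {poly A}[N]}) : map_mpoly (horner_eval alpha) h = 0 ->
  exists h', h = ('X - alpha%:P) *: h'.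
Proof.
move=> h0; have : forall m, exists r, h@_m = r * ('X - alpha%:P).
  move=> m; apply/factor_theorem; apply/eqP.
  by have := congr1 (mcoeff m) h0; rewrite mcoeff_map_mpoly mcoeff0.
move/boolp.choice => [r hr]; exists (\sum_(m <- msupp h) r m *: 'X_[m]).
rewrite [LHS]mpolyE scaler_sumr; apply: eq_bigr => m _.
by rewrite scalerA [_ * r m]mulrC -hr.
Qed.

Lemma primitive_part (h : {mpoly {poly A}[N]}) : h != 0 ->
  exists k h', h = ('X - alpha%:P) ^+ k *: h' /\ map_mpoly (horner_eval alpha) h' != 0.
Proof.
move=> h0; have [m hm] : exists m, h@_m != 0.
  by exists (mlead h); rewrite mleadc_eq0.
(* Each division by the linear factor lowers the size of one fixed nonzero coefficient. *)
elim: (size h@_m) {-2}h (leqnn (size h@_m)) hm => {h h0} [|n IH] h.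
  by rewrite leqn0 size_poly_eq0 => /eqP ->; rewrite eqxx.
move=> hn hm; case: (eqVneq (map_mpoly (horner_eval alpha) h) 0) => [/root_divides[h' e]|]; last first.
  by move=> ?; exists 0%N, h; rewrite expr0 scale1r.
have hm' : h'@_m != 0 by apply: contraNneq hm => h'm; rewrite e mcoeffZ h'm mulr0.
have [|k [h'' [e' ?]]] := IH h' _ hm'; last first.
  by exists k.+1, h''; rewrite e e' scalerA exprS.
by move: hn; rewrite e mcoeffZ size_mul ?polyXsubC_eq0 // size_XsubC.
Qed.

(** Used twice: over C[q] with alpha = q^(a+1), to set t = q^(a+1) in a Macdonald polynomial, and
    over C with alpha = 0, to set q = 0 in the nondegeneracy argument. *)
Lemma primitive_multiple (h : {mpoly {fraction {poly A}}[N]}) : h != 0 ->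
  exists c h', [/\ c != 0, c *: h = map_mpoly tofrac h' & map_mpoly (horner_eval alpha) h' != 0].
Proof.
move=> h0; have [b [h1 [b0 e]]] := common_denominator h.
have h10 : h1 != 0.
  apply: contraNneq h0 => h1z; move/eqP: e; rewrite h1z rmorph0 scaler_eq0 tofrac_eq0 (negPf b0).
  by [].
have [k [h' [e' h'0]]] := primitive_part h10.
have t0 : tofrac (('X - alpha%:P) ^+ k) != 0 by rewrite tofrac_eq0 expf_neq0 // polyXsubC_eq0.
exists ((tofrac (('X - alpha%:P) ^+ k))^-1 * tofrac b), h'; split; last exact: h'0.
  by apply: mulf_neq0; [rewrite invr_eq0; exact: t0|rewrite tofrac_eq0; exact: b0].
exact: rescale_map e e' t0.
Qed.

End PrimitiveMultiple.

Section Naturality.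
Variables (N : nat) (R S : comNzRingType) (phi : {rmorphism R -> S}).
Implicit Types (f g A B : {mpoly R[N]}).

Lemma mdot_map A B : mdot (map_mpoly phi A) (map_mpoly phi B) = phi (mdot A B).
Proof.
pose k := maxn (msize (map_mpoly phi A)) (msize A).
rewrite (@mdotwE _ _ k) ?leq_maxl // (@mdotwE _ _ k) ?leq_maxr // rmorph_sum.
by apply: eq_bigr => m _; rewrite !mcoeff_map_mpoly rmorphM.
Qed.

Lemma map_mpolyXi (i : 'I_N) : map_mpoly phi 'X_i = 'X_i.
Proof. by rewrite map_mpolyX. Qed.

Lemma map_half_mon a : map_mpoly phi (half_mon R N a) = half_mon S N a.
Proof.
rewrite rmorphM !rmorph_prod; congr (_ * _); apply: eq_bigr => p _.
  by rewrite rmorphM /= !map_mpolyXi.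
by rewrite rmorph_prod; apply: eq_bigr => k _; rewrite /= map_mpolyXi.
Qed.

Lemma map_kernel1 a q : map_mpoly phi (@kernel R N a q (fun=> 1)) = kernel a (phi q) (fun=> 1).
Proof.
have e1 (T : comNzRingType) : (fun i : 'I_N => 1 *: 'X_i : {mpoly T[N]}) = (fun i => 'X_i).
  by apply/funext => i; rewrite scale1r.
have eX : map_mpoly phi \o (fun i : 'I_N => 'X_i) = (fun i => 'X_i).
  by apply/funext => i; rewrite /= map_mpolyXi.
rewrite /kernel !e1 !rmorphM rmorph_vdm rmorph_cross eX /= map_mpolyC.
congr (_ * _); rewrite rmorph_prod; apply: eq_bigr => p _.
by rewrite rmorphB /= !map_mpolyXi.
Qed.

Lemma mform_map a q f g :
  mform a (phi q) (map_mpoly phi f) (map_mpoly phi g) = phi (mform a q f g).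
Proof. by rewrite /mform -map_kernel1 -map_half_mon -!rmorphM mdot_map. Qed.

Lemma msym_map f (s : 'S_N) : msym s (map_mpoly phi f) = map_mpoly phi (msym s f).
Proof. by apply/mpolyP => m; rewrite !(mcoeff_sym, mcoeff_map_mpoly). Qed.

Lemma sym_below_map lam f : sym_below lam f -> sym_below lam (map_mpoly phi f).
Proof.
move=> [sf hf]; split.
  by apply/issymP => s; rewrite msym_map (issymP _ sf).
move=> m; rewrite mcoeff_msupp mcoeff_map_mpoly => h; apply: hf; rewrite mcoeff_msupp.
by apply: contraNneq h => ->; rewrite raddf0.
Qed.

Lemma sym_strictly_below_map lam f :
  sym_strictly_below lam f -> sym_strictly_below lam (map_mpoly phi f).
Proof.
by move=> [sf f0]; split; [exact: sym_below_map|rewrite mcoeff_map_mpoly f0 raddf0].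
Qed.

Hypothesis phi_inj : injective phi.

Lemma sym_below_map_inv lam f : sym_below lam (map_mpoly phi f) -> sym_below lam f.
Proof.
move=> [sf hf]; split.
  apply/issymP => s; apply/mpolyP => m; apply: phi_inj.
  by rewrite -!mcoeff_map_mpoly -msym_map (issymP _ sf).
move=> m mf; apply: hf; move: mf; rewrite !mcoeff_msupp mcoeff_map_mpoly.
by apply: contraNneq => h; apply/eqP/phi_inj; rewrite h rmorph0.
Qed.

Lemma sym_strictly_below_map_inv lam f :
  sym_strictly_below lam (map_mpoly phi f) -> sym_strictly_below lam f.
Proof.
move=> [sf f0]; split; first exact: sym_below_map_inv.
by apply: phi_inj; rewrite -mcoeff_map_mpoly f0 rmorph0.
Qed.

End Naturality.

(** * Nondegeneracy of the form through q = 0 *)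

Section NonDegenerate.
Variables (N : nat).

(** At q = 0 only the factors k = 0 of the weight remain. Their product over i != j is V(x) V(1/x)
    for the Vandermonde product V, which splits evenly between the two arguments. *)
Lemma mform0 (K : comNzRingType) a (f g : {mpoly K[N]}) :
  mform a 0 f g = mdot (vdm (fun i => 'X_i) * f) (vdm (fun i => 'X_i) * g).
Proof.
pose M : {mpoly K[N]} := \prod_(p : 'I_N * 'I_N | p.1 != p.2) \prod_(k < a) 'X_p.1.
pose M2 : {mpoly K[N]} := \prod_(p : 'I_N * 'I_N | (p.1 < p.2)%N) ('X_p.2 * 'X_p.1).
have hM A B : mdot (M * A) (M * B) = mdot A B.
  have : adjoint_mul M M 1; last by move=> ->; rewrite mul1r.
  have hp (I : finType) (P : pred I) (G : I -> {mpoly K[N]}) :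
    (forall i, P i -> adjoint_mul (G i) (G i) 1) -> adjoint_mul (\prod_(i | P i) G i) (\prod_(i | P i) G i) 1.
    move=> h; have := adjoint_mul_prod (index_enum I) (V := fun=> 1) h.
    by rewrite [\prod_(i | _) 1]big1.
  by apply: (hp) => p _; apply: hp => k _ A' B'; rewrite mdot_mulX mul1r.
have -> : mform a 0 f g = mdot (M * (vdm_rev K N * (vdm (fun i => 'X_i) * f))) (M * (M2 * g)).
  rewrite /mform /kernel; congr mdot; last first.
    rewrite /half_mon mulrA; congr (_ * _); rewrite mulrC; congr (_ * _).
    by apply: eq_bigr => p _; rewrite mulrC.
  have -> : (fun i : 'I_N => 1 *: 'X_i : {mpoly K[N]}) = (fun i => 'X_i).
    by apply/funext => i; rewrite scale1r.
  have -> : cross a 0%:MP (fun i : 'I_N => 'X_i : {mpoly K[N]}) (fun i => 'X_i) = M.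
    rewrite /M -(swap_pair_prod (fun i j => \prod_(k < a) ('X_i : {mpoly K[N]}))).
    apply: eq_bigr => p _; apply: eq_bigr => k _.
    by rewrite -rmorphXn exprS mul0r rmorph0 mul0r subr0.
  by rewrite -!mulrA [vdm _ * (M * _)]mulrCA [vdm_rev _ _ * (M * _)]mulrCA.
rewrite hM; have : adjoint_mul (vdm_rev K N) M2 (vdm (fun i => 'X_i)); last by move=> ->.
apply: adjoint_mul_prod => p _; have := @adjoint_mul_lin N K 1 1 p.2 p.1.
by rewrite !scale1r.
Qed.

Lemma mdot_conj_eq0 (C : numClosedFieldType) (A : {mpoly C[N]}) :
  mdot A (map_mpoly Num.conj A) = 0 -> A = 0.
Proof.
move=> h; apply/eqP; rewrite -msupp_eq0; apply/eqP.
case E : (msupp A) => [//|m s]; have mA : m \in msupp A by rewrite E mem_head.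
have : A@_m * (map_mpoly Num.conj A)@_m = 0.
  move: h => /eqP; rewrite /mdot psumr_eq0 => [/allP/(_ m mA)/eqP //|k _].
  by rewrite mcoeff_map_mpoly mul_conjC_ge0.
rewrite mcoeff_map_mpoly => /eqP; rewrite mul_conjC_eq0 => /eqP e.
by move: mA; rewrite mcoeff_msupp e eqxx.
Qed.

Lemma vdmX_neq0 (K : fieldType) : vdm (fun i : 'I_N => 'X_i : {mpoly K[N]}) != 0.
Proof.
have := kernelX_neq0 N (0 : K) 0; rewrite mulf_eq0 negb_or; by case/andP.
Qed.

(** A nonzero g has a multiple h that is regular and nonzero at q = 0. It is tested against the
    complex conjugate of its value there, read as constant in q: at q = 0 the form then becomes the
    Hermitian square norm of V h(0), which is not zero. *)
Lemma mform_nondegenerate (C : numClosedFieldType) a (lam : 'X_{1..N}) (g : {mpoly (Cq C)[N]}) :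
  sym_strictly_below lam g ->
  (forall g', sym_strictly_below lam g' -> mform a (q_Cq C) g g' = 0) -> g = 0.
Proof.
move=> hg orth; apply/eqP; apply: contraT => g0.
have [c [h [c0 e h0]]] := primitive_multiple (0 : C) g0.
have hh : sym_strictly_below lam h.
  apply: (sym_strictly_below_map_inv (phi := @FracField.tofrac {poly C})).
    by move=> x y /eqP; rewrite tofrac_eq => /eqP.
  rewrite -e; case: hg => hg1 hg2; split; first exact: sym_belowZ.
  by rewrite mcoeffZ hg2 mulr0.
pose h1 := map_mpoly (horner_eval (0 : C)) h.
have hh1 : sym_strictly_below lam h1 by exact: sym_strictly_below_map.
pose k := map_mpoly (@polyC C) (map_mpoly Num.conj h1).
have hk : sym_strictly_below lam k by do 2![apply: sym_strictly_below_map].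
have e2 : mform a ('X : {poly C}) h k = 0.
  have := orth _ (sym_strictly_below_map (@FracField.tofrac {poly C}) hk).
  move/(congr1 (fun u => c * u)); rewrite mulr0 -mformZl e /q_Cq mform_map => /eqP.
  by rewrite tofrac_eq0 => /eqP.
have := congr1 (horner_eval 0) e2; rewrite -mform_map rmorph0 /= {1}/horner_eval hornerX mform0.
have -> : map_mpoly (horner_eval 0) k = map_mpoly Num.conj h1.
  apply/mpolyP => m; rewrite mcoeff_map_mpoly [k@_m]mcoeff_map_mpoly; exact: hornerC.
rewrite -/h1; set V := vdm _ => e3.
have eV : map_mpoly Num.conj V = V.
  by rewrite rmorph_vdm; congr vdm; apply/funext => i; rewrite /= map_mpolyXi.
have : V * h1 = 0 by apply: mdot_conj_eq0; rewrite rmorphM /= eV.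
by move/eqP; rewrite mulf_eq0 (negPf (vdmX_neq0 _)) (negPf h0).
Qed.

End NonDegenerate.

(** * Truncated weights, their constant terms and their limit *)

Lemma mul4_perm (E : comNzRingType) (b c d e : E) : b * c * (d * e) = d * b * (e * c).
Proof. by ring. Qed.

Lemma rmorphM3 (E E' : comNzRingType) (phi : {rmorphism E -> E'}) (b c d : E) (b' c' d' : E') :
  phi b = b' -> phi c = c' -> phi d = d' -> phi (b * c * d) = b' * c' * d'.
Proof. by rewrite !rmorphM => -> -> ->. Qed.

Lemma ratio_identity (E : comNzRingType) (f c xi xj yj : E) :
  f * (1 - c * (xi * yj)) * (xj * yj) = f * xj * yj - f * (c * xi * yj) * (xj * yj).
Proof. by ring. Qed.

Lemma ratio_identity2 (E : comNzRingType) (f c xi xj yj : E) :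
  f * xj * yj - f * (c * xi * yj) = f * ((xj - c * xi) * yj).
Proof. by ring. Qed.

Definition truncated_product (N : nat) (E : comNzRingType) (q t : E) (rho : 'I_N -> 'I_N -> E)
    (n : nat) : E :=
  \prod_(i < N) \prod_(j < N | j != i) \prod_(k < n)
    ((1 - q ^+ k * rho i j) * \sum_(l < n) (q ^+ k * t * rho i j) ^+ l).

Lemma rmorph_truncated_product (N : nat) (E E' : comNzRingType) (phi : {rmorphism E -> E'})
    (q t : E) (rho : 'I_N -> 'I_N -> E) n :
  phi (truncated_product q t rho n) =
    truncated_product (phi q) (phi t) (fun i j => phi (rho i j)) n.
Proof.
rewrite rmorph_prod; apply: eq_bigr => i _; rewrite rmorph_prod; apply: eq_bigr => j _.
rewrite rmorph_prod; apply: eq_bigr => k _.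
rewrite rmorphM rmorphB rmorph1 rmorphM rmorphXn rmorph_sum /=.
by congr (_ * _); apply: eq_bigr => l _; rewrite rmorphXn !rmorphM rmorphXn.
Qed.

Lemma eq_truncated_product (N : nat) (E : comNzRingType) (q q' t t' : E)
    (rho rho' : 'I_N -> 'I_N -> E) n : q = q' -> t = t' -> (forall i j, rho i j = rho' i j) ->
  truncated_product q t rho n = truncated_product q' t' rho' n.
Proof.
move=> -> -> e; congr truncated_product.
by apply/funext => i; apply/funext => j.
Qed.

Section ConstantTerm.
Variables (N : nat).

Section Ring.
Variable K : comNzRingType.
Implicit Types (F : {mpoly {mpoly K[N]}[N]}) (f g A : {mpoly K[N]}).

(** [constant_term] over any commutative ring: congruences modulo powers of q are stated over
    polynomial rings, before passing to fractions. *)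
Definition cterm F : K := \sum_(b <- msupp F) (F@_b)@_b.

Lemma ctermwE k F : (msize F <= k)%N -> cterm F = \sum_(m : 'X_{1..N < k}) (F@_m)@_m.
Proof.
move=> le_k; rewrite /cterm (big_mksub 'X_{1..N < k}) ?msupp_uniq //=; first last.
  by move=> x /msize_mdeg_lt /leq_trans; apply.
by rewrite big_rmcond //= => j /memN_msupp_eq0 ->; rewrite mcoeff0.
Qed.

Lemma cterm_is_additive : additive cterm.
Proof.
move=> F G; pose k := maxn (msize (F - G)) (maxn (msize F) (msize G)).
rewrite !(@ctermwE k) ?leq_max ?leqnn ?orbT // -sumrB.
by apply: eq_bigr => m _; rewrite !mcoeffB.
Qed.
HB.instance Definition _ := GRing.isAdditive.Build {mpoly {mpoly K[N]}[N]} K cterm cterm_is_additive.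

Lemma ctermD F G : cterm (F + G) = cterm F + cterm G.
Proof. exact: raddfD. Qed.

Lemma ctermB F G : cterm (F - G) = cterm F - cterm G.
Proof. exact: raddfB. Qed.

Lemma ctermC (c : K) F : cterm (c%:MP%:MP * F) = c * cterm F.
Proof.
pose k := maxn (msize (c%:MP%:MP * F)) (msize F).
rewrite !(@ctermwE k) ?leq_max ?leqnn ?orbT // mulr_sumr.
by apply: eq_bigr => m _; rewrite !mcoeffCM.
Qed.

Local Notation lift_y g := (map_mpoly (@mpolyC N K) g).

Lemma cterm_mdot A g : cterm (A%:MP * lift_y g) = mdot A g.
Proof.
pose k := maxn (msize (A%:MP * lift_y g)) (msize A).
rewrite (@ctermwE k) ?leq_max ?leqnn // (@mdotwE _ _ k) ?leq_max ?leqnn ?orbT //.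
by apply: eq_bigr => m _; rewrite mcoeffCM mcoeff_map_mpoly mulrC mcoeffCM mulrC.
Qed.

Lemma cterm_xy F i : cterm (F * (('X_i)%:MP * 'X_i)) = cterm F.
Proof.
elim/mpolyind: F => [|A m F _ _ IH]; first by rewrite mul0r.
rewrite mulrDl !ctermD IH; congr (_ + _).
have -> : A *: 'X_[m] = A%:MP * lift_y 'X_[m] by rewrite map_mpolyX mul_mpolyC.
rewrite cterm_mdot -(mdot_mulX U_(i)%MM A 'X_[m]) -cterm_mdot !rmorphM /= !map_mpolyX.
by rewrite (mul4_perm A%:MP).
Qed.

(* The two factors agree modulo [x_i y_i = 1]. *)
Definition same_cterm (U V : {mpoly {mpoly K[N]}[N]}) := forall F, cterm (F * U) = cterm (F * V).

Lemma same_cterm_prod (I : Type) (s : seq I) (P : pred I) U V :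
  (forall i, P i -> same_cterm (U i) (V i)) ->
  same_cterm (\prod_(i <- s | P i) U i) (\prod_(i <- s | P i) V i).
Proof.
move=> h; apply: (big_ind2 same_cterm) h => // U1 U2 V1 V2 hU hV F.
by rewrite (mulrA F) (hV (F * U1)) (mulrAC F U1) (hU (F * V2)) (mulrAC F V2) (mulrA F).
Qed.

Definition ratio (i j : 'I_N) : {mpoly {mpoly K[N]}[N]} := ('X_i)%:MP * 'X_j.

Lemma same_cterm_ratio (c : K) i j :
  same_cterm (1 - c%:MP%:MP * ratio i j) (('X_j - c *: 'X_i)%:MP * 'X_j).
Proof.
move=> F; rewrite -[LHS](cterm_xy _ j).
rewrite /ratio ratio_identity ctermB cterm_xy -ctermB ratio_identity2.
by rewrite -(mul_mpolyC c) mpolyCB mpolyCM.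
Qed.

Definition weight (q : K) (n : nat) : {mpoly {mpoly K[N]}[N]} :=
  \prod_(i < N) \prod_(j < N | j != i) \prod_(k < n) (1 - q%:MP%:MP ^+ k * ratio i j).

Lemma cterm_weight a q f g : cterm (f%:MP * lift_y g * weight q a.+1) = mform a q f g.
Proof.
pose L : {mpoly K[N]} := \prod_(p : 'I_N * 'I_N | p.1 != p.2) \prod_(k < a.+1) ('X_p.2 - q ^+ k *: 'X_p.1).
pose M : {mpoly K[N]} := \prod_(p : 'I_N * 'I_N | p.1 != p.2) \prod_(k < a.+1) 'X_p.2.
have eW : weight q a.+1 = \prod_(p : 'I_N * 'I_N | p.1 != p.2) \prod_(k < a.+1)
    (1 - (q ^+ k)%:MP%:MP * ratio p.1 p.2).
  rewrite /weight pair_big_dep /=; apply: eq_big => [p|p _]; first by rewrite eq_sym.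
  by apply: eq_bigr => k _; rewrite !rmorphXn.
have -> : cterm (f%:MP * lift_y g * weight q a.+1) = cterm ((L * f)%:MP * lift_y (M * g)).
  have sW : same_cterm (weight q a.+1) (\prod_(p : 'I_N * 'I_N | p.1 != p.2) \prod_(k < a.+1)
      (('X_p.2 - q ^+ k *: 'X_p.1)%:MP * 'X_p.2)).
    by rewrite eW; do 2![apply: same_cterm_prod => ? _]; exact: same_cterm_ratio.
  rewrite sW; congr cterm.
  under eq_bigr => p _ do rewrite big_split /=.
  rewrite big_split /= [(L * f)%:MP]mpolyCM [lift_y (M * g)]rmorphM /=.
  have -> : L%:MP_[N] = \prod_(p : 'I_N * 'I_N | p.1 != p.2) \prod_(k < a.+1) ('X_p.2 - q ^+ k *: 'X_p.1)%:MP.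
    by rewrite /L rmorph_prod; apply: eq_bigr => p _; rewrite rmorph_prod.
  have -> : lift_y M = \prod_(p : 'I_N * 'I_N | p.1 != p.2) \prod_(k < a.+1) 'X_p.2.
    rewrite /M rmorph_prod; apply: eq_bigr => p _; rewrite rmorph_prod; apply: eq_bigr => k _.
    by rewrite /= map_mpolyX.
  exact: mul4_perm.
rewrite cterm_mdot /mform; congr (mdot (_ * _) (_ * _)).
  rewrite /kernel; have -> : (fun i : 'I_N => 1 *: 'X_i : {mpoly K[N]}) = (fun i => 'X_i).
    by apply/funext => i; rewrite scale1r.
  rewrite /L; under eq_bigr => p _ do rewrite big_ord_recl expr0 scale1r.
  rewrite big_split /= mulrA; congr (_ * _); last first.
    by apply: eq_bigr => p _; apply: eq_bigr => k _; rewrite -rmorphXn mul_mpolyC.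
  rewrite (bigID (fun p : 'I_N * 'I_N => p.1 < p.2)%N) /= mulrC; congr (_ * _).
    have inj_s : injective (fun p : 'I_N * 'I_N => (p.2, p.1)) by move=> [i j] [i' j'] /= [-> ->].
    rewrite (reindex_inj inj_s) /=; apply: eq_bigl => p.
    by rewrite -leqNgt ltn_neqAle eq_sym.
  by apply: eq_bigl => p; rewrite ltn_neqAle andbA andbb.
rewrite /M /half_mon; under eq_bigr => p _ do rewrite big_ord_recl.
rewrite big_split /=; congr (_ * _); last first.
  by rewrite (swap_pair_prod (fun i j => \prod_(k < a) ('X_i : {mpoly K[N]}))).
rewrite (bigID (fun p : 'I_N * 'I_N => p.1 < p.2)%N) /=.
rewrite big_split /= mulrC; congr (_ * _).
  have inj_s : injective (fun p : 'I_N * 'I_N => (p.2, p.1)) by move=> [i j] [i' j'] /= [-> ->].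
  rewrite (reindex_inj inj_s) /=; apply: eq_bigl => p.
  by rewrite -leqNgt ltn_neqAle eq_sym.
by apply: eq_bigl => p; rewrite ltn_neqAle andbA andbb.
Qed.

Definition tweight (q t : K) (n : nat) : {mpoly {mpoly K[N]}[N]} :=
  truncated_product q%:MP%:MP t%:MP%:MP ratio n.

Definition tform q t f g n := cterm (f%:MP * lift_y g * tweight q t n).

Lemma tformDr q t f g1 g2 n : tform q t f (g1 + g2) n = tform q t f g1 n + tform q t f g2 n.
Proof. by rewrite /tform rmorphD mulrDr mulrDl ctermD. Qed.

Lemma tformZr q t (c : K) f g n : tform q t f (c *: g) n = c * tform q t f g n.
Proof.
rewrite /tform map_mpolyZ -ctermC -mul_mpolyC; congr cterm.
by rewrite /= mulrCA !mulrA.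
Qed.

Lemma tformZl q t (c : K) f g n : tform q t (c *: f) g n = c * tform q t f g n.
Proof. by rewrite /tform -ctermC -mul_mpolyC mpolyCM -!mulrA. Qed.

End Ring.
End ConstantTerm.

Section Congruence.
Variables (E : comNzRingType).
Implicit Types (c x y q r : E).

Definition congr_mod c x y := exists g, x = y + c * g.

Lemma congr_mod_refl c x : congr_mod c x x.
Proof. by exists 0; rewrite mulr0 addr0. Qed.

Lemma congr_modM c x1 y1 x2 y2 :
  congr_mod c x1 y1 -> congr_mod c x2 y2 -> congr_mod c (x1 * x2) (y1 * y2).
Proof.
move=> [g1 ->] [g2 ->]; exists (y1 * g2 + g1 * y2 + c * g1 * g2).
by ring.
Qed.

Lemma congr_mod_prod (I : Type) (s : seq I) (P : pred I) c (G H : I -> E) :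
  (forall i, P i -> congr_mod c (G i) (H i)) ->
  congr_mod c (\prod_(i <- s | P i) G i) (\prod_(i <- s | P i) H i).
Proof.
move=> h; apply: big_ind2 => //; first exact: congr_mod_refl.
by move=> *; apply: congr_modM.
Qed.

Lemma congr_mod_prod1 (I : Type) (s : seq I) (P : pred I) c (G : I -> E) :
  (forall i, P i -> congr_mod c (G i) 1) -> congr_mod c (\prod_(i <- s | P i) G i) 1.
Proof.
move=> h; apply: (big_ind (fun x => congr_mod c x 1)) => //; first exact: congr_mod_refl.
by move=> x y hx hy; have := congr_modM hx hy; rewrite mulr1.
Qed.

Lemma truncated_factor q r a n : (a < n)%N ->
  congr_mod (q ^+ n)
    (\prod_(k < n) ((1 - q ^+ k * r) * \sum_(l < n) (q ^+ k * q ^+ a.+1 * r) ^+ l))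
    (\prod_(k < a.+1) (1 - q ^+ k * r)).
Proof.
move=> lt_an; have [m en] : exists m, n = (a.+1 + m)%N by exists (n - a.+1)%N; rewrite subnKC.
pose S k : E := \sum_(l < n) (q ^+ k * q ^+ a.+1 * r) ^+ l.
have split (G : nat -> E) : \prod_(k < n) G k = \prod_(k < m) G k * \prod_(k < a.+1) G (m + k)%N.
  by rewrite en addnC big_split_ord.
have split' (G : nat -> E) : \prod_(k < n) G k = \prod_(k < a.+1) G k * \prod_(k < m) G (a.+1 + k)%N.
  by rewrite en big_split_ord.
rewrite big_split /= (split' (fun k => 1 - q ^+ k * r)) (split S).
rewrite -mulrA [X in _ * X]mulrA -big_split /=.
rewrite -[X in congr_mod _ _ X]mulr1; apply: congr_modM; first exact: congr_mod_refl.
rewrite -[X in congr_mod _ _ X]mulr1; apply: congr_modM.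
  apply: congr_mod_prod1 => k _.
  have -> : (1 - q ^+ (a.+1 + k) * r) * S k = 1 - (q ^+ (a.+1 + k) * r) ^+ n.
    rewrite -[RHS]opprB subrX1 -[RHS]mulNr opprB; congr (_ * _).
    by apply: eq_bigr => l _; rewrite -exprD addnC.
  exists (- (q ^+ ((a + k) * n) * r ^+ n)).
  rewrite exprMn -exprM addSn mulSn exprD; ring.
apply: congr_mod_prod1 => k _.
rewrite /S en addSn big_ord_recl /= expr0.
exists (\sum_(l < a + m) q ^+ k * r * (q ^+ (m + k) * q ^+ a.+1 * r) ^+ l); congr (_ + _).
rewrite mulr_sumr; apply: eq_bigr => l _ /=.
rewrite /bump /= add1n exprS; set U := _ ^+ l.
by rewrite mulrA; congr (_ * U); rewrite -addSn !exprD; ring.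
Qed.

End Congruence.

Section TruncatedForm.
Variable N : nat.

Lemma tform_congr (K : comNzRingType) (q : K) a (f g : {mpoly K[N]}) n : (a < n)%N ->
  congr_mod (q ^+ n) (tform q (q ^+ a.+1) f g n) (mform a q f g : K).
Proof.
move=> lt_an; rewrite -(@cterm_weight N).
suff [G e] : congr_mod (q%:MP%:MP ^+ n) (tweight N q (q ^+ a.+1) n) (weight N q a.+1).
  by rewrite /tform e mulrDr ctermD; exists (cterm (f%:MP * map_mpoly (@mpolyC N K) g * G));
     rewrite -ctermC !rmorphXn /= [_ * (_ * G)]mulrCA.
do 2![apply: congr_mod_prod => ? _]; rewrite !rmorphXn; exact: truncated_factor.
Qed.

Section Naturality.
Variables (K K' : comNzRingType) (phi : {rmorphism K -> K'}).

Lemma cterm_map (F : {mpoly {mpoly K[N]}[N]}) :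
  cterm (map_mpoly (map_mpoly phi) F) = phi (cterm F).
Proof.
pose k := maxn (msize (map_mpoly (map_mpoly phi) F)) (msize F).
rewrite (@ctermwE _ _ k) ?leq_maxl // (@ctermwE _ _ k) ?leq_maxr // rmorph_sum.
by apply: eq_bigr => m _; rewrite !mcoeff_map_mpoly.
Qed.

Local Notation phi2 := (map_mpoly (map_mpoly phi)).

Lemma map2C (c : K) : phi2 (c%:MP%:MP : {mpoly {mpoly K[N]}[N]}) = (phi c)%:MP%:MP.
Proof. by rewrite map_mpolyC /=; congr (_%:MP); exact: map_mpolyC. Qed.

Lemma map2_ratio i j : phi2 (ratio K i j : {mpoly {mpoly K[N]}[N]}) = ratio K' i j.
Proof.
by rewrite /ratio rmorphM /= map_mpolyC map_mpolyX /=; congr (_%:MP * _); exact: map_mpolyX.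
Qed.

Lemma map2_tweight q t n : phi2 (tweight N q t n) = tweight N (phi q) (phi t) n.
Proof.
apply: etrans (@rmorph_truncated_product N _ _ phi2 q%:MP%:MP t%:MP%:MP (@ratio N K) n) _.
exact: (eq_truncated_product n (map2C q) (map2C t) map2_ratio).
Qed.

Lemma tform_map q t (f g : {mpoly K[N]}) n :
  tform (phi q) (phi t) (map_mpoly phi f) (map_mpoly phi g) n = phi (tform q t f g n).
Proof.
rewrite /tform -cterm_map; congr cterm; apply/esym.
apply: (@rmorphM3 _ _ phi2); [exact: map_mpolyC| |exact: map2_tweight].
apply/mpolyP => m; apply: etrans (mcoeff_map_mpoly _ _ _) _.
apply: etrans (congr1 (map_mpoly phi) (mcoeff_map_mpoly (@mpolyC N K) m g)) _.
apply: etrans (map_mpolyC _ _ _) _; apply/esym.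
apply: etrans (mcoeff_map_mpoly (@mpolyC N K') m (map_mpoly phi g)) _.
by rewrite mcoeff_map_mpoly.
Qed.

End Naturality.
End TruncatedForm.

Lemma eq_tform (N : nat) (K : comNzRingType) (q q' t t' : K) (f g : {mpoly K[N]}) n :
  q = q' -> t = t' -> tform q t f g n = tform q' t' f g n.
Proof. by move=> -> ->. Qed.

Lemma cancel_congr (R : comNzRingType) (b u c e w : R) : b * u = b * u + b * (c * e * w) - c * (e * (b * w)).
Proof. by ring. Qed.

Section FormalLimit.
Variables (C : fieldType) (a : nat).

Definition in_power (M : nat) (r : {poly {poly C}}) := forall i j, (i + j < M)%N -> (r`_j)`_i = 0.

Definition divXn (M : nat) (p : {poly C}) := exists s, p = 'X^M * s.

Lemma divXn_sum M (I : Type) (s : seq I) (P : pred I) (G : I -> {poly C}) :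
  (forall i, P i -> divXn M (G i)) -> divXn M (\sum_(i <- s | P i) G i).
Proof.
move=> h; apply: (big_ind (divXn M)) => //; first by exists 0; rewrite mulr0.
by move=> x y [u ->] [v ->]; exists (u + v); rewrite mulrDr.
Qed.

Lemma divXn_le M M' p : (M' <= M)%N -> divXn M p -> divXn M' p.
Proof. by move=> le [s ->]; exists ('X^(M - M') * s); rewrite mulrA -exprD subnKC. Qed.

Lemma divXn_eq0 p : (forall M, divXn M p) -> p = 0.
Proof.
move=> h; apply/eqP; apply: contraT => p0; have [s e] := h (size p).
have s0 : s != 0 by apply: contraNneq p0 => s0; rewrite e s0 mulr0.
have := congr1 (fun u : {poly C} => size u) e.
have X0 : 'X^(size p) != 0 :> {poly C} by rewrite -size_poly_eq0 size_polyXn.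
rewrite size_mul // size_polyXn; move: s0; rewrite -size_poly_gt0.
by move: (size s) (size p) => m n; lia.
Qed.

(** t - q^(a+1) has order one at the origin with t among its lowest terms, so cancelling it costs
    one order. The coefficient of q^i t^(j+1) in the product is that of q^i t^j in r minus one with
    smaller q-exponent, whence the induction on i. *)
Lemma in_power_div M r : in_power M.+1 (('X - ('X^(a.+1))%:P) * r) -> in_power M r.
Proof.
move=> h i; elim/ltn_ind: i => i IH j lt.
have := h i j.+1; rewrite addnS ltnS => /(_ lt).
rewrite mulrBl coefB coefB coefXM /= coefCM coefXnM => /eqP; rewrite subr_eq0 => /eqP ->.
case: ltnP => // le; apply: IH; first by rewrite ltn_subrL (leq_trans _ le).
by rewrite addnS (leq_trans _ lt) // ltnS -addSn leq_add2r; lia.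
Qed.

Lemma in_power_divX k M r : in_power (M + k) (('X - ('X^(a.+1))%:P) ^+ k * r) -> in_power M r.
Proof.
elim: k => [|k IH]; first by rewrite expr0 mul1r addn0.
by rewrite addnS exprS -mulrA => /in_power_div.
Qed.

Lemma in_power_eval M r : in_power M r -> divXn M r.['X^(a.+1)].
Proof.
move=> h; rewrite horner_coef; apply: divXn_sum => j _.
have e : take_poly (M - j) r`_j = 0.
  by apply/polyP => i; rewrite coef_take_poly coef0; case: ltnP => // lt; apply: h; lia.
rewrite -(poly_take_drop (M - j) r`_j) e add0r.
apply: (@divXn_le (M - j + a.+1 * j)); first by nia.
by exists (drop_poly (M - j) r`_j); rewrite exprD exprM -[LHS]mulrA mulrC.
Qed.

Variable N : nat.
Local Notation S := {poly {poly C}}.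
Local Notation sp := (horner_eval ('X^(a.+1) : {poly C})).

(** The denominator d of the limit may vanish at t = q^(a+1); its power of t - q^(a+1) is split off,
    and the k orders lost by cancelling it are made up by asking for order M + k. Substitution
    carries order M in (q,t) to order M in q, and there the truncated form agrees with [mform]
    modulo q^n. *)
Lemma specialized_form_eq0 (f g : {mpoly S[N]}) :
  formally_tends_to_0 (fun n => (tform ('X : {poly C})%:P 'X f g n)%:F : Cqt C) ->
  mform a ('X : {poly C}) (map_mpoly sp f) (map_mpoly sp g) = 0.
Proof.
case=> d d0 lim; set u := mform _ _ _ _.
have [k [d' ndv ed]] := multiplicity_XsubC d ('X^(a.+1) : {poly C}).
rewrite d0 /= in ndv.
have dv0 : d'.['X^(a.+1)] != 0 by [].
suff : d'.['X^(a.+1)] * u = 0 by move/eqP; rewrite mulf_eq0 (negPf dv0) => /eqP.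
apply: divXn_eq0 => M; have [K0 hK] := lim (M + k)%N.
pose n := maxn K0 (maxn M a.+1).
have [|r er hr] := hK n; first exact: leq_maxl.
set v := tform _ _ _ _ _ in er.
have erS : d * v = r by apply/eqP; rewrite -tofrac_eq tofracM; apply/eqP; exact: er.
have hr' : in_power (M + k) (('X - ('X^(a.+1))%:P) ^+ k * (d' * v)).
  rewrite (_ : _ * (d' * v) = r); first by move=> i j; exact: hr.
  by rewrite -erS ed mulrA [d' * _]mulrC.
have := in_power_eval (in_power_divX hr'); rewrite hornerM.
have [w ew] : congr_mod ('X^n) (v.['X^(a.+1)]) u.
  have -> : v.['X^(a.+1)] = tform 'X 'X^(a.+1) (map_mpoly sp f) (map_mpoly sp g) n.
    apply: etrans (esym (tform_map sp ('X : {poly C})%:P 'X f g n)) _.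
    exact: (eq_tform _ _ _ (hornerC _ _) (hornerX _)).
  by apply: tform_congr; rewrite !leq_max leqnn !orbT.
rewrite ew mulrDr => -[s es]; exists (s - 'X^(n - M) * (d'.['X^(a.+1)] * w)).
rewrite mulrBr -es (_ : 'X^n = 'X^M * 'X^(n - M)).
  exact: cancel_congr.
by rewrite -exprD subnKC // !leq_max leqnn orbT.
Qed.

End FormalLimit.

Section Partitions.
Variable N : nat.
Implicit Types (m lam mu : 'X_{1..N}).

Lemma psum_mdeg m k : (N <= k)%N -> psum m k = mdeg m.
Proof.
move=> le; rewrite /psum mdegE; apply: eq_bigl => i.
by rewrite (leq_trans (ltn_ord i) le).
Qed.

Lemma is_partition_leq lam (i j : 'I_N) : is_partition lam -> (i <= j)%N -> (lam j <= lam i)%N.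
Proof. by move=> /forallP/(_ i)/forallP/(_ j)/implyP. Qed.

Lemma below_perm lam m (s : 'S_N) : is_partition lam -> (forall i, m i = lam (s i)) -> below lam m.
Proof.
move=> pl e; have em : mdeg m = mdeg lam.
  rewrite !mdegE [RHS](reindex_inj (@perm_inj _ s)) /=; apply: eq_bigr => i _; exact: e.
split=> // k; case: (leqP N k) => [le|lt]; first by rewrite !psum_mdeg // em.
(* With t = lam_k, both sides are compared to k t plus the sum of all positive parts of lam_j - t:
   it bounds any k entries of lam, and is attained by the first k because lam is decreasing. *)
pose t := lam (Ordinal lt); rewrite /psum.
apply: (@leq_trans (\sum_(i < N | (i < k)%N) t + \sum_(i < N) (lam (s i) - t))%N).
  apply: (@leq_trans (\sum_(i < N | (i < k)%N) t + \sum_(i < N | (i < k)%N) (lam (s i) - t))%N).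
    by rewrite -big_split /=; apply: leq_sum => i _; rewrite e; lia.
  by rewrite leq_add2l [X in (_ <= X)%N](bigID (fun i : 'I_N => i < k)%N) /= leq_addr.
rewrite -(reindex_inj (@perm_inj _ s) (P := xpredT) (F := fun j => (lam j - t)%N)) /=.
rewrite [X in (_ + X <= _)%N](bigID (fun i : 'I_N => i < k)%N) /= [X in (_ + (_ + X) <= _)%N]big1; last first.
  move=> j; rewrite -leqNgt => le; apply/eqP; rewrite subn_eq0; exact: is_partition_leq.
rewrite addn0 -big_split /=; apply: leq_sum => j ltj.
by rewrite addnC subnK //; apply: is_partition_leq => //; exact: ltnW.
Qed.

Lemma below_psumS lam m : mdeg m = mdeg lam ->
  (forall k : 'I_N, (psum m k.+1 <= psum lam k.+1)%N) -> below lam m.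
Proof.
move=> e h; split=> // -[|k]; first by rewrite /psum !big_pred0.
case: (ltnP k N) => [lt|le]; first exact: (h (Ordinal lt)).
by rewrite !psum_mdeg ?e // ltnW.
Qed.

Lemma dominance_below lam mu : dominance_lt mu lam -> below lam mu /\ mu != lam.
Proof.
case/and3P => neq /eqP e /forallP h; split=> //; exact: below_psumS.
Qed.

Lemma below_lemc lam m : below lam m -> (m <= lam)%O.
Proof.
move=> [e h]; rewrite leNgt; apply/negP => /ltmcP - /(_ (esym e)) [i eqi lti].
have := h i.+1; rewrite !psumS leqNgt => /negP; apply.
have -> : psum lam i = psum m i by apply: eq_bigr => j ji; exact: eqi.
by rewrite ltn_add2l.
Qed.

Section MonomialSym.
Variable K : fieldType.

Lemma mcoeff_monomial_sym mu m :
  (monomial_sym K mu)@_m = [exists s : 'S_N, [forall i, m i == mu (s i)]]%:R.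
Proof.
rewrite /monomial_sym raddf_sum /=; under eq_bigr do rewrite mcoeffX.
case: (boolP [exists s, _]) => [orb|norb].
  have lt : (mdeg m < (mdeg mu).+1)%N.
    case/existsP: orb => s /forallP e; rewrite ltnS !mdegE.
    rewrite [X in (_ <= X)%N](reindex_inj (@perm_inj _ s)) /=; apply: leq_sum => i _.
    by rewrite (eqP (e i)).
  rewrite (bigD1 (BMultinom lt)) //= eqxx big1 ?addr0 // => m' /andP[_ neq].
  suff /negPf -> : (m' : 'X_{1..N}) != m by [].
  by apply: contraNneq neq => e; apply/eqP/val_inj.
rewrite big1 // => m' orb; case: eqP => // e; case/negP: norb.
by rewrite -e.
Qed.

Lemma monomial_sym_below mu m : is_partition mu -> m \in msupp (monomial_sym K mu) -> below mu m.
Proof.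
move=> pmu; rewrite mcoeff_msupp mcoeff_monomial_sym.
case: (boolP [exists s, _]) => [|_]; last by rewrite eqxx.
by move=> + _; case/existsP => s /forallP e; apply: (below_perm (s := s) pmu) => i; exact/eqP.
Qed.

Lemma mcoeff_monomial_sym_id mu : (monomial_sym K mu)@_mu = 1.
Proof.
rewrite mcoeff_monomial_sym (_ : [exists s, _]) //; apply/existsP; exists 1%g.
by apply/forallP => i; rewrite perm1.
Qed.

End MonomialSym.
End Partitions.

Lemma clear_denominator (K : fieldType) (b d n v : K) : b != 0 -> d * b * (n / b * v) = n * (d * v).
Proof. by move=> b0; field. Qed.

Section FormallyTends.
Variable C : fieldType.
Implicit Types (u v : nat -> Cqt C).

Lemma in_powerM M (w z : {poly {poly C}}) : in_power M z -> in_power M (w * z).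
Proof.
move=> hz i j lt; rewrite coefM coef_sum big1 // => k _; rewrite coefM big1 // => l _.
by rewrite hz ?mulr0 // (leq_ltn_trans _ lt) // leq_add ?leq_subr.
Qed.

Lemma tends0_add u v : formally_tends_to_0 u -> formally_tends_to_0 v ->
  formally_tends_to_0 (fun n => u n + v n).
Proof.
move=> [d d0 hu] [e e0 hv]; exists (d * e); first by rewrite mulf_neq0.
move=> M; have [K1 h1] := hu M; have [K2 h2] := hv M; exists (maxn K1 K2) => n.
rewrite geq_max => /andP[/h1[r er hr] /h2[s es hs]].
exists (e * r + d * s).
  rewrite rmorphD !rmorphM /= -er -es mulrDr !mulrA; congr (_ * _ + _).
  exact: mulrC.
by move=> i j lt; rewrite coefD coefD (in_powerM e hr) // (in_powerM d hs) // addr0.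
Qed.

Lemma tends0_scale (c : Cqt C) v : formally_tends_to_0 v -> formally_tends_to_0 (fun n => c * v n).
Proof.
move=> [d d0 hv]; have b0 := frac_denom_neq0 c; have ec := frac_numden c.
set n := \n_ _ in ec; set b := \d_ _ in b0 ec.
exists (d * b); first by rewrite mulf_neq0.
move=> M; have [K1 h1] := hv M; exists K1 => k /h1[r er hr]; exists (n * r).
  have bF : b%:F != 0 :> Cqt C by rewrite tofrac_eq0.
  rewrite !rmorphM /= -er {1}ec; exact: clear_denominator.
by move=> i j lt; exact: in_powerM hr _ _ lt.
Qed.

End FormallyTends.

(** * The specialized Macdonald polynomial *)

Section Specialization.
Variables (C : numClosedFieldType) (N a : nat) (P : 'X_{1..N} -> {mpoly (Cqt C)[N]}).
Hypothesis macP : is_macdonald P.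
Implicit Types (lam mu : 'X_{1..N}).

Lemma macdonald_below lam : is_partition lam -> sym_below lam (P lam) /\ (P lam)@_lam = 1.
Proof.
case: macP => symP triP _ pl; have [c e] := triP _ pl; split; last first.
  rewrite e mcoeffD mcoeff_monomial_sym_id raddf_sum big1 ?addr0 // => mu /andP[pmu dom] /=.
  rewrite mcoeffZ; apply/eqP; rewrite mulf_eq0 mcoeff_eq0; apply/orP; right.
  apply/negP => /(monomial_sym_below pmu) h; have [h' neq] := dominance_below dom.
  by rewrite (below_anti h' h) eqxx in neq.
split; first exact: symP.
move=> m; rewrite e => /msuppD_le; rewrite mem_cat => /orP[/(monomial_sym_below pl) //|].
rewrite mcoeff_msupp => h; apply: contrapT => nb; case/eqP: h.
rewrite raddf_sum big1 // => mu /andP[pmu dom] /=.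
rewrite mcoeffZ; apply/eqP; rewrite mulf_eq0 mcoeff_eq0; apply/orP; right.
apply/negP => /(monomial_sym_below pmu) h; apply: nb; apply: below_trans h.
exact: (dominance_below dom).1.
Qed.

Lemma truncated_formE (f g : {mpoly (Cqt C)[N]}) n :
  truncated_form f g n = tform (q_Cqt C) (t_Cqt C) f g n.
Proof. by []. Qed.

Lemma macdonald_orthogonal0 (f : {mpoly (Cqt C)[N]}) : macdonald_orthogonal f 0.
Proof.
exists 1; first exact: oner_neq0.
move=> n; exists 0%N => K _; exists 0; last by move=> i j _; rewrite !coef0.
rewrite truncated_formE -(scale0r (0 : {mpoly (Cqt C)[N]})) tformZr mul0r mulr0.
by rewrite rmorph0.
Qed.

(** Induction on the leading monomial mu of g, a partition because g is symmetric. Subtracting the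
    multiple of [P mu] with the same leading coefficient lowers it, and [P mu] is orthogonal to
    [P lam] since mu != lam. *)
Lemma macdonald_orthogonal_below lam g : is_partition lam -> sym_strictly_below lam g ->
  macdonald_orthogonal (P lam) g.
Proof.
move=> pl; case: macP => _ _ orthP.
elim/(well_founded_ind (@ltom_wf N)): {g}(mlead g) {-2}g (erefl (mlead g)) => mu IH g emu hg.
case: (eqVneq g 0) => [->|g0]; first exact: macdonald_orthogonal0.
have mg : mu \in msupp g by rewrite -emu mlead_supp.
have bmu : below lam mu := hg.1.2 _ mg.
have nmu : mu != lam by apply: contraTneq mg => ->; rewrite mcoeff_msupp hg.2 eqxx.
have pmu : is_partition mu.
  by apply/forallP => i; apply/forallP => j; apply/implyP => le; rewrite -emu; apply: mlead_msym_sorted => //; exact: hg.1.1.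
have [hP P1] := macdonald_below pmu.
pose g' := g - g@_mu *: P mu.
have hP' : sym_below lam (P mu) by split; [exact: hP.1|move=> m mm; exact: below_trans bmu (hP.2 _ mm)].
have hg' : sym_strictly_below lam g'.
  split; first by apply: sym_belowB; [exact: hg.1|exact: sym_belowZ].
  rewrite mcoeffB mcoeffZ hg.2 sub0r; apply/eqP; rewrite oppr_eq0 mulf_eq0; apply/orP; right.
  by rewrite mcoeff_eq0; apply/negP => mm; have h := hP.2 _ mm; rewrite (below_anti bmu h) eqxx in nmu.
have -> : g = g' + g@_mu *: P mu by rewrite /g' subrK.
rewrite /macdonald_orthogonal.
have e n : truncated_form (P lam) (g' + g@_mu *: P mu) n =
    truncated_form (P lam) g' n + g@_mu * truncated_form (P lam) (P mu) n.
  by rewrite !truncated_formE tformDr tformZr.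
rewrite (funext e); apply: tends0_add; last first.
  by apply: tends0_scale; apply: orthP => //; rewrite eq_sym.
case: (eqVneq g' 0) => [->|g'0]; first exact: macdonald_orthogonal0.
apply: (IH (mlead g')) => //; rewrite lt_neqAle; apply/andP; split.
  have := mlead_supp g'0; apply: contraTneq => ->.
  by rewrite mcoeff_msupp mcoeffB mcoeffZ P1 mulr1 subrr eqxx.
have := mlead_supp g'0 => /msuppB_le; rewrite mem_cat => /orP[/msupp_le_mlead|/msuppZ_le mm].
  by rewrite emu.
exact: below_lemc (hP.2 _ mm).
Qed.

Local Notation sp := (horner_eval ('X^(a.+1) : {poly C})).

Lemma subst_tE (c : Cqt C) (u b : {poly {poly C}}) :
  b.['X^(a.+1)] != 0 -> c = u%:F / b%:F ->
  subst_t a.+1 c = (u.['X^(a.+1)])%:F / (b.['X^(a.+1)])%:F.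
Proof.
move=> bX ec; have nz (w : {poly {poly C}}) : w.['X^(a.+1)] != 0 -> w != 0.
  by apply: contraNneq => ->; rewrite horner0.
apply: xget_unique; first by exists u, b.
move=> v [u' [b' [b'X ec' ->]]]; apply/eqP; rewrite frac_cross //.
have := etrans (esym ec) ec' => /eqP; rewrite frac_cross ?nz // => /eqP e.
by rewrite -!hornerM e.
Qed.

Theorem macdonald_specialization lam : is_partition lam -> exists p : {mpoly (Cq C)[N]},
  [/\ sym_below lam p, p@_lam != 0,
      forall g, sym_strictly_below lam g -> mform a (q_Cq C) p g = 0
    & forall m, subst_t a.+1 (P lam)@_m = p@_m / p@_lam].
Proof.
move=> pl; have [hP P1] := macdonald_below pl.
have P0 : P lam != 0 by apply: contra_eqN P1 => /eqP ->; rewrite mcoeff0 eq_sym oner_eq0.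
have [c [Q [c0 eQ Q0]]] := primitive_multiple ('X^(a.+1) : {poly C}) P0.
have inj2 : injective (@FracField.tofrac {poly {poly C}}) by move=> x y /eqP; rewrite tofrac_eq => /eqP.
have inj1 : injective (@FracField.tofrac {poly C}) by move=> x y /eqP; rewrite tofrac_eq => /eqP.
have hQ : sym_below lam Q.
  by apply: (sym_below_map_inv inj2); rewrite -eQ; exact: sym_belowZ.
pose Q1 := map_mpoly sp Q.
pose p := map_mpoly (@FracField.tofrac {poly C}) Q1.
have hp : sym_below lam p by do 2![apply: sym_below_map].
have orth g : sym_strictly_below lam g -> mform a (q_Cq C) p g = 0.
  move=> hg; have [b [g1 [b0 eg]]] := common_denominator g.
  have hg1 : sym_strictly_below lam g1.
    apply: (sym_strictly_below_map_inv inj1); rewrite -eg; case: hg => hg2 hg3.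
    by split; [exact: sym_belowZ|rewrite mcoeffZ hg3 mulr0].
  pose G := map_mpoly (@polyC {poly C}) g1.
  have hG : sym_strictly_below lam G by exact: sym_strictly_below_map.
  have lim : formally_tends_to_0 (fun n => (tform ('X : {poly C})%:P 'X Q G n)%:F : Cqt C).
    have e n : (tform ('X : {poly C})%:P 'X Q G n)%:F =
        c * truncated_form (P lam) (map_mpoly (@FracField.tofrac {poly {poly C}}) G) n.
      rewrite truncated_formE -tformZl eQ; apply/esym.
      exact: (tform_map (@FracField.tofrac {poly {poly C}})).
    rewrite (funext e); apply: tends0_scale; apply: macdonald_orthogonal_below => //.
    exact: sym_strictly_below_map.
  have := @specialized_form_eq0 C a N _ _ lim.
  have -> : map_mpoly sp G = g1.
    by apply/mpolyP => m; rewrite mcoeff_map_mpoly [G@_m]mcoeff_map_mpoly; exact: hornerC.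
  move=> e; have : b%:F * mform a (q_Cq C) p g = 0.
    by rewrite -mformZr eg /q_Cq /p mform_map e rmorph0.
  by move/eqP; rewrite mulf_eq0 tofrac_eq0 (negPf b0) => /eqP.
have pN0 : p != 0.
  apply: contraNneq Q0 => p0; apply/eqP/mpolyP => m; apply: inj1.
  by rewrite -mcoeff_map_mpoly -/Q1 -/p p0 !mcoeff0 rmorph0.
(* Otherwise p would be strictly below lam and orthogonal to everything strictly below lam, hence 0,
   although Q was chosen not to vanish at t = q^(a+1). So the coefficients of [P lam] have no pole
   there, and [subst_t] does not fall back on 0 for them. *)
have p0 : p@_lam != 0.
  apply: contraNneq pN0 => pl0; apply/eqP.
  by apply: (@mform_nondegenerate N C a lam).
exists p; split=> // m.
have pE k : p@_k = ((Q@_k).['X^(a.+1)])%:F.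
  by rewrite !mcoeff_map_mpoly.
have PE k : c * (P lam)@_k = (Q@_k)%:F by rewrite -mcoeffZ eQ mcoeff_map_mpoly.
rewrite !pE; apply: subst_tE; first by move: p0; rewrite pE tofrac_eq0.
have := PE lam; rewrite P1 mulr1 => <-; rewrite -PE mulrC mulKf //.
Qed.

End Specialization.

(** * The Pieri relation on the lattice *)

Lemma kernel_reorder (R : comNzRingType) (V D A0 A1 B0 B1 C0 C1 E0 E1 K : R) :
  D * A0 * (A1 * V) * (B0 * C0 * (B1 * E0 * (C1 * (E1 * K)))) =
  V * (E0 * (E1 * K)) * (D * (A0 * C0 * B0) * (A1 * C1 * B1)).
Proof. by ring. Qed.

Section KernelSplit.
Variables (F : fieldType) (q : F) (a : nat).

Lemma vdm_recl n (z : 'I_n.+1 -> F) :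
  vdm z = \prod_(j < n) (z (lift ord0 j) - z ord0) * vdm (z \o lift ord0).
Proof.
rewrite /vdm -(pair_big_dep xpredT (fun i j : 'I_n.+1 => i < j)%N (fun i j => z j - z i)) /=.
rewrite big_ord_recl /= big_mkcond big_ord_recl /= mul1r; congr (_ * _).
rewrite -(pair_big_dep xpredT (fun i j : 'I_n => i < j)%N (fun i j => z (lift ord0 j) - z (lift ord0 i))) /=.
by apply: eq_bigr => i _; rewrite big_mkcond big_ord_recl /= mul1r -big_mkcond.
Qed.

Lemma cross_recl n (x z : 'I_n.+1 -> F) :
  cross a q x z =
    \prod_(j < n) \prod_(k < a) (x (lift ord0 j) - q ^+ k.+1 * z ord0) *
    (\prod_(i < n) \prod_(k < a) (x ord0 - q ^+ k.+1 * z (lift ord0 i)) *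
     cross a q (x \o lift ord0) (z \o lift ord0)).
Proof.
pose G (m : nat) (x' z' : 'I_m -> F) i j := \prod_(k < a) (x' j - q ^+ k.+1 * z' i).
rewrite /cross -(pair_big_dep xpredT (fun i j : 'I_n.+1 => i != j) (G _ x z)) /=.
rewrite big_ord_recl /= big_mkcond big_ord_recl /= mul1r; congr (_ * _).
rewrite -(pair_big_dep xpredT (fun i j : 'I_n => i != j) (G _ (x \o lift ord0) (z \o lift ord0))) /=.
rewrite -big_split /=; apply: eq_bigr => i _.
rewrite big_mkcond big_ord_recl /=; congr (_ * _).
rewrite -big_mkcond; apply: eq_bigl => j.
by rewrite (inj_eq lift_inj).
Qed.

Definition pt n (u v : F) (y : 'I_n -> F) : 'I_n.+2 -> F :=
  fun i => if unlift ord0 i is Some j then (if unlift ord0 j is Some k then y k else v) else u.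

Lemma pt0 n u v (y : 'I_n -> F) : pt u v y ord0 = u.
Proof. by rewrite /pt unlift_none. Qed.
Lemma pt1 n u v (y : 'I_n -> F) : pt u v y (lift ord0 ord0) = v.
Proof. by rewrite /pt liftK unlift_none. Qed.
Lemma pt2 n u v (y : 'I_n -> F) k : pt u v y (lift ord0 (lift ord0 k)) = y k.
Proof. by rewrite /pt !liftK. Qed.

(** The factors of [vdm] and [cross] in which a shifted coordinate z meets the tail y or the other
    leading coordinate x. The factor k = 0 of the first product comes from the Vandermonde. *)
Definition tail_factor n (y : 'I_n -> F) (x z : F) : F :=
  \prod_(j < n) \prod_(k < a.+1) (y j - q ^+ k * z) * \prod_(k < a) (x - q ^+ k.+1 * z).

Definition rest_factor n (y : 'I_n -> F) (x0 x1 : F) : F :=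
  vdm y * (\prod_(i < n) \prod_(k < a) (x0 - q ^+ k.+1 * y i) *
  (\prod_(i < n) \prod_(k < a) (x1 - q ^+ k.+1 * y i) * cross a q y y)).

Lemma kernel_pt n (y : 'I_n -> F) x0 x1 z0 z1 :
  vdm (pt z0 z1 y) * cross a q (pt x0 x1 y) (pt z0 z1 y) =
  rest_factor y x0 x1 * ((z1 - z0) * tail_factor y x1 z0 * tail_factor y x0 z1).
Proof.
have e2 u v : (pt u v y \o lift ord0) \o lift ord0 = y by apply/funext => k; rewrite /= pt2.
have split z : \prod_(j < n) \prod_(k < a.+1) (y j - q ^+ k * z) =
    \prod_(j < n) (y j - z) * \prod_(j < n) \prod_(k < a) (y j - q ^+ k.+1 * z).
  by rewrite -big_split; apply: eq_bigr => j _; rewrite big_ord_recl expr0 mul1r.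
have eV : vdm (pt z0 z1 y) = (z1 - z0) * \prod_(j < n) (y j - z0) * (\prod_(j < n) (y j - z1) * vdm y).
  rewrite vdm_recl vdm_recl e2 big_ord_recl /= pt0 pt1; congr (_ * _ * (_ * _));
    by apply: eq_bigr => j _; rewrite pt2.
have eC : cross a q (pt x0 x1 y) (pt z0 z1 y) =
   \prod_(k < a) (x1 - q ^+ k.+1 * z0) * \prod_(j < n) \prod_(k < a) (y j - q ^+ k.+1 * z0) *
   (\prod_(k < a) (x0 - q ^+ k.+1 * z1) * \prod_(j < n) \prod_(k < a) (x0 - q ^+ k.+1 * y j) *
    (\prod_(j < n) \prod_(k < a) (y j - q ^+ k.+1 * z1) *
     (\prod_(j < n) \prod_(k < a) (x1 - q ^+ k.+1 * y j) * cross a q y y))).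
  rewrite cross_recl cross_recl !e2 !big_ord_recl /= !pt0 !pt1.
  congr (_ * _ * (_ * _ * (_ * (_ * _))));
    by apply: eq_bigr => j _; apply: eq_bigr => k _; rewrite pt2.
rewrite eV eC /rest_factor /tail_factor !split.
exact: kernel_reorder.
Qed.

End KernelSplit.

Section Pieri.
Variables (F : fieldType) (q : F) (a r n : nat).
Hypothesis char2 : 2%:R != 0 :> F.
Variable (f : {mpoly F[n.+2]}).
Hypothesis sf : f \is symmetric.

Local Notation comps := {ffun 'I_n.+2 -> 'I_r.+1}.
Local Notation term := (noumi_term q a idfun).
Local Notation scale := (@qscale F q n.+2 r F idfun).

Definition tail (m : nat) (mu : comps) := [forall i : 'I_n.+2, (m <= i)%N ==> (mu i == 0%N :> nat)].

(** For i >= 2 the relation x_(i-1) = q^(a+1) x_i forces mu_i + a < a + 1. Rows are treated from the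
    last one upwards, because the condition already gained must not involve the two rows being
    exchanged. *)
Lemma sum_kill_tail (x : 'I_n.+2 -> F) :
  (forall i j : 'I_n.+2, (2 <= i)%N -> i = j.+1 :> nat -> x j = q ^+ a.+1 * x i) ->
  \sum_(mu : comps | is_comp mu) term x f (scale x mu) =
  \sum_(mu : comps | is_comp mu && tail 2 mu) term x f (scale x mu).
Proof.
move=> hx; suff h m : (m <= n)%N -> \sum_(mu : comps | is_comp mu) term x f (scale x mu) =
    \sum_(mu : comps | is_comp mu && tail (n.+2 - m) mu) term x f (scale x mu).
  by rewrite (h n) // !subSn // subnn.
elim: m => [_|m IH lt].
  apply: eq_bigl => mu; rewrite subn0 [tail _ _](_ : _ = true) ?andbT //.
  by apply/forallP => i; rewrite leqNgt ltn_ord.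
rewrite IH; last exact: ltnW.
have lt_i : (n.+2 - m.+1 < n.+2)%N by lia.
have lt_j : ((n.+2 - m.+1).-1 < n.+2)%N by lia.
pose i : 'I_n.+2 := Ordinal lt_i; pose j : 'I_n.+2 := Ordinal lt_j.
have ej : i = j.+1 :> nat by rewrite /=; lia.
have nij : i != j by apply/eqP => /(congr1 val) /=; lia.
have le2 : (2 <= i)%N by rewrite /=; lia.
have loc (mu mu' : comps) : (forall l, l != i -> l != j -> mu l = mu' l) ->
    tail (n.+2 - m) mu = tail (n.+2 - m) mu'.
  move=> e; apply: eq_forallb => l; case: leqP => //= le.
  by rewrite e //; apply: contraTneq le => ->; rewrite -ltnNge /=; lia.
rewrite (@noumi_term_restrict F q n.+2 a r F idfun char2 x f _ a.+1 i j sf nij (hx i j le2 ej) loc).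
apply: eq_bigl => mu; congr (_ && _); apply/andP/forallP => [[/forallP h lt0] l|h].
  apply/implyP; rewrite leq_eqVlt => /orP[/eqP el|lt'].
    have -> : l = i by apply: val_inj.
    by rewrite -leqn0 -(leq_add2r a) add0n -ltnS.
  by apply: (implyP (h l)); lia.
split.
  by apply/forallP => l; apply/implyP => le; apply: (implyP (h l)); lia.
by have /implyP/(_ (leqnn _))/eqP -> := h i.
Qed.

End Pieri.

Section RisingProducts.
Variables (F : fieldType) (q : F).

(* [(q ^+ e.+1 ; q)_m] *)
Definition rising (m e : nat) : F := \prod_(i < m) (1 - q ^+ (e + i.+1)).

Lemma risingD m m' e : rising (m + m') e = rising m e * rising m' (e + m).
Proof.
rewrite /rising big_split_ord; congr (_ * _); apply: eq_bigr => i _ /=.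
by congr (1 - q ^+ _); lia.
Qed.

Lemma rising1 e : rising 1 e = 1 - q ^+ e.+1.
Proof. by rewrite /rising big_ord1 addn1. Qed.

Lemma prod_blocks (R : comNzRingType) (n b : nat) (G : nat -> R) :
  \prod_(j < n) \prod_(k < b) G (b * j + k)%N = \prod_(i < b * n) G i.
Proof.
elim: n => [|n IH]; first by rewrite muln0 !big_ord0.
by rewrite big_ord_recr IH mulnS addnC big_split_ord.
Qed.

Hypothesis qn : forall n, (0 < n)%N -> q ^+ n != 1.

Lemma rising_neq0 m e : rising m e != 0.
Proof. by apply/prodf_neq0 => i _; rewrite subr_eq0 eq_sym qn // addnS. Qed.

End RisingProducts.

Section PieriPoints.
Variables (F : fieldType) (q : F) (a n : nat).
Hypothesis char2 : 2%:R != 0 :> F.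
Hypothesis q0 : q != 0.
Hypothesis qn : forall n, (0 < n)%N -> q ^+ n != 1.
Variable (f : {mpoly F[n.+2]}).
Hypothesis sf : f \is symmetric.

Local Notation th := a.+1.
Local Notation M' := (a + th * n)%N.
Local Notation M := (a + th * n.+1)%N.
Local Notation ris := (rising q).

(** With N = n + 2 and t = q^theta the tail is t^(N-3), ..., t, 1. In the notations above, [M] is
    theta N - 1 and [M'] is theta (N-1) - 1, the numbers of linear factors per variable in the two
    products of the formula. *)
Definition tail_pt : 'I_n -> F := fun k => q ^+ (th * (n - k.+1)).
Definition lattice_pt (b k : nat) : 'I_n.+2 -> F :=
  pt (q ^+ (b + th * n.+1)) (q ^+ (k + th * n)) tail_pt.

Lemma lattice_ptE b k (i : 'I_n.+2) :
  lattice_pt b k i = if i == 0%N :> nat then q ^+ (b + th * n.+1) else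
    if i == 1%N :> nat then q ^+ (k + th * n) else q ^+ (th * (n.+1 - i)).
Proof.
rewrite /lattice_pt /pt; case: unliftP => [j ->|->] //=.
by case: unliftP => [l ->|->].
Qed.

Lemma prod_tail_pt e :
  \prod_(j < n) \prod_(k < th) (tail_pt j - q ^+ k * q ^+ (e + th * n)) =
  (\prod_(j < n) \prod_(k < th) tail_pt j) * ris (th * n) (e + a).
Proof.
rewrite /rising -(prod_blocks n th (fun i => 1 - q ^+ (e + a + i.+1))) -big_split.
apply: eq_bigr => j _; rewrite -big_split; apply: eq_bigr => k _ /=.
rewrite mulrBr mulr1 /tail_pt -!exprD; congr (_ - q ^+ _).
have le_jn : (j.+1 <= n)%N := ltn_ord j.
by rewrite -{1}(subnK le_jn) mulnDr mulnS; lia.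
Qed.

Let C1 : F := \prod_(j < n) \prod_(k < th) tail_pt j.
Let x1 : F := q ^+ (th * n).

Lemma tail_factor_x1 e : tail_factor q a tail_pt x1 (q ^+ (e + th * n)) = C1 * x1 ^+ a * ris M' e.
Proof.
rewrite /tail_factor prod_tail_pt risingD -/C1.
have -> : \prod_(k < a) (x1 - q ^+ k.+1 * q ^+ (e + th * n)) = x1 ^+ a * ris a e.
  have -> : x1 ^+ a = \prod_(k < a) x1 by rewrite prodr_const card_ord.
  rewrite -big_split; apply: eq_bigr => k _ /=; rewrite /x1 mulrBr mulr1 -!exprD.
  by congr (_ - q ^+ _); lia.
by ring.
Qed.

Let E1 : F := \prod_(k < a) - q ^+ k.+1.

Lemma tail_factor_x0 s k : (k <= s)%N ->
  tail_factor q a tail_pt (q ^+ (s + th * n.+1)) (q ^+ (k + th * n)) =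
  C1 * ris (th * n) (k + a) * (x1 ^+ a * q ^+ (k * a) * E1 * ris a (s - k)).
Proof.
move=> le_ks; rewrite /tail_factor prod_tail_pt -/C1; congr (_ * _ * _).
have -> : x1 ^+ a = \prod_(k < a) x1 by rewrite prodr_const card_ord.
have -> : q ^+ (k * a) = \prod_(l < a) q ^+ k by rewrite prodr_const card_ord exprM.
have -> : ris a (s - k) = \prod_(l < a) (1 - q ^+ (s - k + (a - l))).
  rewrite /rising (reindex_inj rev_ord_inj) /=; apply: eq_bigr => l _.
  by congr (1 - q ^+ _); have := ltn_ord l; lia.
rewrite -!big_split /=; apply: eq_bigr => l _ /=.
have -> : q ^+ (s + th * n.+1) = x1 * q ^+ k * q ^+ l.+1 * q ^+ (s - k + (a - l)).
  by rewrite -!exprD; congr (q ^+ _); have := ltn_ord l; rewrite mulnS; lia.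
have -> : q ^+ (k + th * n) = q ^+ k * x1 by rewrite exprD.
by ring.
Qed.



Lemma rest_factor_neq0 s : rest_factor q a tail_pt (q ^+ (s + th * n.+1)) (q ^+ (th * n)) != 0.
Proof.
have qneq i j : i != j -> q ^+ i - q ^+ j != 0.
  by move=> nij; rewrite subr_eq0; apply: contraNneq nij => /(expr_inj q0 qn) ->.
rewrite /rest_factor !mulf_neq0 //; apply/prodf_neq0.
- move=> [i j] /= lt; rewrite /tail_pt; apply: qneq; apply/eqP.
  by have := ltn_ord j; have := ltn_ord i; nia.
- move=> i _; apply/prodf_neq0 => k _; rewrite /tail_pt -exprD; apply: qneq; apply/eqP.
  by have := ltn_ord k; have := ltn_ord i; nia.
- move=> i _; apply/prodf_neq0 => k _; rewrite /tail_pt -exprD; apply: qneq; apply/eqP.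
  by have := ltn_ord k; have := ltn_ord i; nia.
move=> [i j] /= nij; apply/prodf_neq0 => k _; rewrite /tail_pt -exprD; apply: qneq; apply/eqP.
have nij' : (i != j :> nat) by [].
have := ltn_ord k; have := ltn_ord i; have := ltn_ord j.
have [le|lt] := leqP (n - j.+1) (n - i.+1); first by nia.
have : (n - i.+1 + 1 <= n - j.+1)%N by lia.
by nia.
Qed.

Section FixedR.
Variable r : nat.
Local Notation comps := {ffun 'I_n.+2 -> 'I_r.+1}.

Definition two_rows (k : 'I_r.+1) : comps :=
  [ffun i : 'I_n.+2 => if i == 0%N :> nat then inord (r - k) else if i == 1%N :> nat then k else ord0].

Lemma sum_two_rows (s : nat) (G : comps -> F) :
  \sum_(mu : comps | [&& is_comp mu, tail 2 mu & (mu (lift ord0 ord0) + a < s + th)%N]) G mu =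
  \sum_(k < r.+1 | (k <= s)%N) G (two_rows k).
Proof.
have two1 k : two_rows k (lift ord0 ord0) = k by rewrite ffunE.
rewrite (reindex_onto two_rows (fun mu => mu (lift ord0 ord0))) /=; last first.
  move=> mu /and3P[cmu /forallP tl _]; apply/ffunP => i; rewrite ffunE; apply: val_inj.
  case: (unliftP ord0 i) => [j ->|->] /=.
    case: (unliftP ord0 j) => [l ->|->] //=.
    by have /implyP/(_ isT)/eqP := tl (lift ord0 (lift ord0 l)).
  move: cmu; rewrite /is_comp !big_ord_recl [X in (_ + (_ + X))%N]big1 ?addn0 => [/eqP e|l _].
    by rewrite inordK; lia.
  by have /implyP/(_ isT)/eqP := tl (lift ord0 (lift ord0 l)).
apply: eq_bigl => k; rewrite two1 eqxx andbT -[X in (X < _)%N]addnC addnS ltnS [(s + a)%N]addnC leq_add2l.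
case: leqP => le; rewrite ?andbT ?andbF //.
apply/andP; split.
  rewrite /is_comp !big_ord_recl big1 ?addn0 => [|l _]; rewrite !ffunE //=.
  by rewrite inordK; have := ltn_ord k; lia.
by apply/forallP => i; apply/implyP; rewrite ffunE; case: i => -[|[|i]] lt.
Qed.

Lemma qscale_two_rows s (k : 'I_r.+1) :
  qscale q idfun (lattice_pt s 0) (two_rows k) = lattice_pt (s + (r - k)) k.
Proof.
apply/funext => i; rewrite /qscale !lattice_ptE ffunE.
case: eqP => _; first by rewrite inordK ?ltnS ?leq_subr //= -exprD; congr (q ^+ _); lia.
by case: eqP => _ /=; rewrite ?expr0 ?mul1r -?exprD.
Qed.

Lemma weight_two_rows (k : 'I_r.+1) :
  noumi_weight q a (fun i => two_rows k i) = ris a (r - k) * (ris a k * ris a 0 ^+ n).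
Proof.
have w (mu : 'I_n.+2 -> nat) : noumi_weight q a mu = \prod_i ris a (mu i).
  by apply: eq_bigr => i _; apply: eq_bigr => l _; rewrite addnC.
rewrite w !big_ord_recl !ffunE /= inordK ?ltnS ?leq_subr //; congr (_ * (_ * _)).
rewrite -[in RHS](card_ord n) -prodr_const.
by apply: eq_big => // l _; rewrite ffunE.
Qed.

Lemma pieri_sum s (eta : F) :
  (forall x : 'I_n.+2 -> F, noumi q a r idfun x f = eta * f.@[x] * (vdm x * cross a q x x)) ->
  eta * f.@[lattice_pt s 0] *
    ((q ^+ (th * n) - q ^+ (s + th * n.+1)) * tail_factor q a tail_pt (q ^+ (th * n)) (q ^+ (s + th * n.+1))
       * tail_factor q a tail_pt (q ^+ (s + th * n.+1)) (q ^+ (th * n))) =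
  \sum_(k < r.+1 | (k <= s)%N) ris a (r - k) * (ris a k * ris a 0 ^+ n) *
    ((q ^+ (k + th * n) - q ^+ (s + (r - k) + th * n.+1)) *
      tail_factor q a tail_pt (q ^+ (th * n)) (q ^+ (s + (r - k) + th * n.+1)) *
      tail_factor q a tail_pt (q ^+ (s + th * n.+1)) (q ^+ (k + th * n))) * f.@[lattice_pt (s + (r - k)) k].
Proof.
move=> e; pose x := lattice_pt s 0.
have x0 i : x i != 0 by rewrite /x lattice_ptE; do ![case: ifP => _]; rewrite expf_neq0.
have px0 : (\prod_i x i) ^+ a != 0 by rewrite expf_neq0 //; apply/prodf_neq0.
have R0 := rest_factor_neq0 s.
have := noumi_termE q a r idfun x f; rewrite sum_kill_tail //; last first.
  move=> i j lei eij; rewrite /x !lattice_ptE.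
  have ->: (i == 0%N :> nat) = false by apply/eqP; lia.
  have ->: (i == 1%N :> nat) = false by apply/eqP; lia.
  have ->: (j == 0%N :> nat) = false by apply/eqP; lia.
  have := ltn_ord i; rewrite -exprD; case: eqP => ej ltin; congr (q ^+ _).
    have -> : i = 2%N :> nat by rewrite eij ej.
    by rewrite add0n -mulnS; congr (_ * _)%N; move: ltin; rewrite eij ej; lia.
  by rewrite -mulnS eij; congr (_ * _)%N; lia.
have nij : lift ord0 ord0 != ord0 :> 'I_n.+2 by [].
(* With this exponent [noumi_term_restrict] keeps mu_1 + a < s + theta for the second row, that is
   mu_1 <= s. *)
have xji : x ord0 = q ^+ (s + th) * x (lift ord0 ord0).
  by rewrite /x !lattice_ptE /= -exprD; congr (q ^+ _); nia.
have loc (mu mu' : {ffun 'I_n.+2 -> 'I_r.+1}) :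
    (forall l, l != lift ord0 ord0 -> l != ord0 -> mu l = mu' l) -> tail 2 mu = tail 2 mu'.
  move=> h; apply: eq_forallb => l; case: leqP => //= le.
  by rewrite h //; apply: contraTneq le => ->.
rewrite (@noumi_term_restrict F q n.+2 a r F idfun char2 x f _ (s + th) _ _ sf nij xji loc).
rewrite sum_two_rows e -/x.
have cancel (A B V W S : F) : A != 0 -> B != 0 -> A * (V * (B * W)) = B * S * A -> V * W = S.
  move=> A0 B0 E; apply: (mulfI A0); apply: (mulfI B0).
  by rewrite [B * (A * S)]mulrCA [A * (B * S)]mulrC -E; ring.
rewrite (kernel_pt q a tail_pt) => E; apply: (cancel _ _ _ _ _ px0 R0); rewrite E.
rewrite mulr_sumr mulr_suml; apply: eq_bigr => k _.
rewrite /noumi_term diagonal_qscale qscale_two_rows weight_two_rows.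
rewrite mulrA (kernel_pt q a tail_pt) /meval /= add0n; ring.
Qed.

End FixedR.

(** Up to a factor independent of m, [ris M m] is the product of q^g - q^(j - theta) over 1 <= j <
    theta N at g = m + theta (N-1). So g carries the very normalization that the formula gives to
    the one-variable characters. *)
Definition row_value (m : nat) : F := ris M m * f.@[lattice_pt m 0].

(** Collects the factors of the term mu = (r - k, k) that depend only on the point reached; what
    remains depends on r - k and s - k alone. *)
Definition two_row_value (b k : nat) : F :=
  q ^+ (k * th) * (1 - q ^+ (b - k + th)) * ris M' k * ris M' (b + th) * f.@[lattice_pt b k].

Lemma pieri_eta r s (eta : F) :
  (forall x : 'I_n.+2 -> F, noumi q a r idfun x f = eta * f.@[x] * (vdm x * cross a q x x)) ->
  eta * row_value s * ris (th * n) a =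
  ris a 0 ^+ n * \sum_(k < r.+1 | (k <= s)%N) ris a (r - k) * ris a (s - k) * two_row_value (s + (r - k)) k.
Proof.
move=> /(pieri_sum s) e.
have splitM m : ris M m = ris a m * (1 - q ^+ (m + th)) * ris M' (m + th).
  rewrite (_ : M = a + (1 + M'))%N; last by rewrite mulnS; lia.
  by rewrite !risingD rising1 mulrA !addnS !addn0.
have C0 : C1 != 0.
  by apply/prodf_neq0 => j _; apply/prodf_neq0 => k _; rewrite expf_neq0.
have E0 : E1 != 0 by apply/prodf_neq0 => k _; rewrite oppr_eq0 expf_neq0.
have K0 : C1 ^+ 2 * x1 ^+ (a + a).+1 * E1 != 0 by rewrite !mulf_neq0 // !expf_neq0.
apply: (mulfI K0); rewrite mulrCA mulr_sumr.
have eX m : q ^+ (m + th * n.+1) = q ^+ (m + th) * x1 by rewrite -exprD mulnS addnA.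
have tx m : tail_factor q a tail_pt (q ^+ (th * n)) (q ^+ (m + th * n.+1)) =
    C1 * x1 ^+ a * ris M' (m + th) by rewrite mulnS addnA -tail_factor_x1.
transitivity (eta * f.@[lattice_pt s 0] *
    ((q ^+ (th * n) - q ^+ (s + th * n.+1)) * tail_factor q a tail_pt (q ^+ (th * n)) (q ^+ (s + th * n.+1))
       * tail_factor q a tail_pt (q ^+ (s + th * n.+1)) (q ^+ (0 + th * n)))).
  rewrite tail_factor_x0 // tx eX mul0n expr0 subn0 !add0n /row_value splitM (exprS x1) (exprD x1).
  by rewrite -/x1; ring.
rewrite add0n e mulr_sumr; apply: eq_bigr => k le_ks.
rewrite tail_factor_x0 // tx eX /two_row_value (exprS x1) (exprD x1) -/x1 mulnS.
have -> : (s + (r - k) + th = k + (s + (r - k) - k + th))%N by lia.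
rewrite (risingD q a (th * n) k) !(exprD q k) -/x1; ring.
Qed.

Hypothesis eig : forall r, exists eta : F, forall x : 'I_n.+2 -> F,
  noumi q a r idfun x f = eta * f.@[x] * (vdm x * cross a q x x).

(** The relation at s = 0 has only the term k = 0 and so gives eta times [row_value 0] as a known
    multiple of [row_value r]. Multiplying the general relation by [row_value 0] eliminates eta
    without a division. *)
Lemma pieri r s :
  row_value r * row_value s * (ris a 0 * ris M' 0) =
  row_value 0 * \sum_(k < r.+1 | (k <= s)%N) ris a (r - k) * ris a (s - k) * two_row_value (s + (r - k)) k.
Proof.
have sum0 : \sum_(k < r.+1 | (k <= 0)%N) ris a (r - k) * ris a (0 - k) * two_row_value (r - k) k =
    ris a 0 * ris M' 0 * row_value r.
  rewrite big_mkcond big_ord_recl big1 //= addr0 subn0 /two_row_value mul0n expr0 subn0.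
  rewrite /row_value (_ : M = a + (1 + M'))%N; last by rewrite mulnS; lia.
  rewrite (risingD q a _ r) (risingD q 1 M') rising1 addn1 -addnS subn0; ring.
have [eta eE] := eig r; have e := pieri_eta s eE; have := pieri_eta 0 eE.
under eq_bigr do rewrite add0n; rewrite sum0 => e0.
have W0 : ris a 0 ^+ n != 0 by rewrite expf_neq0 // rising_neq0.
apply: (mulfI W0); rewrite [RHS]mulrCA -e.
transitivity (row_value s * (ris a 0 ^+ n * (ris a 0 * ris M' 0 * row_value r))); first by ring.
by rewrite -e0; ring.
Qed.

End PieriPoints.

(** * A telescoping sum *)

Section Telescoping.
Variables (F : fieldType) (q : F).
Hypothesis q0 : q != 0.
Hypothesis qn : forall n, (0 < n)%N -> q ^+ n != 1.
Local Notation ris := (rising q).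

Definition qfact (m : nat) : F := ris m 0.

Lemma qfactS m : qfact m.+1 = qfact m * (1 - q ^+ m.+1).
Proof. by rewrite /qfact /rising big_ord_recr. Qed.

Lemma qfact0 : qfact 0 = 1.
Proof. exact: big_ord0. Qed.

Lemma qfact_neq0 m : qfact m != 0.
Proof. exact: rising_neq0. Qed.

Lemma one_sub_neq0 m : 1 - q ^+ m.+1 != 0.
Proof. by rewrite subr_eq0 eq_sym qn. Qed.

Lemma rising_qfact m e : ris m e = qfact (e + m) / qfact e.
Proof. by rewrite /qfact risingD add0n mulrC mulKf // qfact_neq0. Qed.

(* Up to a factor independent of [i], the coefficient of [T_1^i T_2^(n-i)] in
   [((x_1 - x_2)^-1 (T_2 - T_1))^n] where [x_1 = q^(n + D) x_2], [D = d.+1]. *)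
Definition step_coef (n d i : nat) : F :=
  (-1) ^+ i * q ^+ 'C(i, 2) * (qfact n / (qfact i * qfact (n - i)))
  * (1 - q ^+ (d.+1 + i.*2)) * (qfact (d + i) / qfact (d + n.+1 + i)).

Lemma q_pascal (Q A D : F) : (1 - Q * A) * (1 - D * (Q * A)) =
  (1 - Q) * (1 - D * (Q * A * A)) + Q * (1 - A) * (1 - D * A).
Proof. by ring. Qed.

(** One more application of the operator, at gap al - be = n + d + 2: T_2 leads to gap n + d.+1 and
    T_1 to gap n + d.+3, hence d and d.+2. The factor q^n compares the prefactors at be and be + 1,
    and 1 - q^(d+n+2) comes from q^al - q^be. *)
Lemma step_coef_recr n d i : (i <= n.+1)%N ->
  step_coef n.+1 d i * (1 - q ^+ (d.+1 + n.+1)) =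
  (if (i <= n)%N then step_coef n d i else 0) -
  (if (0 < i)%N then q ^+ n * step_coef n d.+2 i.-1 else 0).
Proof.
have n0 := one_sub_neq0; have k0 := qfact_neq0.
case: i => [_|i].
  rewrite /step_coef subr0 !subn0 !addn0 !addnS addSn !qfactS.
  by field; rewrite !n0 !k0.
rewrite ltnS leq_eqVlt => /orP[/eqP ->|lt_in].
  rewrite ltnn /step_coef /= !subnn binS bin1 exprS (exprD q) !doubleS.
  have -> : (d.+3 + n.*2 = d.+1 + n.*2.+2)%N by lia.
  rewrite !addnS !addSn !(qfactS, addnS).
  have -> : (d + n + n = d + n.*2)%N by lia.
  by field; rewrite !n0 !k0.
rewrite lt_in /=; move: lt_in => /subnK; rewrite addnC; move: (n - i.+1)%N => u <-.
rewrite /step_coef.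
have -> : ((i.+1 + u).+1 - i.+1 = u.+1)%N by lia.
have -> : (i.+1 + u - i.+1 = u)%N by lia.
have -> : (i.+1 + u - i = u.+1)%N by lia.
have -> : (d + (i.+1 + u).+2 + i.+1 = (d + (i.+1 + u).+1 + i.+1).+1)%N by lia.
have -> : (d.+2 + (i.+1 + u).+1 + i = (d + (i.+1 + u).+1 + i.+1).+1)%N by lia.
have -> : (d.+3 + i.*2 = d.+1 + i.+1.*2)%N by lia.
have -> : (d.+2 + i = (d + i.+1).+1)%N by lia.
have -> : q ^+ (i.+1 + u) = q ^+ i * q ^+ u.+1 by rewrite -exprD; congr (q ^+ _); lia.
have eu : (u.+1 + i.+1 = (i.+1 + u).+1)%N by lia.
move: eu; move: (i.+1 + u)%N => n' eu.
rewrite !qfactS binS bin1 (exprD q 'C(i, 2)) (exprS (-1)).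
(* With the q-factorials cleared the recursion reduces to this identity, a q-Pascal rule deformed by
   the factors in q^(d+1). *)
have E := q_pascal (q ^+ u.+1) (q ^+ i.+1) (q ^+ d.+1).
move: E; rewrite -(exprD q u.+1) -(exprD q (u.+1 + i.+1)) -!(exprD q d.+1).
rewrite eu (_ : (d.+1 + (n'.+1 + i.+1) = (d + n'.+1 + i.+1).+1)%N); last by lia.
rewrite (addSn d i.+1); move: (n0 n') (n0 (d + n'.+1 + i.+1)%N) (n0 u) (n0 i).
move: (1 - q ^+ n'.+1) (1 - q ^+ (d + n'.+1 + i.+1).+1) (1 - q ^+ u.+1) (1 - q ^+ i.+1).
move=> w1 w4 w3 w5 w10 w40 w30 w50.
move: (q ^+ u.+1) => Q E.
move: (k0 i) (k0 u) (k0 (d + n'.+1 + i.+1)%N).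
move: (qfact i) (qfact u) (qfact (d + _ + _)) => f1 f2 f3 f10 f20 f30.
set K := (-1) ^+ i * q ^+ 'C(i, 2) * q ^+ i * qfact n' * (1 - q ^+ (d.+1 + i.+1.*2)) *
  qfact (d + i.+1) / (f1 * w5 * (f2 * w3) * f3 * w4).
transitivity (- K * (w1 * (1 - q ^+ (d.+1 + n'.+1)))).
  by rewrite /K; field; rewrite f10 f20 f30 w30 w40 w50.
by rewrite E /K; field; rewrite f10 f20 f30 w30 w40 w50.
Qed.

(** [telescope_term] without 1 - q^th and without the very-well-poised factor 1 - q^(d+1+2j),
    written in q-factorials so that consecutive values have a simple ratio. *)
Definition telescope_factor (th m d j : nat) : F :=
  (-1) ^+ j * q ^+ 'C(j, 2) *
  (qfact th.-1 * qfact (d + j) * qfact (d.+1 + m + th.-1 + j) * qfact (m + th.-1 - j))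
  / (qfact j * qfact (th - j) * qfact (m - j) * qfact (d.+1 + th + j) * qfact (d.+1 + m + j)).

Lemma telescope_factorS th m d j : (j < th)%N -> (j < m)%N ->
  telescope_factor th m d j * (q ^+ j * (1 - q ^+ (d.+1 + j)) * (1 - q ^+ (d.+1 + m + th + j)) *
    (1 - q ^+ (th - j)) * (1 - q ^+ (m - j))) =
  - telescope_factor th m d j.+1 * ((1 - q ^+ (m + th.-1 - j)) * (1 - q ^+ j.+1) *
     (1 - q ^+ (d.+1 + th + j.+1)) * (1 - q ^+ (d.+1 + m + j.+1))).
Proof.
move=> /subnK; rewrite addnC; move: (th - j.+1)%N => u <-.
move=> /subnK; rewrite addnC; move: (m - j.+1)%N => v <-.
rewrite /telescope_factor.
have -> : (j.+1 + v + (j.+1 + u).-1 - j = (v + u + j).+1)%N by lia.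
have -> : (j.+1 + v + (j.+1 + u).-1 - j.+1 = (v + u + j))%N by lia.
have -> : (j.+1 + u - j = u.+1)%N by lia.
have -> : (j.+1 + u - j.+1 = u)%N by lia.
have -> : (j.+1 + v - j = v.+1)%N by lia.
have -> : (j.+1 + v - j.+1 = v)%N by lia.
have -> : (d.+1 + (j.+1 + v) + (j.+1 + u).-1 + j.+1 = (d.+1 + (j.+1 + v) + (j.+1 + u).-1 + j).+1)%N by lia.
have -> : (d.+1 + (j.+1 + v) + (j.+1 + u) + j = (d.+1 + (j.+1 + v) + (j.+1 + u).-1 + j).+1)%N by lia.
have -> : (d.+1 + j = (d + j).+1)%N by lia.
have -> : (d + j.+1 = (d + j).+1)%N by lia.
have -> : (j.+1 + u).-1 = (j + u)%N by [].
rewrite !(addnS _ j); move: (_ + _ + (j + u) + j)%N (v + u + j)%N (d + j)%N => X Y Z.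
move: (_ + (j.+1 + u) + j)%N (_ + (j.+1 + v) + j)%N (j + u)%N => T0 M0 a.
rewrite !qfactS binS bin1 (exprD q 'C(j, 2)) (exprS (-1)).
have n0 := one_sub_neq0; have k0 := qfact_neq0.
by field; rewrite !n0 !k0.
Qed.

Lemma telescope_step (E A B T : F) :
  (1 - A * B) * (1 - E * A * A * B * T) * (1 - A * T) * (1 - E * A * A) -
  (1 - A * B * T) * (1 - A) * (1 - E * A * A * T) * (1 - E * A * A * B) =
  A * (1 - E * A) * (1 - E * A * A * A * B * T) * (1 - T) * (1 - B).
Proof. by ring. Qed.

Definition telescope_term (th m d j : nat) : F :=
  step_coef th d j * ris th.-1 (d.+1 + m + j) * ris th.-1 (m - j).

Lemma telescope_termE th m d j : (0 < th)%N -> (j <= m)%N ->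
  telescope_term th m d j = telescope_factor th m d j * (1 - q ^+ th) * (1 - q ^+ (d.+1 + j.*2)).
Proof.
case: th => // a _ le_jm; rewrite /telescope_term /step_coef /telescope_factor !rising_qfact /=.
have -> : (d.+1 + m + j + a = d.+1 + m + a + j)%N by lia.
have -> : (m - j + a = m + a - j)%N by lia.
rewrite (_ : d + a.+2 + j = d.+1 + a.+1 + j)%N; last by lia.
rewrite (qfactS a); have k0 := qfact_neq0.
by field; rewrite !k0.
Qed.

(** The partial sums of this very-well-poised sum have a closed form. Its factors 1 - q^(th - L) and
    1 - q^(m - L) make it vanish at L = [minn th m], where the full sum stops. *)
Lemma telescope_partial th m d L : (0 < th)%N -> (L <= th)%N -> (L <= m)%N ->
  (1 - q ^+ m) * (1 - q ^+ (d.+1 + m + th)) * \sum_(j < L.+1) telescope_term th m d j =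
  telescope_factor th m d L * (q ^+ L * (1 - q ^+ (d.+1 + L)) * (1 - q ^+ (d.+1 + m + th + L)) *
    (1 - q ^+ (th - L)) * (1 - q ^+ (m - L))).
Proof.
move=> th0; elim: L => [|L IH] leth lem.
  rewrite big_ord_recl big_ord0 addr0 telescope_termE // !subn0 !addn0 expr0; ring.
rewrite big_ord_recr mulrDr IH; [|lia|lia]; rewrite telescope_factorS // telescope_termE //=.
move: (telescope_factor _ _ _ _) => K.
have := telescope_step (q ^+ d.+1) (q ^+ L.+1) (q ^+ (m - L.+1)) (q ^+ (th - L.+1)).
rewrite -!exprD.
have -> : (L.+1 + (m - L.+1) = m)%N by lia.
have -> : (L.+1 + (th - L.+1) = th)%N by lia.
have -> : (d.+1 + L.+1 + L.+1 + (m - L.+1) + (th - L.+1) = d.+1 + m + th)%N by lia.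
have -> : (d.+1 + L.+1 + L.+1 = d.+1 + L.+1.*2)%N by lia.
have -> : (m + (th - L.+1) = m + th.-1 - L)%N by lia.
have -> : (d.+1 + L.+1.*2 + (m - L.+1) = d.+1 + m + L.+1)%N by lia.
have -> : (d.+1 + L.+1.*2 + (th - L.+1) = d.+1 + th + L.+1)%N by lia.
have -> : (d.+1 + L.+1.*2 + L.+1 + (m - L.+1) + (th - L.+1) = d.+1 + m + th + L.+1)%N by lia.
by move=> <-; ring.
Qed.

Lemma telescope_sum th m d : (0 < th)%N -> (0 < m)%N ->
  \sum_(j < th.+1 | (j <= m)%N) telescope_term th m d j = 0.
Proof.
move=> th0 m0.
have -> : \sum_(j < th.+1 | (j <= m)%N) telescope_term th m d j =
    \sum_(j < (minn th m).+1) telescope_term th m d j.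
  rewrite (big_ord_widen_cond th.+1 xpredT (telescope_term th m d)) ?ltnS ?geq_minl //.
  by apply: eq_bigl => j /=; rewrite ltnS leq_min -(ltnS j th) ltn_ord.
have := @telescope_partial th m d (minn th m) th0 (geq_minl _ _) (geq_minr _ _).
set c := (1 - _) * (1 - _).
have c0 : c != 0.
  by rewrite /c mulf_neq0 // subr_eq0 eq_sym qn // ltn_addl.
rewrite -[X in _ = _ * X](mulrA _ (1 - q ^+ (th - _))).
rewrite (_ : (1 - q ^+ (th - minn th m)) * (1 - q ^+ (m - minn th m)) = 0).
  by rewrite !mulr0 => /eqP; rewrite mulf_eq0 (negbTE c0) => /eqP.
have [le|lt] := leqP th m.
  by rewrite subnn expr0 subrr mul0r.
by rewrite subnn expr0 subrr mulr0.
Qed.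

End Telescoping.

(** * Powers of the operator on the lattice *)

Section LatticeStep.
Variables (F : fieldType) (q : F).
Hypothesis q0 : q != 0.
Hypothesis qn : forall n, (0 < n)%N -> q ^+ n != 1.
Local Notation ris := (rising q).

(* The operator [(x_1 - x_2)^-1 (T_2 - T_1)] on values at the points [(q^al, q^be)]. *)
Definition lattice_step (phi : nat -> nat -> F) (al be : nat) : F :=
  (phi al be.+1 - phi al.+1 be) / (q ^+ al - q ^+ be).

(** n steps can raise be by at most n, so a gap larger than n keeps every denominator q^al - q^be
    met on the way nonzero. *)
Lemma iter_lattice_step phi n d al be : al = (be + n + d.+1)%N ->
  iter n lattice_step phi al be =
  (-1) ^+ n * q ^- (n * be + 'C(n, 2)) *
  \sum_(i < n.+1) step_coef q n d i * phi (al + i)%N (be + (n - i))%N.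
Proof.
elim: n d al be => [|n IH] d al be eal.
  rewrite big_ord_recl big_ord0 !addr0 /step_coef mul0n !bin0n /= expr0 double0 !subnn !addn0 addn1 (qfactS q d).
  by rewrite !expr0 (qfact0 q); have k0 := qfact_neq0 qn; have n0 := one_sub_neq0 qn; field; rewrite !k0 !n0 oner_eq0.
rewrite iterS /lattice_step (IH d) ?(IH d.+2); [|lia|lia].
have w0 : 1 - q ^+ (d.+1 + n.+1) != 0 by rewrite addnS one_sub_neq0.
have -> : q ^+ al - q ^+ be = - q ^+ be * (1 - q ^+ (d.+1 + n.+1)).
  by rewrite mulrBr mulr1 mulNr opprK [RHS]addrC -exprD; congr (_ - _); congr (q ^+ _); lia.
have -> : \sum_(i < n.+2) step_coef q n.+1 d i * phi (al + i)%N (be + (n.+1 - i))%N =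
  (\sum_(i < n.+1) step_coef q n d i * phi (al + i)%N (be.+1 + (n - i))%N -
   q ^+ n * \sum_(i < n.+1) step_coef q n d.+2 i * phi (al.+1 + i)%N (be + (n - i))%N) /
  (1 - q ^+ (d.+1 + n.+1)).
  apply: (mulIf w0); rewrite divfK // mulr_suml.
  have -> : \sum_(i < n.+2) step_coef q n.+1 d i * phi (al + i)%N (be + (n.+1 - i))%N * (1 - q ^+ (d.+1 + n.+1)) =
    \sum_(i < n.+2) (if (i <= n)%N then step_coef q n d i else 0) * phi (al + i)%N (be + (n.+1 - i))%N -
    \sum_(i < n.+2) (if (0 < i)%N then q ^+ n * step_coef q n d.+2 i.-1 else 0) * phi (al + i)%N (be + (n.+1 - i))%N.
    rewrite -sumrB; apply: eq_bigr => i _; rewrite mulrAC (@step_coef_recr F q q0 qn n d i (ltn_ord i)).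
    exact: mulrBl.
  congr (_ - _).
    rewrite big_ord_recr /= ltnn mul0r addr0; apply: eq_bigr => i _.
    have le_in : (i <= n)%N := ltn_ord i.
    by rewrite le_in (subSn le_in) addnS addSn.
  rewrite big_ord_recl /= mul0r add0r mulr_sumr; apply: eq_bigr => i _.
  by rewrite /= mulrA subSS addnS addSn.
have q_n0 k : q ^+ k != 0 by rewrite expf_neq0.
move: (1 - q ^+ (d.+1 + n.+1)) w0 => w w0.
rewrite exprS binS bin1 mulSn mulnS !exprD.
by field; rewrite ?oppr_eq0 ?oner_eq0 w0 !q_n0 ?oppr_eq0 ?oner_eq0.
Qed.

End LatticeStep.

Section LatticeIdentity.
Variables (F : fieldType) (q : F) (a n : nat).
Hypothesis char2 : 2%:R != 0 :> F.
Hypothesis q0 : q != 0.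
Hypothesis qn : forall n, (0 < n)%N -> q ^+ n != 1.
Variable (f : {mpoly F[n.+2]}).
Hypothesis sf : f \is symmetric.
Hypothesis eig : forall r, exists eta : F, forall x : 'I_n.+2 -> F,
  noumi q a r idfun x f = eta * f.@[x] * (vdm x * cross a q x x).

Local Notation th := a.+1.
Local Notation M' := (a + th * n)%N.
Local Notation ris := (rising q).

(** The arguments of each product add up to 2b + d + 1 for every i, so the two-row value attached to
    k by [pieri] does not depend on i. After exchanging the sums, the sum over i is [telescope_sum]
    with m = b - k, zero for k < b; at k = b only i = 0 is left. *)
Lemma row_value_sum b d :
  ris M' 0 * \sum_(i < th.+1 | (i <= b)%N) step_coef q th d i *
    (row_value q a f (b + d.+1 + i) * row_value q a f (b - i)) =
  row_value q a f 0 *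
    (q ^+ (b * th) * ris M' b * ris M' (b + d.+1 + th) * f.@[lattice_pt q a (b + d.+1) b]).
Proof.
have W0 : ris a 0 != 0 by rewrite rising_neq0.
apply: (mulfI W0); rewrite [LHS]mulrA mulr_sumr.
transitivity (\sum_(i < th.+1) \sum_(k < b.+1 | (i <= b - k)%N)
   row_value q a f 0 * two_row_value q a f (b + d.+1 + (b - k)) k *
     telescope_term q th (b - k) d i).
  rewrite big_mkcond; apply: eq_bigr => i _; case: leqP => [le_ib|lt_bi]; last first.
    by rewrite big_pred0 // => k; apply/negbTE; rewrite -ltnNge; lia.
  rewrite mulrCA [row_value q a f (_ + _) * _]mulrC [ris a 0 * ris M' 0 * _]mulrC.
  rewrite (pieri char2 q0 qn sf eig).
  pose G k := row_value q a f 0 * two_row_value q a f (b + d.+1 + (b - k)) k *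
    telescope_term q th (b - k) d i.
  transitivity (\sum_(k < (b - i).+1) G k); last first.
    rewrite (big_ord_widen_cond b.+1 xpredT G) ?ltnS ?leq_subr //.
    by apply: eq_bigl => k /=; have := ltn_ord k; lia.
  rewrite mulrA mulr_sumr; apply: eq_big => [k|k _]; first by have := ltn_ord k; lia.
  rewrite /G /telescope_term /=.
  have -> : (b + d.+1 + i + (b - i - k) = b + d.+1 + (b - k))%N by have := ltn_ord k; lia.
  have -> : (b + d.+1 + i - k = d.+1 + (b - k) + i)%N by have := ltn_ord k; lia.
  have -> : (b - i - k = b - k - i)%N by lia.
  by ring.
rewrite (exchange_big_dep xpredT) //= big_ord_recr /= big1 ?add0r => [|k _]; last first.
  by rewrite -mulr_sumr telescope_sum ?mulr0 // subn_gt0.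
rewrite subnn big_mkcond big_ord_recl big1 //= addr0 /telescope_term /step_coef /two_row_value !addn0 !subn0.
have -> : (b + d.+1 - b = d.+1)%N by lia.
rewrite bin0n /= ?expr0 ?double0 ?addn0 (rising_qfact qn a d.+1) (_ : d + th.+1 = (d.+1 + a).+1)%N; last by lia.
rewrite (qfactS q (d.+1 + a)) (qfactS q d) (qfact0 q) addnS.
have k0 := qfact_neq0 qn; have n0 := one_sub_neq0 qn.
by field; rewrite !k0 !n0.
Qed.

(** For i > b the second argument falls into the window where h vanishes, so the expansion of the
    operator stops at i = b, the range in which [row_value_sum] applies. *)
Lemma iter_lattice_step_row (h : nat -> F) (A0 : F) b d :
  (forall m, h (m + th * n.+1)%N = A0 * row_value q a f m) ->
  (forall c, (th * n <= c < th * n.+1)%N -> h c = 0) ->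
  ris M' 0 * iter th (lattice_step q) (fun al be => h al * h be) (b + d.+1 + th * n.+1)%N (b + th * n)%N =
  (-1) ^+ th * q ^- (th ^ 2 * n + 'C(th, 2)) * A0 ^+ 2 * row_value q a f 0 *
    (ris M' b * ris M' (b + d.+1 + th) * f.@[lattice_pt q a (b + d.+1) b]).
Proof.
move=> hE h0; rewrite (iter_lattice_step q0 qn _ (d := d)); last by rewrite mulnS; lia.
have -> : \sum_(i < th.+1) step_coef q th d i *
      (h (b + d.+1 + th * n.+1 + i)%N * h (b + th * n + (th - i))%N) =
   A0 ^+ 2 * \sum_(i < th.+1 | (i <= b)%N) step_coef q th d i *
    (row_value q a f (b + d.+1 + i) * row_value q a f (b - i)).
  rewrite mulr_sumr [RHS]big_mkcond; apply: eq_bigr => i _; have lti := ltn_ord i.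
  case: leqP => [le|lt]; last by rewrite (h0 (b + th * n + _)%N) ?mulr0 // mulnS; lia.
  rewrite addnAC hE (_ : (b + th * n + (th - i) = b - i + th * n.+1)%N); last by rewrite mulnS; lia.
  by rewrite hE; ring.
rewrite mulrCA [ris M' 0 * (A0 ^+ 2 * _)]mulrCA row_value_sum.
have -> : (th * (b + th * n) = b * th + th ^ 2 * n)%N by rewrite mulnDr [(th * b)%N]mulnC; lia.
rewrite -addnA exprD invfM.
have q_n0 k : q ^+ k != 0 by rewrite expf_neq0.
by field; rewrite !q_n0.
Qed.

End LatticeIdentity.

(** * From lattice values to rational functions *)

Lemma frac_mul (K : fieldType) (a b c d : K) : (a / b) * (c / d) = (a * c) / (b * d).
Proof. by rewrite invfM mulrACA. Qed.

Lemma frac_sub (K : fieldType) (a b c d : K) : b != 0 -> d != 0 -> (a / b) - (c / d) = (a * d - c * b) / (b * d).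
Proof. by move=> b0 d0; field; rewrite b0 d0. Qed.

Lemma eq_quotient (K : fieldType) (u u' v v' w : K) :
  u = u' -> v = v' -> v' != 0 /\ w = u' / v' -> v != 0 /\ w = u / v.
Proof. by move=> -> ->. Qed.

Lemma div_div_swap (K : fieldType) (u v w : K) : u^-1 * (v * w^-1) = w^-1 * (v / u).
Proof. by rewrite mulrA mulrC [u^-1 * v]mulrC. Qed.

Lemma div_pow_step (K : fieldType) (w u v d : K) n :
  w^-1 * ((w ^- n * u - w ^- n * v) / d) = w ^- n.+1 * ((u - v) / d).
Proof. by rewrite -mulrBr exprS invfM !mulrA. Qed.

Section LatticeDensity.
Variables (F : fieldType) (q : F).
Hypothesis q0 : q != 0.
Hypothesis qn : forall n, (0 < n)%N -> q ^+ n != 1.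

Definition lattice_eval (al be : nat) (p : {mpoly F[2]}) : F :=
  p.@[fun j : 'I_2 => q ^+ (if j == 0 then al else be)].

Lemma poly_eq0_qpow (p : {poly F}) (b : nat) : (forall m, (b <= m)%N -> p.[q ^+ m] = 0) -> p = 0.
Proof.
move=> h; apply: (roots_geq_poly_eq0 (rs := [seq q ^+ (b + i) | i <- iota 0 (size p)])).
- by apply/allP => _ /mapP[i _ ->]; apply/rootP; apply: h; exact: leq_addr.
- rewrite map_inj_uniq ?iota_uniq // => i j /(expr_inj q0 qn); lia.
- by rewrite size_map size_iota.
Qed.

(* Kronecker substitution [x_1 = x_2^K] reduces to one variable. *)
Lemma lattice_dense (p : {mpoly F[2]}) (k b : nat) :
  (forall al be, (b <= be)%N -> (be + k < al)%N -> lattice_eval al be p = 0) -> p = 0.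
Proof.
move=> h; pose K := (msize p + k + 2)%N.
pose v (j : 'I_2) : {poly F} := 'X^(if j == 0 then K else 1%N).
have sub0 : mmap polyC v p = 0.
  apply: (@poly_eq0_qpow _ b.+1) => m le_bm.
  have -> : (mmap polyC v p).[q ^+ m] = lattice_eval (m * K) m p.
    apply: etrans (rmorph_mmap (horner_eval (q ^+ m)) _ _ _) _.
    apply: eq_mmap => [c|j]; first exact: hornerC.
    by rewrite /= /horner_eval hornerXn -exprM; case: ifP; rewrite ?muln1.
  by apply: h; first exact: ltnW; rewrite /K; nia.
have e (m : 'X_{1..2}) : mmap1 v m = 'X^(K * m 0 + m 1).
  rewrite /mmap1 !big_ord_recl big_ord0 mulr1 /v /= -!exprM -exprD mul1n.
  by congr ('X^(_ * m _ + m _)); apply: val_inj.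
apply/mpolyP => m; rewrite mcoeff0; apply/eqP; apply: contraTT isT => pm.
move/(congr1 (fun u : {poly F} => u`_(K * m (0 : 'I_2)%R + m (1 : 'I_2)%R)%N)): sub0; rewrite coef0 /mmap coef_sum.
have ms : m \in msupp p by rewrite mcoeff_msupp.
rewrite (bigD1_seq m) //= e coefCM coefXn eqxx mulr1 big1_seq ?addr0 => [e0|m' /andP[nm m's]].
  by rewrite e0 eqxx in pm.
rewrite e coefCM coefXn; case: eqP => [em|]; last by rewrite mulr0.
have lt2 (u : 'X_{1..2}) : u \in msupp p -> (u 1%R < K)%N.
  move=> /msize_mdeg_lt; rewrite mdegE !big_ord_recl big_ord0 /=.
  have -> : lift ord0 ord0 = 1 :> 'I_2 by apply: val_inj.
  by rewrite /K; lia.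
case/negP: nm; apply/eqP/mnmP => j.
have e1 : m' 1 = m 1.
  have := congr1 (fun u => u %% K)%N em; rewrite !(mulnC K) !modnMDl !modn_small //; exact: lt2.
have e0 : m' 0 = m 0.
  by move: em; rewrite e1 => /addIn /eqP; rewrite eqn_mul2l /K => /orP[/eqP|/eqP]; lia.
case: (unliftP ord0 j) => [j' ->|->]; last exact: e0.
by rewrite (ord1 j') (_ : lift ord0 ord0 = 1) //; apply: val_inj.
Qed.

Local Notation ev := lattice_eval.

Lemma lattice_eval_mul_div al be (P Q P' Q' : {mpoly F[2]}) : ev al be Q != 0 -> ev al be Q' != 0 ->
  ev al be (Q * Q') != 0 /\
  (ev al be P / ev al be Q) * (ev al be P' / ev al be Q') = ev al be (P * P') / ev al be (Q * Q').
Proof. by rewrite /lattice_eval !mevalM => Q0 Q0'; rewrite mulf_neq0 // frac_mul. Qed.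

Lemma lattice_eval_sub_div al be (P Q P' Q' : {mpoly F[2]}) : ev al be Q != 0 -> ev al be Q' != 0 ->
  ev al be (Q * Q') != 0 /\
  ev al be P / ev al be Q - ev al be P' / ev al be Q' = ev al be (P * Q' - P' * Q) / ev al be (Q * Q').
Proof. by rewrite /lattice_eval mevalB !mevalM => Q0 Q0'; rewrite mulf_neq0 // frac_sub. Qed.

Lemma lattice_eval_inv_div al be (P Q : {mpoly F[2]}) : ev al be Q != 0 -> ev al be P / ev al be Q != 0 ->
  ev al be P != 0 /\ (ev al be P / ev al be Q)^-1 = ev al be Q / ev al be P.
Proof. by move=> Q0; rewrite mulf_eq0 negb_or invf_div => /andP[]. Qed.

Lemma lattice_eval_cross al be (P Q P' Q' : {mpoly F[2]}) : ev al be Q != 0 -> ev al be Q' != 0 ->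
  ev al be P / ev al be Q = ev al be P' / ev al be Q' -> ev al be (P * Q' - P' * Q) = 0.
Proof.
rewrite /lattice_eval mevalB !mevalM => Q0 Q0' /eqP; rewrite eqr_div // => /eqP ->.
exact: subrr.
Qed.

End LatticeDensity.

Section FractionArithmetic.
Variable A : idomainType.
Local Open Scope quotient_scope.
Implicit Types P Q : A.

Lemma tofrac_mul_div P Q P' Q' : P%:F / Q%:F * (P'%:F / Q'%:F) = (P * P')%:F / (Q * Q')%:F :> {fraction A}.
Proof. by rewrite !rmorphM frac_mul. Qed.

Lemma tofrac_sub_div P Q P' Q' : Q != 0 -> Q' != 0 ->
  P%:F / Q%:F - P'%:F / Q'%:F = (P * Q' - P' * Q)%:F / (Q * Q')%:F :> {fraction A}.
Proof. by move=> Q0 Q0'; rewrite rmorphB !rmorphM -frac_sub // tofrac_eq0. Qed.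

Lemma frac_map_repr (s : {rmorphism A -> A}) (P Q : A) :
  let r := generic_quotient.repr (P%:F / Q%:F : {fraction A}) in
  (forall p, p != 0 -> s p != 0) -> Q != 0 ->
  (s \n_r)%:F / (s \d_r)%:F = (s P)%:F / (s Q)%:F :> {fraction A}.
Proof.
move=> r nz Q0; have d0 := frac_denom_neq0 (P%:F / Q%:F).
have /eqP := frac_numden (P%:F / Q%:F); rewrite frac_cross // => /eqP e.
by apply/eqP; rewrite frac_cross ?nz // -!rmorphM -e.
Qed.

End FractionArithmetic.

(** * Rational functions seen through their lattice values *)

Section Represents.
Variable C : fieldType.
Local Notation F := (Cq C).
Local Notation q := (q_Cq C).
Local Notation ev := (@lattice_eval F q).

Lemma q_Cq_neq0 : q != 0.
Proof. by rewrite tofrac_eq0 polyX_eq0. Qed.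

Lemma q_Cq_pow n : (0 < n)%N -> q ^+ n != 1.
Proof.
move=> n0; rewrite /q_Cq -rmorphXn -(rmorph1 (@FracField.tofrac {poly C})) tofrac_eq.
apply/eqP => /(congr1 (fun p : {poly C} => size p)).
by rewrite size_polyXn size_poly1; lia.
Qed.



Lemma lattice_eval_shift (i : 'I_2) al be (p : {mpoly F[2]}) :
  ev al be (q_shift_poly i p) = if i == 0 then ev al.+1 be p else ev al be.+1 p.
Proof.
rewrite /lattice_eval /q_shift_poly comp_mpoly_meval.
have -> : (fun j : 'I_2 => (tnth [tuple (if j == i then q *: 'X_j else 'X_j) | j < 2] j).@[
     fun j : 'I_2 => q ^+ (if j == 0 then al else be)]) =
  (fun j : 'I_2 => q ^+ (if j == 0 then (al + (i == 0%R))%N else (be + (i != 0%R))%N)).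
  apply/funext => j; rewrite tnth_mktuple.
  have j01 : (j == 0) || (j == 1) by case: j => -[|[|]].
  have i01 : (i == 0) || (i == 1) by case: i => -[|[|]].
  case/orP: j01 => /eqP ->; case/orP: i01 => /eqP -> /=; rewrite ?mevalZ mevalXU /= -?exprS ?addn0 ?addn1 //.
by case: eqP => _; apply: eq_mmap => // j; rewrite ?addn0 ?addn1.
Qed.

Definition Cqx_const : {rmorphism F -> Cqx C} := (@FracField.tofrac _) \o (@mpolyC 2 F).

Lemma Cq_to_CqxE c : Cq_to_Cqx c = Cqx_const c.
Proof. by []. Qed.

(** The denominator must vanish nowhere on the region, so that equal lattice values give equal
    fractions. The margin k is recorded because T_2 raises be: every [diff_step] costs one unit of
    distance from the diagonal. *)
Definition represents (b k : nat) (f : Cqx C) (phi : nat -> nat -> F) : Prop :=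
  exists P Q : {mpoly F[2]}, f = P%:F / Q%:F /\ 
    forall al be, (b <= be)%N -> (be + k < al)%N -> ev al be Q != 0 /\ phi al be = ev al be P / ev al be Q.



Lemma ev_neq0 b k (Q : {mpoly F[2]}) :
  (forall al be, (b <= be)%N -> (be + k < al)%N -> ev al be Q != 0) -> Q != 0.
Proof.
move=> h; apply: contraTneq (h (b + k).+1 b (leqnn b) (ltnSn _)) => ->.
by rewrite /lattice_eval meval0 eqxx.
Qed.

Lemma represents_const b k c : represents b k (Cq_to_Cqx c) (fun _ _ => c).
Proof.
exists c%:MP, 1; split; first by rewrite rmorph1 divr1.
by move=> al be _ _; rewrite /lattice_eval meval1 mevalC divr1 oner_eq0.
Qed.

Lemma represents_var b k (i : 'I_2) :
  represents b k (var C i) (fun al be => q ^+ (if i == 0 then al else be)).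
Proof.
exists 'X_i, 1; split; first by rewrite rmorph1 divr1.
by move=> al be _ _; rewrite /lattice_eval meval1 mevalXU divr1 oner_eq0.
Qed.



Lemma representsM b k f g phi psi : represents b k f phi -> represents b k g psi ->
  represents b k (f * g) (fun al be => phi al be * psi al be).
Proof.
case=> P [Q [-> h]] [P' [Q' [-> h']]]; exists (P * P'), (Q * Q'); split.
  exact: tofrac_mul_div.
move=> al be lb lk; have [Q0 ->] := h al be lb lk; have [Q0' ->] := h' al be lb lk.
exact: lattice_eval_mul_div.
Qed.

Lemma representsB b k f g phi psi : represents b k f phi -> represents b k g psi ->
  represents b k (f - g) (fun al be => phi al be - psi al be).
Proof.
case=> P [Q [-> h]] [P' [Q' [-> h']]]; exists (P * Q' - P' * Q), (Q * Q'); split.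
  apply: tofrac_sub_div.
    by apply: (@ev_neq0 b k) => al be lb lk; have [] := h al be lb lk.
  by apply: (@ev_neq0 b k) => al be lb lk; have [] := h' al be lb lk.
move=> al be lb lk; have [Q0 ->] := h al be lb lk; have [Q0' ->] := h' al be lb lk.
exact: lattice_eval_sub_div.
Qed.

Lemma representsV b k f phi : represents b k f phi ->
  (forall al be, (b <= be)%N -> (be + k < al)%N -> phi al be != 0) ->
  represents b k f^-1 (fun al be => (phi al be)^-1).
Proof.
case=> P [Q [-> h]] nz; exists Q, P; split; first by rewrite invf_div.
move=> al be lb lk; have [Q0 e] := h al be lb lk; have := nz al be lb lk.
by rewrite e; exact: lattice_eval_inv_div.
Qed.

Lemma represents_ext b k f phi psi :
  (forall al be, (b <= be)%N -> (be + k < al)%N -> phi al be = psi al be) ->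
  represents b k f phi -> represents b k f psi.
Proof.
move=> e [P [Q [-> h]]]; exists P, Q; split=> // al be lb lk.
by rewrite -e //; exact: h.
Qed.

Lemma represents_prod b k (I : Type) (r : seq I) (Pr : pred I) (f : I -> Cqx C) phi :
  (forall i, Pr i -> represents b k (f i) (phi i)) ->
  represents b k (\prod_(i <- r | Pr i) f i) (fun al be => \prod_(i <- r | Pr i) phi i al be).
Proof.
move=> h; elim: r => [|i r IH].
  have -> : (fun al be : nat => \prod_(i <- [::] | Pr i) phi i al be) = (fun _ _ => 1).
    by apply/funext => al; apply/funext => be; rewrite big_nil.
  have -> : \prod_(i <- [::] | Pr i) f i = Cq_to_Cqx 1 := etrans (big_nil _ _ _ _) (esym (rmorph1 Cqx_const)).
  exact: represents_const.
have -> : (fun al be : nat => \prod_(j <- i :: r | Pr j) phi j al be) =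
   (fun al be => (if Pr i then phi i al be else 1) * \prod_(j <- r | Pr j) phi j al be).
  by apply/funext => al; apply/funext => be; rewrite big_cons; case: ifP; rewrite ?mul1r.
rewrite big_cons; case: ifP => [Pi|_]; first exact: representsM (h i Pi) IH.
by apply: represents_ext IH => al be _ _; rewrite mul1r.
Qed.



Lemma represents_unique b k f g phi : represents b k f phi -> represents b k g phi -> f = g.
Proof.
case=> P [Q [-> h]] [P' [Q' [-> h']]].
apply/eqP; rewrite frac_cross; [|by apply: (@ev_neq0 b k) => al be lb lk; have [] := h al be lb lk
  |by apply: (@ev_neq0 b k) => al be lb lk; have [] := h' al be lb lk].
rewrite -subr_eq0; apply/eqP; apply: (@lattice_dense F q q_Cq_neq0 q_Cq_pow _ k b) => al be lb lk.
have [Q0 e] := h al be lb lk; have [Q0' e'] := h' al be lb lk.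
exact: lattice_eval_cross Q0 Q0' (etrans (esym e) e').
Qed.

Lemma q_shiftE (i : 'I_2) (P Q : {mpoly F[2]}) : Q != 0 ->
  q_shift i (P%:F / Q%:F : Cqx C) = (q_shift_poly i P)%:F / (q_shift_poly i Q)%:F.
Proof.
have nz (p : {mpoly F[2]}) : p != 0 -> q_shift_poly i p != 0.
  apply: contraNneq => e; apply/eqP.
  apply: (@lattice_dense F q q_Cq_neq0 q_Cq_pow _ 1 1) => al be lb lk.
  have [ei|ni] := boolP (i == 0).
    have := lattice_eval_shift i al.-1 be p; rewrite ei e prednK; last by lia.
    by move=> <-; rewrite /lattice_eval meval0.
  have := lattice_eval_shift i al be.-1 p; rewrite (negbTE ni) e prednK; last by lia.
  by move=> <-; rewrite /lattice_eval meval0.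
exact: (@frac_map_repr _ (comp_mpoly [tuple (if j == i then q *: 'X_j else 'X_j) | j < 2]) P Q nz).
Qed.

Lemma represents_shift0 b k f phi : represents b k f phi ->
  represents b k (q_shift 0 f) (fun al be => phi al.+1 be).
Proof.
case=> P [Q [-> h]]; exists (q_shift_poly 0 P), (q_shift_poly 0 Q); split.
  apply: q_shiftE; apply: (@ev_neq0 b k) => al be lb lk; by have [] := h al be lb lk.
move=> al be lb lk; apply: (eq_quotient (lattice_eval_shift 0 al be P) (lattice_eval_shift 0 al be Q)).
by apply: h => //; exact: ltnW.
Qed.

Lemma represents_shift1 b k f phi : represents b k f phi ->
  represents b k.+1 (q_shift 1 f) (fun al be => phi al be.+1).
Proof.
case=> P [Q [-> h]]; exists (q_shift_poly 1 P), (q_shift_poly 1 Q); split.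
  apply: q_shiftE; apply: (@ev_neq0 b k) => al be lb lk; by have [] := h al be lb lk.
move=> al be lb lk; apply: (eq_quotient (lattice_eval_shift 1 al be P) (lattice_eval_shift 1 al be Q)).
by apply: h; lia.
Qed.

Lemma representsS b k f phi : represents b k f phi -> represents b k.+1 f phi.
Proof.
by case=> P [Q [-> h]]; exists P, Q; split=> // al be lb lk; apply: h => //; lia.
Qed.

Lemma represents_diff_step b k f phi : represents b k f phi ->
  represents b k.+1 (diff_step f) (fun al be => (q - 1)^-1 * lattice_step q phi al be).
Proof.
move=> hf; rewrite /diff_step /q_deriv -mulrBl opprB addrA subrK.
have q1 : q - 1 != 0 by rewrite subr_eq0 -(expr1 q) q_Cq_pow.
have -> : q_Cqx C - 1 = Cq_to_Cqx (q - 1)     by rewrite /q_Cqx !Cq_to_CqxE (rmorphB Cqx_const) (rmorph1 Cqx_const).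
apply: (@represents_ext _ _ _ (fun al be => (q ^+ al - q ^+ be)^-1 * ((phi al be.+1 - phi al.+1 be) * (q - 1)^-1))).
  by move=> al be _ _; exact: div_div_swap.
apply: representsM; last first.
  apply: representsM; last by apply: representsV => //; exact: represents_const.
  exact: representsB (represents_shift1 hf) (representsS (represents_shift0 hf)).
apply: representsV; first exact: representsB (represents_var _ _ 0) (represents_var _ _ 1).
move=> al be _ lt; rewrite subr_eq0; apply/eqP => /(expr_inj q_Cq_neq0 q_Cq_pow); lia.
Qed.

Lemma represents_iter b k f phi n : represents b k f phi ->
  represents b (k + n) (iter n (@diff_step C) f) (fun al be => (q - 1) ^- n * iter n (lattice_step q) phi al be).
Proof.
move=> hf; elim: n => [|n IH].
  rewrite addn0 /=; apply: represents_ext hf => al be _ _.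
  by rewrite expr0 invr1 mul1r.
rewrite addnS iterS; apply: represents_ext (represents_diff_step IH) => al be _ _.
exact: div_pow_step.
Qed.

End Represents.

(** * The formula at lattice points *)

Section CharacterValues.
Variables (F : fieldType) (q : F) (a n : nat).
Hypothesis char2 : 2%:R != 0 :> F.
Hypothesis q0 : q != 0.
Hypothesis qn : forall n, (0 < n)%N -> q ^+ n != 1.
Variable (f : {mpoly F[n.+2]}).
Hypothesis sf : f \is symmetric.
Hypothesis eig : forall r, exists eta : F, forall x : 'I_n.+2 -> F,
  noumi q a r idfun x f = eta * f.@[x] * (vdm x * cross a q x x).
Variables (p : nat) (c : F).

Local Notation th := a.+1.
Local Notation M' := (a + th * n)%N.
Local Notation M := (a + th * n.+1)%N.
Local Notation ris := (rising q).
Local Notation t := (q ^+ th).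

Lemma prod_sub_qpow L g e : (g + th = e + L.+1)%N ->
  \prod_(1 <= j < L.+1) (q ^+ g - q ^ (j%:Z - th%:Z)) =
  \prod_(1 <= j < L.+1) (- q ^ (j%:Z - th%:Z)) * ris L e.
Proof.
move=> eg; rewrite !big_add1 !big_mkord /= /rising.
rewrite [\prod_(i < L) (1 - _)](reindex_inj rev_ord_inj) -big_split /=.
apply: eq_bigr => i _; have lti := ltn_ord i.
rewrite mulNr mulrBr mulr1 opprB; congr (_ - _).
by rewrite !exprnP -expfzDr //; congr (q ^ _); lia.
Qed.

Definition one_row_pt (g : nat) : 'I_n.+2 -> F :=
  fun i => nth 0 (q ^+ g :: mkseq (fun k => t ^+ k) n.+1) i.
Definition two_row_pt (al be : nat) : 'I_n.+2 -> F :=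
  fun i => nth 0 [:: q ^+ al, q ^+ be & mkseq (fun k => t ^+ k) n] i.
Definition principal_pt : 'I_n.+2 -> F := fun i => t ^+ i.

Lemma eval_perm (s s' : seq F) (v w : 'I_n.+2 -> F) : size s = n.+2 -> perm_eq s s' ->
  (forall i, v i = nth 0 s i) -> (forall i, w i = nth 0 s' i) -> f.@[v] = f.@[w].
Proof.
move=> /eqP ss pe hv hw; have ss' : size s' == n.+2 by rewrite -(perm_size pe).
have := @mmap_perm_eq _ _ F idfun (Tuple ss) (Tuple ss') f sf pe.
rewrite /meval => e; etransitivity; [|etransitivity; [exact: e|]]; apply: eq_mmap => // i.
  by rewrite hv (tnth_nth 0).
by rewrite hw (tnth_nth 0).
Qed.

Lemma lattice_pt_nth b k (i : 'I_n.+2) : lattice_pt q a b k i =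
  nth 0 [:: q ^+ (b + th * n.+1), q ^+ (k + th * n) & rev (mkseq (fun k => t ^+ k) n)] i.
Proof.
rewrite lattice_ptE; case: i => -[|[|i]] lt //=.
rewrite nth_rev size_mkseq // nth_mkseq; last by lia.
by rewrite -exprM.
Qed.

Lemma eval_two_row_pt b k :
  f.@[two_row_pt (b + th * n.+1) (k + th * n)] = f.@[lattice_pt q a b k].
Proof.
pose s := [:: q ^+ (b + th * n.+1), q ^+ (k + th * n) & mkseq (fun k => t ^+ k) n].
apply: (eval_perm (s := s) _ _ _ (lattice_pt_nth b k)) => //.
  by rewrite /= size_mkseq.
by rewrite !perm_cons perm_sym perm_rev.
Qed.

Lemma eval_one_row_pt m : f.@[one_row_pt (m + th * n.+1)] = f.@[lattice_pt q a m 0].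
Proof.
apply: (eval_perm (s := q ^+ (m + th * n.+1) :: mkseq (fun k => t ^+ k) n.+1) _ _ _ (lattice_pt_nth m 0)) => //.
  by rewrite -cat1s size_cat size_mkseq.
rewrite perm_cons mkseqS add0n exprM perm_rcons perm_cons.
by rewrite perm_sym perm_rev.
Qed.

Lemma eval_principal_pt : f.@[principal_pt] = f.@[lattice_pt q a 0 0].
Proof.
apply: (eval_perm (s := mkseq (fun k => t ^+ k) n.+2) _ _ _ (lattice_pt_nth 0 0)) => //.
- by rewrite size_mkseq.
- rewrite !mkseqS !add0n !exprM perm_rcons perm_cons perm_rcons perm_cons.
  by rewrite perm_sym perm_rev.
by move=> i; rewrite nth_mkseq.
Qed.

Lemma two_row_pt_neq0 al be i : two_row_pt al be i != 0.
Proof.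
case: i => -[|[|i]] lt; rewrite /two_row_pt /= ?expf_neq0 //.
by rewrite nth_mkseq // !expf_neq0.
Qed.

Lemma one_row_pt_neq0 g i : one_row_pt g i != 0.
Proof.
case: i => -[|i] lt; rewrite /one_row_pt [nth _ _ _]/= ?expf_neq0 //.
by rewrite -/(mkseq _ n.+1) nth_mkseq // !expf_neq0.
Qed.

(* [c^-1 f] divided by the [p]-th power of the product of the variables. *)
Definition laurent_eval (z : 'I_n.+2 -> F) : F := (\prod_i z i) ^- p * (c^-1 * f.@[z]).

Definition row_char (g : nat) : F :=
  laurent_eval (one_row_pt g) / laurent_eval principal_pt *
  \prod_(1 <= j < (th * n.+2)%N) (q ^+ g - q ^ (j%:Z - th%:Z)).

Let T2 : F := \prod_(k < n) t ^+ k.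

Lemma prod_two_row_pt al be : \prod_i two_row_pt al be i = q ^+ (al + be) * T2.
Proof.
rewrite !big_ord_recl /two_row_pt /= exprD -mulrA; congr (_ * (_ * _)).
by apply: eq_bigr => i _; rewrite nth_mkseq ?ltn_ord.
Qed.

Lemma prod_one_row_pt g : \prod_i one_row_pt g i = q ^+ g * (T2 * t ^+ n).
Proof.
rewrite big_ord_recl /one_row_pt /=; congr (_ * _).
rewrite big_ord_recr /= nth_mkseq // /T2; congr (_ * _).
by apply: eq_bigr => i _; rewrite nth_mkseq //= ltnS ltnW ?ltn_ord.
Qed.

Lemma prod_principal_pt : \prod_i principal_pt i = T2 * t ^+ n * t ^+ n.+1.
Proof. by rewrite !big_ord_recr. Qed.

(** Both branches of a step raise al + be by one, so the factor w^(al + be) passes through. With w =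
    q^(-p) it is the Laurent monomial (x_1 x_2)^(-p) that shifts a partition to a signature. *)
Lemma iter_lattice_step_scale (k w : F) (phi psi : nat -> nat -> F) m al be :
  (forall al be, phi al be = k * w ^+ (al + be) * psi al be) ->
  iter m (lattice_step q) phi al be = k * w ^+ (al + be + m) * iter m (lattice_step q) psi al be.
Proof.
move=> h; elim: m al be => [|m IH] al be; first by rewrite addn0 /= h.
rewrite !iterS /lattice_step !IH !addnS !addSn; ring.
Qed.

Lemma two_mul_bin2 k : ('C(k, 2) * 2 = k * k.-1)%N.
Proof. by rewrite bin2 muln2 -[RHS]odd_double_half; case: k => // k; rewrite oddM /= andNb. Qed.

Lemma exponentE : ((- (2 * n.+2%:Z - 3) * th%:Z ^+ 2 + th%:Z) %/ 2)%Z = - (th ^ 2 * n + 'C(th, 2))%N%:Z.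
Proof.
have := two_mul_bin2 th; rewrite /=.
have -> : (- (2 * n.+2%:Z - 3) * th%:Z ^+ 2 + th%:Z) = - (th ^ 2 * n + 'C(th, 2))%N%:Z * 2.
  have := two_mul_bin2 th; rewrite expr2 /=; nia.
by rewrite mulzK.
Qed.

(** The product over j < theta N has theta more factors than the one over j < theta (N-1), and their
    exponents add up to E = theta^2 n + C(theta, 2). Squared, they meet q^(-E) from the iterated
    step, and the prefactor q^(-E) of the formula absorbs what is left. *)
Lemma prod_neg_qpow :
  \prod_(1 <= j < (th * n.+2)%N) (- q ^ (j%:Z - th%:Z)) =
  \prod_(1 <= j < (th * n.+1)%N) (- q ^ (j%:Z - th%:Z)) * ((-1) ^+ th * q ^+ (th ^ 2 * n + 'C(th, 2))).
Proof.
rewrite (big_cat_nat _ (n := (th * n.+1)%N)) /=; [|by rewrite mulnS|by rewrite leq_mul2l leqnSn orbT].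
congr (_ * _); rewrite -{1}[(th * n.+1)%N]add0n big_addn mulnS addnK big_mkord.
have -> : (-1) ^+ th = \prod_(i < th) (-1 : F) by rewrite prodr_const card_ord.
have -> : q ^+ (th ^ 2 * n + 'C(th, 2)) = \prod_(i < th) q ^+ (th * n + i).
  under [RHS]eq_bigr do rewrite exprD.
  rewrite -bin2_sum big_mkord exprD -prodrXr big_split /= prodr_const card_ord -exprM.
  by congr (q ^+ _ * _); rewrite expnS expn1 -mulnA mulnC.
rewrite -big_split; apply: eq_bigr => i _ /=; rewrite mulN1r; congr (- _).
by rewrite exprnP; congr (q ^ _); rewrite mulnS; lia.
Qed.

Lemma lattice_char_identity b d (al := (b + d.+1 + th * n.+1)%N) (be := (b + th * n)%N) :
  laurent_eval (two_row_pt al be) / laurent_eval principal_pt =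
  q ^ ((- (2 * n.+2%:Z - 3) * th%:Z ^+ 2 + th%:Z) %/ 2)%Z * (1 - q) ^+ th
    / \prod_(1 <= i < th.+1) (1 - q ^+ (th * n.+2 - i)%N)
  * (\prod_(1 <= i < (th * (n.+2 - 1))%N)
       ((q ^+ al - q ^ (i%:Z - th%:Z)) * (q ^+ be - q ^ (i%:Z - th%:Z))))^-1
  * ((q - 1) ^- th * iter th (lattice_step q) (fun al be => row_char al * row_char be) al be).
Proof.
pose A0 : F := \prod_(1 <= j < (th * n.+2)%N) (- q ^ (j%:Z - th%:Z)).
pose B0 : F := \prod_(1 <= j < (th * n.+1)%N) (- q ^ (j%:Z - th%:Z)).
pose h g := f.@[one_row_pt g] * \prod_(1 <= j < (th * n.+2)%N) (q ^+ g - q ^ (j%:Z - th%:Z)).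
have eM : (th * n.+2 = M.+1)%N by rewrite mulnS; lia.
have eM' : (th * n.+1 = M'.+1)%N by rewrite mulnS; lia.
have hE m : h (m + th * n.+1)%N = A0 * row_value q a f m.
  rewrite /h eval_one_row_pt /A0 eM (@prod_sub_qpow M _ m); last by rewrite mulnS; lia.
  by rewrite /row_value; ring.
(* The factor with j = g + theta is zero, and g < theta (n+1) puts this j in range. *)
have h0 g : (th * n <= g < th * n.+1)%N -> h g = 0.
  move=> /andP[l1 l2]; apply/eqP; rewrite mulf_eq0; apply/orP; right.
  rewrite prodf_seq_eq0; apply/hasP; exists (g + th)%N.
    by rewrite mem_index_iota !mulnS; rewrite mulnS in l2; lia.
  by rewrite /= PoszD addrK -exprnP subrr eqxx.
pose D := laurent_eval principal_pt.
pose k0 := (T2 * t ^+ n) ^- p * c^-1 / D.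
have pow_shift g X : (q ^+ g * X) ^- p = (q ^- p) ^+ g * X ^- p.
  by rewrite exprMn invfM exprVn -!exprM mulnC.
have step := iter_lattice_step_row char2 q0 qn sf eig b d hE h0.
have -> : iter th (lattice_step q) (fun al be => row_char al * row_char be) al be =
    k0 ^+ 2 * (q ^- p) ^+ (al + be + th) * iter th (lattice_step q) (fun al be => h al * h be) al be.
  apply: iter_lattice_step_scale => al' be'; rewrite /row_char /laurent_eval -/D !prod_one_row_pt /k0 /h.
  by rewrite !pow_shift (exprD _ al'); ring.
apply: (mulfI (rising_neq0 qn M' 0)).
have B00 : B0 != 0 by rewrite prodf_seq_neq0; apply/allP => j _ /=; rewrite oppr_eq0 expfz_neq0.
have A0E : A0 = B0 * ((-1) ^+ th * q ^+ (th ^ 2 * n + 'C(th, 2))) by exact: prod_neg_qpow.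
have -> : \prod_(1 <= i < (th * (n.+2 - 1))%N) ((q ^+ al - q ^ (i%:Z - th%:Z)) * (q ^+ be - q ^ (i%:Z - th%:Z))) =
   B0 ^+ 2 * (ris M' b * ris M' (b + d.+1 + th)).
  rewrite subSS subn0 big_split /= eM' (@prod_sub_qpow M' al (b + d.+1 + th)); last by rewrite /al mulnS; lia.
  rewrite (@prod_sub_qpow M' be b); last by rewrite /be; lia.
  by rewrite /B0 eM'; ring.
have eR : \prod_(1 <= i < th.+1) (1 - q ^+ (th * n.+2 - i)%N) = ris th M'.
  rewrite big_add1 big_mkord /rising (reindex_inj rev_ord_inj) /=; apply: eq_bigr => i _.
  by congr (1 - q ^+ _); rewrite !mulnS; have := ltn_ord i; lia.
have eM0 : ris M 0 = ris M' 0 * ris th M'.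
  by rewrite (_ : M = M' + th)%N ?risingD ?add0n // mulnS; lia.
have T20 : T2 != 0 by apply/prodf_neq0 => j _; rewrite !expf_neq0.
have t0 : t != 0 by rewrite expf_neq0.
(* The inverse of 0 is 0, so the identity also covers D = 0. *)
have dd : D^-1 * D^-1 * D = D^-1.
  have [->|D0] := eqVneq D 0; first by rewrite invr0 !mulr0.
  by rewrite mulfVK.
have fD : c^-1 * f.@[lattice_pt q a 0 0] = D * (T2 * t ^+ n * t ^+ n.+1) ^+ p.
  rewrite -eval_principal_pt /D /laurent_eval prod_principal_pt mulrAC mulVf ?mul1r //.
  by rewrite !(expf_neq0, mulf_neq0).
have shift : (T2 * t ^+ n) ^- p * (T2 * t ^+ n) ^- p * (T2 * t ^+ n * t ^+ n.+1) ^+ p * (q ^- p) ^+ th = T2 ^- p.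
  have -> : (q ^- p) ^+ th = t ^- p by rewrite exprVn -!exprM mulnC.
  have [U0 V0 W0] : [/\ T2 ^+ p != 0, (t ^+ n) ^+ p != 0 & t ^+ p != 0] by split; rewrite !expf_neq0.
  rewrite (exprS t n) !exprMn; move: (T2 ^+ p) ((t ^+ n) ^+ p) (t ^+ p) U0 V0 W0 => U V W U0 V0 W0.
  by field; rewrite U0 V0 W0.
have k0E : k0 ^+ 2 * f.@[lattice_pt q a 0 0] * (q ^- p) ^+ th = T2 ^- p * c^-1 / D.
  rewrite -shift -[in RHS]dd /k0.
  transitivity ((T2 * t ^+ n) ^- p * (T2 * t ^+ n) ^- p * (q ^- p) ^+ th * c^-1 * (D^-1 * D^-1) *
    (c^-1 * f.@[lattice_pt q a 0 0])); first by ring.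
  by rewrite fD; ring.
have signs : (1 - q) ^+ th = (-1) ^+ th * (q - 1) ^+ th by rewrite -exprMn mulN1r opprB.
have sign2 : (-1) ^+ th * (-1) ^+ th = 1 :> F by rewrite -exprMn mulrNN mul1r expr1n.
have q1 : (q - 1) ^+ th != 0 by rewrite expf_neq0 // subr_eq0 -(expr1 q) qn.
rewrite -[laurent_eval principal_pt]/D /laurent_eval prod_two_row_pt pow_shift eval_two_row_pt eR exponentE signs.
rewrite (exprD _ (al + be)).
move: step; rewrite -/al -/be /row_value eM0 A0E => step.
have R0 : ris th M' != 0 by rewrite rising_neq0.
have r1 : ris M' b != 0 by rewrite rising_neq0.
have r2 : ris M' (b + d.+1 + th) != 0 by rewrite rising_neq0.
have qE : q ^+ (th ^ 2 * n + 'C(th, 2)) != 0 by rewrite expf_neq0.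
rewrite -exprnN; move: (iter _ _ _ al be) step => S step.
transitivity ((-1) ^+ th * (-1) ^+ th * ((-1) ^+ th * (-1) ^+ th) * ris M' 0 * (q ^- p) ^+ (al + be) *
    f.@[lattice_pt q a (b + d.+1) b] * (k0 ^+ 2 * f.@[lattice_pt q a 0 0] * (q ^- p) ^+ th)).
  rewrite k0E !sign2; ring.
transitivity (q ^- (th ^ 2 * n + 'C(th, 2)) * (-1) ^+ th * (q - 1) ^+ th / ris th M' *
    (B0 ^+ 2 * (ris M' b * ris M' (b + d.+1 + th)))^-1 * (q - 1) ^- th * k0 ^+ 2 *
    (q ^- p) ^+ (al + be) * (q ^- p) ^+ th * (ris M' 0 * S)); last by ring.
rewrite step; move: (q ^- p ^+ (al + be)) (q ^- p ^+ th) (k0 ^+ 2) => w1 w2 kk.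
move: ((q - 1) ^+ th) (ris th M') (ris M' b) (ris M' _) (q ^+ (_ + 'C(th, 2))) q1 R0 r1 r2 qE => s R0 R1 R2 Q *.
by field; do ?[apply/andP; split].
Qed.

End CharacterValues.

Lemma subst_t0 (C : fieldType) (theta : nat) : subst_t theta (0 : Cqt C) = 0.
Proof.
rewrite /subst_t; case: xgetP => // v _ [a [b [b0 e ->]]].
have b0' : b != 0 by apply: contraNneq b0 => ->; rewrite horner0.
move/eqP: e; rewrite eq_sym mulf_eq0 invr_eq0 !tofrac_eq0 (negbTE b0') orbF => /eqP ->.
by rewrite horner0 rmorph0 mul0r.
Qed.

(** [subst_t] sends poles to 0 and is no ring morphism; only its values on the coefficients of P are
    known, and they are those of p divided by c. The condition s 0 = 0 handles monomials outside the
    support of P. *)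
Lemma mmap_rescale (K F L : fieldType) (N : nat) (phi : {rmorphism F -> L}) (s : K -> F)
    (v : 'I_N -> L) (P : {mpoly K[N]}) (p : {mpoly F[N]}) (c : F) :
  s 0 = 0 -> c != 0 -> (forall m, s P@_m = p@_m / c) ->
  mmap (fun x => phi (s x)) v P = phi c^-1 * mmap phi v p.
Proof.
move=> s0 c0 h.
have -> : p = \sum_(m <- msupp P) p@_m *: 'X_[m].
  apply/mpolyP => m; rewrite raddf_sum /=.
  have [mP|mP] := boolP (m \in msupp P).
    rewrite (bigD1_seq m) //= mcoeffZ mcoeffX eqxx mulr1 big1 ?addr0 // => m' nm.
    by rewrite mcoeffZ mcoeffX (negbTE nm) mulr0.
  rewrite big1_seq => [|m' /= m'P].
    have := h m; rewrite memN_msupp_eq0 // s0 => /esym/eqP.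
    by rewrite mulf_eq0 invr_eq0 (negbTE c0) orbF => /eqP.
  by rewrite mcoeffZ mcoeffX; case: (eqVneq m' m) m'P => [->|]; rewrite ?mulr0 // (negbTE mP).
rewrite raddf_sum mulr_sumr; apply: eq_bigr => m _.
by rewrite /= mmapZ mmapX h rmorphM -mulrA mulrCA.
Qed.

Lemma signature_nth (N : nat) (lam : N.-tuple int) (i j : 'I_N) : is_signature lam ->
  (i <= j)%N -> (tnth lam j <= tnth lam i)%R.
Proof.
move=> sl le_ij; rewrite !(tnth_nth 0).
have tr : transitive (>=%R : rel int) by move=> x y z /= h1 h2; apply: le_trans h2 h1.
have refl : reflexive (>=%R : rel int) by move=> x /=.
by apply: (sorted_leq_nth tr refl 0 sl i j _ _ le_ij); rewrite inE size_tuple.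
Qed.

Lemma tnth_shift_ge0 (N : nat) (lam : N.-tuple int) (i : 'I_N) : is_signature lam ->
  (0 <= tnth lam i + (sig_shift lam)%:Z)%R.
Proof.
move=> sl.
have le : (last 0 lam <= tnth lam i)%R.
  case: N lam i sl => [|N] lam i sl; first by case: i.
  have -> : last 0 lam = tnth lam ord_max.
    by rewrite (tnth_nth 0) -nth_last size_tuple.
  by apply: signature_nth => //; exact: leq_ord.
rewrite /sig_shift; move: (last 0 lam) (tnth lam i) le => l x le.
by case: leP => h; lia.
Qed.

Lemma is_partition_shifted (N : nat) (lam : N.-tuple int) : is_signature lam ->
  is_partition (shifted_partition lam).
Proof.
move=> sl; apply/forallP => i; apply/forallP => j; apply/implyP => le_ij.
have le := signature_nth sl le_ij.
rewrite !mnmE; have := tnth_shift_ge0 i sl; have := tnth_shift_ge0 j sl; lia.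
Qed.

Section CharacterRepresentation.
Variables (C : fieldType) (b k : nat).
Local Notation F := (Cq C).
Local Notation q := (q_Cq C).
Local Notation rep := (@represents C b k).

Lemma representsD f g phi psi : rep f phi -> rep g psi -> rep (f + g) (fun al be => phi al be + psi al be).
Proof.
move=> hf hg.
have h0 : rep (Cq_to_Cqx 0) (fun _ _ => 0) := represents_const _ _ 0.
have e : f + g = f - (Cq_to_Cqx 0 - g).
  by rewrite [Cq_to_Cqx 0](rmorph0 (Cqx_const C)) sub0r opprK.
rewrite e; apply: represents_ext (representsB hf (representsB h0 hg)) => al be _ _.
by rewrite sub0r opprK.
Qed.

Lemma represents0 : rep 0 (fun _ _ => 0).
Proof. by rewrite -[0 in X in represents _ _ X _](rmorph0 (Cqx_const C)); exact: represents_const. Qed.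

Lemma represents_sum (I : Type) (r : seq I) (f : I -> Cqx C) (phi : I -> nat -> nat -> F) :
  (forall i, rep (f i) (phi i)) ->
  rep (\sum_(i <- r) f i) (fun al be => \sum_(i <- r) phi i al be).
Proof.
move=> h; elim: r => [|i r IH].
  rewrite big_nil; apply: represents_ext represents0 => al be _ _; exact: esym (big_nil _ _ _ _).
rewrite big_cons; apply: represents_ext (representsD (h i) IH) => al be _ _.
by rewrite [RHS]big_cons.
Qed.

Lemma represents_exp f phi m : rep f phi -> rep (f ^+ m) (fun al be => phi al be ^+ m).
Proof.
move=> h; have := @represents_prod C b k _ (index_enum 'I_m) xpredT (fun _ => f) (fun _ => phi) (fun _ _ => h).
have -> : \prod_(i < m) f = f ^+ m by exact: etrans (prodr_const _ _) (congr1 _ (card_ord m)).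
apply: represents_ext => al be _ _.
exact: etrans (prodr_const _ _) (congr1 _ (card_ord m)).
Qed.

Lemma represents_mmap (N : nat) (v : 'I_N -> Cqx C) (psi : nat -> nat -> 'I_N -> F) (p : {mpoly F[N]}) :
  (forall i, rep (v i) (fun al be => psi al be i)) ->
  rep (mmap (Cqx_const C) v p) (fun al be => p.@[psi al be]).
Proof.
move=> h; apply: represents_sum => m; apply: representsM; first exact: represents_const.
by apply: represents_prod => i _; exact: represents_exp.
Qed.

Variables (n a : nat) (P : 'X_{1..n.+2} -> {mpoly (Cqt C)[n.+2]}) (lam : n.+2.-tuple int) (p : {mpoly F[n.+2]}).
Local Notation pl := (p@_(shifted_partition lam)).
Hypothesis pl0 : pl != 0.
Hypothesis specE : forall m, subst_t a.+1 (P (shifted_partition lam))@_m = p@_m / pl.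
Local Notation value := (laurent_eval p (sig_shift lam) pl).

Lemma represents_macdonald_at (v : 'I_n.+2 -> Cqx C) (psi : nat -> nat -> 'I_n.+2 -> F) :
  (forall i, rep (v i) (fun al be => psi al be i)) -> (forall al be i, psi al be i != 0) ->
  rep (macdonald_at P a.+1 lam v) (fun al be => value (psi al be)).
Proof.
move=> h nz; rewrite /macdonald_at.
rewrite (@mmap_rescale _ _ _ _ (Cqx_const C) (subst_t a.+1) v _ p pl (subst_t0 _ _) pl0 specE).
apply: representsM; last by apply: representsM; [exact: represents_const|exact: represents_mmap].
apply: representsV; first by apply: represents_exp; apply: represents_prod => i _; exact: h.
by move=> al be _ _; apply: expf_neq0; apply/prodf_neq0 => i _; exact: nz.
Qed.

Lemma represents_tpow m : rep ((q_Cqx C ^+ a.+1) ^+ m) (fun _ _ => (q ^+ a.+1) ^+ m).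
Proof. by do 2!apply: represents_exp; exact: represents_const. Qed.

Lemma represents_macdonald_char xs (psi : nat -> nat -> 'I_n.+2 -> F) :
  (forall i : 'I_n.+2, rep (nth 0 (xs ++ mkseq (fun j => (q_Cqx C ^+ a.+1) ^+ j) (n.+2 - size xs)) i)
     (fun al be => psi al be i)) -> (forall al be i, psi al be i != 0) ->
  rep (macdonald_char P a.+1 lam xs)
      (fun al be => value (psi al be) / value (principal_pt q a (n := n))).
Proof.
move=> h nz; rewrite /macdonald_char; apply: representsM; first exact: represents_macdonald_at.
(* [representsV] would ask for a nonzero value. Once recognized as a constant of C(q), the
   denominator is inverted through the field morphism instead, which also covers 0. *)
have e : macdonald_at P a.+1 lam (fun i => (q_Cqx C ^+ a.+1) ^+ i) =
    Cq_to_Cqx (value (principal_pt q a (n := n))).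
  apply: (@represents_unique C b k _ _ (fun _ _ => value (principal_pt q a (n := n)))).
    apply: (@represents_macdonald_at _ (fun _ _ => principal_pt q a (n := n))) => [i|_ _ i].
      exact: represents_tpow.
    exact: expf_neq0 _ (expf_neq0 _ (q_Cq_neq0 C)).
  exact: represents_const.
rewrite e; have -> : (Cq_to_Cqx (value (principal_pt q a (n := n))))^-1 =
    Cq_to_Cqx (value (principal_pt q a (n := n)))^-1 by exact: esym (fmorphV (Cqx_const C) _).
exact: represents_const.
Qed.

Lemma represents_char2 : rep (macdonald_char P a.+1 lam [:: var C 0; var C 1])
  (fun al be => value (two_row_pt q a al be) / value (principal_pt q a (n := n))).
Proof.
apply: represents_macdonald_char => [i|al be i].
  case: i => -[|[|i]] lt; rewrite /two_row_pt; [exact: represents_var|exact: represents_var|].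
  rewrite [nth _ _ _](nth_mkseq 0); last by rewrite subn2.
  apply: represents_ext (represents_tpow i) => al be _ _.
  by rewrite [RHS](nth_mkseq 0).
exact: two_row_pt_neq0 (q_Cq_neq0 C) _ _ _.
Qed.

Lemma represents_char1 (j : 'I_2) : rep (macdonald_char P a.+1 lam [:: var C j])
  (fun al be => value (one_row_pt q a (if j == 0 then al else be)) / value (principal_pt q a (n := n))).
Proof.
apply: (@represents_macdonald_char _ (fun al be => one_row_pt q a (if j == 0 then al else be))) => [i|al be i].
  case: i => -[|i] lt; rewrite /one_row_pt; first exact: represents_var.
  rewrite [nth _ _ _](nth_mkseq 0); last by rewrite subn1.
  apply: represents_ext (represents_tpow i) => al be _ _.
  by rewrite [RHS](nth_mkseq 0).
exact: one_row_pt_neq0 (q_Cq_neq0 C) _ _.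
Qed.

Lemma represents_qpow (e : int) : rep (q_Cqx C ^ e) (fun _ _ => q ^ e).
Proof.
have -> : q_Cqx C ^ e = Cq_to_Cqx (q ^ e) by exact: esym (fmorphXz (Cqx_const C) e q).
exact: represents_const.
Qed.

Lemma represents_sub_qpow (j : 'I_2) (e : int) :
  rep (var C j - q_Cqx C ^ e) (fun al be => q ^+ (if j == 0 then al else be) - q ^ e).
Proof. exact: representsB (represents_var C b k j) (represents_qpow e). Qed.

End CharacterRepresentation.

Lemma prod_ord2 (R : comNzRingType) (G : 'I_2 -> R) : \prod_(i < 2) G i = G 0 * G 1.
Proof. by rewrite big_ord_recl big_ord1; congr (_ * G _); apply: val_inj. Qed.

(** * From lattice points to the identity of rational functions *)

Section Formula.
Variables (C : fieldType) (n a : nat) (P : 'X_{1..n.+2} -> {mpoly (Cqt C)[n.+2]}).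
Variables (lam : n.+2.-tuple int) (p : {mpoly (Cq C)[n.+2]}).
Local Notation th := a.+1.
Local Notation q := (q_Cq C).
Local Notation b0 := (th * n)%N.
Local Notation pl := (p@_(shifted_partition lam)).
Hypothesis pl0 : pl != 0.
Hypothesis specE : forall m, subst_t th (P (shifted_partition lam))@_m = p@_m / pl.
Hypothesis char2 : 2%:R != 0 :> Cq C.
Hypothesis sp : p \is symmetric.
Hypothesis eig : forall r, exists eta : Cq C, forall x : 'I_n.+2 -> Cq C,
  noumi q a r idfun x p = eta * p.@[x] * (vdm x * cross a q x x).

Lemma represents_row_char_prod : represents b0 0
  (\prod_(i < 2) (macdonald_char P th lam [:: var C i]
            * \prod_(1 <= j < (th * n.+2)%N) (var C i - q_Cqx C ^ (j%:Z - th%:Z))))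
  (fun al be => row_char q a p (sig_shift lam) pl al * row_char q a p (sig_shift lam) pl be).
Proof.
pose phi (i : 'I_2) al be := row_char q a p (sig_shift lam) pl (if i == 0 then al else be).
apply: (@represents_ext _ _ _ _ (fun al be => \prod_(i < 2) phi i al be)).
  by move=> al be _ _; exact: prod_ord2.
apply: represents_prod => i _; apply: representsM; first exact: represents_char1.
by apply: represents_prod => j _; exact: represents_sub_qpow.
Qed.

(** The zeros q^(i - theta) with i < theta (N-1) have exponents below theta n, which [b0 <= be < al]
    excludes. *)
Lemma represents_denominator k : represents b0 k
  (\prod_(1 <= i < (th * (n.+2 - 1))%N)
         ((var C 0 - q_Cqx C ^ (i%:Z - th%:Z)) * (var C 1 - q_Cqx C ^ (i%:Z - th%:Z))))^-1
  (fun al be => (\prod_(1 <= i < (th * (n.+2 - 1))%N)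
         ((q ^+ al - q ^ (i%:Z - th%:Z)) * (q ^+ be - q ^ (i%:Z - th%:Z))))^-1).
Proof.
apply: representsV.
  by apply: represents_prod => i _; apply: representsM; exact: represents_sub_qpow.
have nz g i : (b0 <= g)%N -> (i < th * n.+1)%N -> q ^+ g - q ^ (i%:Z - th%:Z) != 0.
  move=> lg li; rewrite subr_eq0; apply/eqP => /(congr1 (fun z => z * q ^+ th)).
  rewrite -exprD [q ^+ th in RHS]exprnP -expfzDr ?q_Cq_neq0 // subrK -exprnP.
  by move/(expr_inj (q_Cq_neq0 C) (q_Cq_pow C)); rewrite mulnS in li; lia.
move=> al be lb lk; rewrite prodf_seq_neq0; apply/allP => i /=.
rewrite mem_index_iota subSS subn0 => /andP[_ li]; apply: mulf_neq0; apply: nz => //; lia.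
Qed.

Lemma represents_prefactor k (e : int) : represents b0 k
  (q_Cqx C ^ e * (1 - q_Cqx C) ^+ th / \prod_(1 <= i < th.+1) (1 - q_Cqx C ^+ (th * n.+2 - i)%N))
  (fun _ _ => q ^ e * (1 - q) ^+ th / \prod_(1 <= i < th.+1) (1 - q ^+ (th * n.+2 - i)%N)).
Proof.
have one : represents b0 k (1 : Cqx C) (fun _ _ => 1).
  have -> : 1 = Cq_to_Cqx 1 :> Cqx C by exact: esym (rmorph1 (Cqx_const C)).
  exact: represents_const.
have qq : represents b0 k (q_Cqx C) (fun _ _ => q) by exact: represents_const.
apply: representsM; first apply: representsM; first exact: represents_qpow.
  apply: represents_exp; exact: representsB one qq.
apply: representsV.
  by apply: represents_prod => i _; apply: representsB one _; exact: represents_exp.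
move=> al be _ _; rewrite prodf_seq_neq0; apply/allP => i /=.
rewrite mem_index_iota subr_eq0 eq_sym => /andP[i0 lti]; apply: q_Cq_pow; rewrite !mulnS; lia.
Qed.

Lemma macdonald_char_two_variables :
  macdonald_char P th lam [:: var C 0; var C 1] =
  q_Cqx C ^ ((- (2 * n.+2%:Z - 3) * th%:Z ^+ 2 + th%:Z) %/ 2)%Z
    * (1 - q_Cqx C) ^+ th
    / \prod_(1 <= i < th.+1) (1 - q_Cqx C ^+ (th * n.+2 - i)%N)
    * (\prod_(1 <= i < (th * (n.+2 - 1))%N)
         ((var C 0 - q_Cqx C ^ (i%:Z - th%:Z)) * (var C 1 - q_Cqx C ^ (i%:Z - th%:Z))))^-1
    * iter th (@diff_step C)
        (\prod_(i < 2)
           (macdonald_char P th lam [:: var C i]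
            * \prod_(1 <= j < (th * n.+2)%N) (var C i - q_Cqx C ^ (j%:Z - th%:Z)))).
Proof.
apply: (@represents_unique C b0 th _ _ _ (represents_char2 b0 th pl0 specE)).
have h := representsM (representsM (represents_prefactor th _) (represents_denominator th))
  (represents_iter th represents_row_char_prod).
apply: represents_ext (h _) => al be lb lk.
(* Every point of the region has the shape required by [lattice_char_identity]: [b0 <= be] provides
   b, and be + theta < al provides a positive d.+1. *)
have eb : be = (be - b0 + b0)%N by rewrite subnK.
have ea : al = (be - b0 + (al - be - th.+1).+1 + th * n.+1)%N by rewrite mulnS; lia.
rewrite eb ea; symmetry.
exact: (lattice_char_identity char2 (q_Cq_neq0 C) (q_Cq_pow C) sp eig (sig_shift lam) pl).
Qed.

End Formula.

Unset Implicit Arguments.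

(* The exponent of q in the prefactor is -(N - 3/2) theta^2 + theta / 2, whose
   double - (2 N - 3) theta^2 + theta is always even: the division is exact. *)
Theorem theorem1p2 (R : realType) (theta N : nat) (lam : N.-tuple int)
    (P : 'X_{1..N} -> {mpoly (Cqt R[i])[N]}) :
  (0 < theta)%N -> (2 <= N)%N -> is_signature lam -> is_macdonald P ->
  let q := q_Cqx R[i] in
  let x := var R[i] in
  macdonald_char P theta lam [:: x 0; x 1]
  = q ^ ((- (2 * N%:Z - 3) * theta%:Z ^+ 2 + theta%:Z) %/ 2)%Z
    * (1 - q) ^+ theta
    / \prod_(1 <= i < theta.+1) (1 - q ^+ (theta * N - i)%N)
    * (\prod_(1 <= i < (theta * (N - 1))%N)
         ((x 0 - q ^ (i%:Z - theta%:Z)) * (x 1 - q ^ (i%:Z - theta%:Z))))^-1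
    * iter theta (@diff_step R[i])
        (\prod_(i < 2)
           (macdonald_char P theta lam [:: x i]
            * \prod_(1 <= j < (theta * N)%N)
                (x i - q ^ (j%:Z - theta%:Z)))).
Proof.
move=> th0 N2 sl macP; case: theta th0 => // a _; case: N lam P N2 sl macP => [|[|n]] // lam P _ sl macP.
have [p [below lead orth specE]] := macdonald_specialization a macP (is_partition_shifted sl).
have char2 : 2%:R != 0 :> Cq R[i].
  by rewrite -(rmorph_nat (@FracField.tofrac {poly R[i]})) tofrac_eq0 -polyC_natr polyC_eq0 pnatr_eq0.
apply: (macdonald_char_two_variables lead specE char2 (proj1 below)) => r.
exact: (noumi_eigenvalue r (q_Cq_neq0 _) (@q_Cq_pow _) char2 below lead orth (@mform_nondegenerate _ _ a _)).
Qed.
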